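(* Assume $\mathbb{E}(B_1^2)<\infty$. As $\rho_1 \uparrow \frac{c_2}{c_1+c_2}$, $$\left(\frac{c_2}{c_1+c_2}-\rho_1\right)V_1 \overset{d}{\longrightarrow} Z,$$ where $Z$ is an exponentially distributed random variable with mean $$\frac{c_1c_2}{(c_1+c_2)^3}+\frac{c_2}{c_1+c_2}\,\frac12\,\frac{\mathbb{E}(B_1^2)}{\mathbb{E}(B_1)}.$$
   Context: Model (two-queue polling with exponential timers). Customers arrive at queue $i$ according to independent Poisson processes with rates $\lambda_i>0$, $i=1,2$. Service times at queue $i$ are i.i.d. positive random variables distributed as $B_i$, with finite mean and Laplace-Stieltjes transform $\tilde b_i(s)=\mathbb{E}(e^{-sB_i})$, $\mathrm{Re}\, s\ge 0$. All arrival processes, service times and residing times are independent. A single server alternates between the queues: it stays at queue $i$ for an exponentially distributed residing time $T_i$ with rate $c_i>0$, regardless of the queue contents (it stays even if the queue is empty), and then switches instantaneously to the other queue (no switch-over time). While at queue $i$ the server serves only customers of queue $i$, at unit speed, in first-come-first-served order. A service interrupted by a switch is resumed where it stopped at the next visit (preemptive-resume). $\rho_i=\lambda_i\mathbb{E}(B_i)$. The system is stable: $\rho_1<\frac{c_2}{c_1+c_2}$ and $\rho_2<\frac{c_1}{c_1+c_2}$. $V_1$ denotes a random variable with the steady-state distribution (at an arbitrary epoch) of the workload of queue 1, i.e. the total amount of remaining service time present in queue 1. Heavy-traffic limit: $\rho_1\uparrow \frac{c_2}{c_1+c_2}$ by letting $\lambda_1$ increase, with the distribution of $B_1$ and the rates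 $c_1,c_2$ (and the parameters of queue 2) fixed. *)

(* Defs.v *)
From HB Require Import structures.
From mathcomp Require Import all_boot all_order all_algebra finmap.
From mathcomp Require Import all_classical all_reals all_analysis.

Set Implicit Arguments.
Unset Strict Implicit.
Unset Printing Implicit Defensive.

Import Order.TTheory GRing.Theory Num.Theory.
Import numFieldNormedType.Exports.

Local Open Scope classical_set_scope.
Local Open Scope ring_scope.

Variant queue : Set := Q1 | Q2.

Definition other_queue (i : queue) : queue := if i is Q1 then Q2 else Q1.

Definition bool_of_queue (i : queue) : bool := if i is Q1 then true else false.
Definition queue_of_bool (b : bool) : queue := if b then Q1 else Q2.
Lemma bool_of_queueK : cancel bool_of_queue queue_of_bool.
Proof. by case. Qed.
HB.instance Definition _ := Choice.copy queue (can_type bool_of_queueK).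

Variant input : Set := Interarrival | Service | Residing.

Definition option_of_input (k : input) : option bool :=
  match k with Interarrival => None | Service => Some true | Residing => Some false end.
Definition input_of_option (o : option bool) : input :=
  match o with None => Interarrival | Some true => Service | Some false => Residing end.
Lemma option_of_inputK : cancel option_of_input input_of_option.
Proof. by case. Qed.
HB.instance Definition _ := Choice.copy input (can_type option_of_inputK).

Section probability_notions.
Context {R : realType}.

Definition mutually_independent (d : measure_display) (T : measurableType d)
    (P : probability T R) (I : choiceType) (X : I -> {RV P >-> R}) : Prop :=
  forall (J : {fset I}) (E : I -> set R), (forall i, measurable (E i)) ->
    P (\bigcap_(i in [set` J]) (X i @^-1` E i)) =
    (\prod_(i <- J) P (X i @^-1` E i))%E.

Definition has_law (d : measure_display) (T : measurableType d)
    (P : probability T R) (X : {RV P >-> R}) (mu : set R -> \bar R) : Prop :=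
  forall A : set R, measurable A -> distribution P X A = mu A.

(* The variables X i may live on different probability spaces. *)
Definition cvg_in_law (I : Type) (F : set_system I) (d : I -> measure_display)
    (T : forall i, measurableType (d i)) (P : forall i, probability (T i) R)
    (X : forall i, T i -> R) (mu : set (measurableTypeR R) -> \bar R) : Prop :=
  forall f : R -> R, continuous f -> (exists M : R, forall x, `|f x| <= M) ->
    (fun i => \int[P i]_w (f (X i w))%:E)%E @ F --> (\int[mu]_x (f x)%:E)%E.

(* Real-valued; meaningful when the expectation is finite. *)
Definition mean (d : measure_display) (T : measurableType d)
    (P : probability T R) (X : T -> R) : R := fine ('E_P[X])%E.

End probability_notions.

(* The sample path determined by the initial position j0 of the server, the
   interarrival times A i n, the service times S i n and the residing times
   D i n, where D i n is the length of the n-th stay of the server at queue i.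
   Both queues are empty at time 0. *)
Section sample_path.
Context {R : realType} (j0 : queue) (A S D : queue -> nat -> R).

Definition arrival_epoch (i : queue) (n : nat) : R := \sum_(k < n.+1) A i k.

(* The stays of the server, at either queue, are numbered from 0; stay k is
   stay number k./2 at its own queue. *)
Definition queue_of_stay (k : nat) : queue :=
  if odd k then other_queue j0 else j0.

Definition switch_epoch (k : nat) : R :=
  \sum_(m < k) D (queue_of_stay m) m./2.

(* Total time spent by the server at queue i during [0, t]: stay k occupies
   the time interval [switch_epoch k, switch_epoch k.+1). *)
Definition server_time (i : queue) (t : R) : R :=
  fine (\sum_(k <oo | queue_of_stay k == i)
    (Num.min (switch_epoch k.+1) t - Num.min (switch_epoch k) t)%:E)%E.

(* Value of the clock [server_time i] at which the service of customer n of
   queue i is completed. Under first-come-first-served preemptive-resume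
   service at unit speed, this service starts, on that clock, at the later of
   the arrival of customer n and the completion of customer n - 1, and then
   lasts S i n. *)
Fixpoint completion (i : queue) (n : nat) : R :=
  let a := server_time i (arrival_epoch i n) in
  (if n is m.+1 then Num.max a (completion i m) else a) + S i n.

(* Before its service starts, customer n has completion - clock >= S i n. *)
Definition remaining_service (i : queue) (n : nat) (t : R) : R :=
  Num.max 0 (Num.min (S i n) (completion i n - server_time i t)).

Definition workload (i : queue) (t : R) : R :=
  fine (\sum_(n <oo | (arrival_epoch i n <= t)%R) (remaining_service i n t)%:E)%E.

End sample_path.

Section polling_model.
Context {R : realType}.

Definition polling_inputs (dB : measure_display) (TB : measurableType dB)
    (Q : probability TB R) (B : queue -> {RV Q >-> R}) (lam c : queue -> R)
    (d : measure_display) (T : measurableType d) (P : probability T R)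
    (X : input -> queue -> nat -> {RV P >-> R}) : Prop :=
  [/\ mutually_independent (fun j : input * queue * nat => X j.1.1 j.1.2 j.2),
      (forall i n, has_law (X Interarrival i n) (exponential_prob (lam i))),
      (forall i n, has_law (X Service i n) (distribution Q (B i))) &
      (forall i n, has_law (X Residing i n) (exponential_prob (c i)))].

(* mu is the limiting law, as t tends to infinity, of the workload of queue i
   at time t. The law of the inputs is determined by the parameters, so that
   the choice of their realization X is immaterial. *)
Definition steady_state_workload (dB : measure_display)
    (TB : measurableType dB) (Q : probability TB R)
    (B : queue -> {RV Q >-> R}) (lam c : queue -> R) (i : queue)
    (mu : set (measurableTypeR R) -> \bar R) : Prop :=
  exists (d : measure_display) (T : measurableType d) (P : probability T R)
    (X : input -> queue -> nat -> {RV P >-> R}) (j0 : queue),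
    polling_inputs B lam c X /\
    cvg_in_law +oo%R (fun _ : R => P)
      (fun t w => workload j0 (fun j n => X Interarrival j n w)
         (fun j n => X Service j n w) (fun j n => X Residing j n w) i t) mu.

End polling_model.

(* Main.v *)
(* Let [phi s] and [b s] be the Laplace transforms of the stationary workload and
   of the service time of queue 1, [L s = lambda1 * (1 - b s)] and
   [c = c1 + c2]. Along a path, [exp (- s * workload)] grows at relative rate [s]
   while the server works at queue 1, is multiplied by [exp (- s * service)] at
   the arrivals, and the stays at queue [i] end at rate [c_i]. Averaged over a
   uniform time in [[0, T]], as [T] tends to infinity, this gives
     [c1 x - c2 y + L x = s (x - p)]  and  [c2 y - c1 x + L y = 0],
   where [x] and [y] are the contributions to [phi s = x + y] of the times spent
   at queue 1 and at queue 2, and [p] is the probability that the server is idle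
   at queue 1, which does not depend on [s]. Hence
     [phi s * ((c2 + L s) / (c + L s) - L s / s) = p]  for all [s > 0],
   and [p = c2 / c - rho1] by letting [s] tend to 0. At [s = n * p] the
   second-order expansion of [b] gives [phi s --> 1 / (1 + n * m)] in heavy
   traffic, for every natural number [n], where [m] is the mean of the limit; by
   the Weierstrass theorem in the variable [exp (- x)], these values determine
   the limit law.

   Only finitely many customers and stays are considered at a time; the error is
   controlled by the probability that [N] interarrival times, or [K] residing
   times, add up to less than [T]. *)
Require Import Defs.
From HB Require Import structures.
From mathcomp Require Import all_boot all_order all_algebra finmap.
From mathcomp Require Import all_classical all_reals all_analysis.
From mathcomp Require Import measurable_realfun.
From mathcomp Require Import ring lra.
Set Implicit Arguments.
Unset Strict Implicit.
Unset Printing Implicit Defensive.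
Import Order.TTheory GRing.Theory Num.Theory.
Import numFieldNormedType.Exports.
Local Open Scope classical_set_scope.
Local Open Scope ring_scope.

(** No stationary version of the process is at hand: the hypothesis only says that the workload at
    time [t] converges in law. Hence the average over a uniform time in [[0, T]]: the boundary terms
    of the balance stay bounded, so they vanish after division by [T], and a Cesaro argument carries
    the limit in law over to the average. The averages behind [x], [y] and [p] are not known to
    converge separately; only [x + y] is. The two balance equations are therefore solved at finite
    [T], which writes the idle average in terms of [x + y] and of errors tending to 0, so that the
    existence of [p] comes out of the computation. The arrival and switching rates enter through the
    constant hazard of the exponential law: with everything else frozen, the mean of a function at
    the end of an exponential waiting period is the rate times its mean integral over that period.
    Since the inputs are nonnegative only almost surely, absolute values are taken throughout; the
    path identities then hold everywhere. *)

Notation ind b := ((nat_of_bool b%R)%:R).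

(** The class of all integrands below. It is stable under ring operations, composition and sections,
    and integrable for every probability, so that linearity and Fubini cost no side conditions. *)
Definition bmeas (R : realType) (d : measure_display) (T : measurableType d)
    (f : T -> R) : Prop :=
  measurable_fun setT f /\ exists M : R, forall x, `|f x| <= M.

(** * Integration of bounded measurable functions *)

Section bounded_measurable.
Context {R : realType} {d : measure_display} {T : measurableType d}.
Implicit Types f g : T -> R.

Lemma bmeas_cst (r : R) : bmeas (fun _ : T => r).
Proof. by split; [exact: measurable_cst | exists `|r|]. Qed.

Lemma bmeasD f g : bmeas f -> bmeas g -> bmeas (fun x => f x + g x).
Proof.
move=> [mf [M fM]] [mg [N gN]]; split; first exact: measurable_funD.
by exists (M + N) => x; rewrite (le_trans (ler_normD _ _))// lerD.
Qed.

Lemma bmeasN f : bmeas f -> bmeas (fun x => - f x).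
Proof.
move=> [mf [M fM]]; split; first exact: measurableT_comp.
by exists M => x; rewrite normrN.
Qed.

Lemma bmeasB f g : bmeas f -> bmeas g -> bmeas (fun x => f x - g x).
Proof. by move=> bf bg; apply: bmeasD => //; exact: bmeasN. Qed.

Lemma bmeasM f g : bmeas f -> bmeas g -> bmeas (fun x => f x * g x).
Proof.
move=> [mf [M fM]] [mg [N gN]]; split; first exact: measurable_funM.
by exists (M * N) => x; rewrite normrM ler_pM.
Qed.

Lemma bmeas_sum (I : Type) (s : seq I) (p : pred I) (F : I -> T -> R) :
  (forall i, bmeas (F i)) -> bmeas (fun x => \sum_(i <- s | p i) F i x).
Proof.
move=> bF; elim: s => [|i s ih].
  by under eq_fun do rewrite big_nil; exact: bmeas_cst.
under eq_fun do rewrite big_cons; case: (p i) => //; exact: bmeasD.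
Qed.

Lemma measurable_fun_natb (b : T -> bool) :
  measurable_fun setT b -> measurable_fun setT (fun x => (b x)%:R : R).
Proof.
move=> mb; rewrite (_ : (fun _ => _) = fun x => if b x then 1 else 0 : R).
  by apply: measurable_fun_ifT.
by apply/funext => x; case: (b x).
Qed.

Lemma bmeasb (b : T -> bool) : measurable_fun setT b ->
  bmeas (fun x => (b x)%:R : R).
Proof.
move=> mb; split; first exact: measurable_fun_natb.
by exists 1 => x; case: (b x); rewrite ?normr1 ?normr0.
Qed.

Lemma bmeas01 f : measurable_fun setT f -> (forall x, 0 <= f x <= 1) -> bmeas f.
Proof. by move=> mf f01; split => //; exists 1 => x; rewrite ger0_norm; case/andP: (f01 x). Qed.

Lemma bmeas_comp d' (T' : measurableType d') (f : T' -> R) (h : T -> T') :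
  bmeas f -> measurable_fun setT h -> bmeas (fun x => f (h x)).
Proof.
by move=> [mf [M fM]] mh; split; [exact: measurableT_comp | exists M].
Qed.

Variable P : probability T R.

Lemma bmeas_integrable f : bmeas f -> P.-integrable setT (EFin \o f).
Proof.
move=> [mf [M fM]]; apply: measurable_bounded_integrable => //.
- by rewrite [X in (X < _)%E](probability_setT P) ltry.
- exists M; split; first exact: num_real.
  by move=> N MN x _; apply: le_trans (fM x) _; exact: ltW.
Qed.

Lemma EFin_Rintegral f : bmeas f ->
  (\int[P]_x f x)%:E = (\int[P]_x (f x)%:E)%E.
Proof.
move=> bf; rewrite /Rintegral fineK//.
by apply: integrable_fin_num => //; exact: bmeas_integrable.
Qed.

Lemma bRintegralD f g : bmeas f -> bmeas g ->
  \int[P]_x (f x + g x) = \int[P]_x f x + \int[P]_x g x.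
Proof. by move=> bf bg; apply: RintegralD => //; exact: bmeas_integrable. Qed.

Lemma bRintegralB f g : bmeas f -> bmeas g ->
  \int[P]_x (f x - g x) = \int[P]_x f x - \int[P]_x g x.
Proof. by move=> bf bg; apply: RintegralB => //; exact: bmeas_integrable. Qed.

Lemma bRintegralZ (r : R) f : bmeas f ->
  \int[P]_x (r * f x) = r * \int[P]_x f x.
Proof. by move=> bf; apply: RintegralZl => //; exact: bmeas_integrable. Qed.

Lemma bRintegral_cst (r : R) : \int[P]_x r = r.
Proof. by rewrite Rintegral_cst// [X in fine X](probability_setT P) mulr1. Qed.

Lemma bRintegral_sum (I : Type) (s : seq I) (p : pred I) (F : I -> T -> R) :
  (forall i, bmeas (F i)) ->
  \int[P]_x (\sum_(i <- s | p i) F i x) = \sum_(i <- s | p i) \int[P]_x F i x.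
Proof.
move=> bF; elim: s => [|i s ih].
  by under eq_Rintegral do rewrite big_nil; rewrite bRintegral_cst big_nil.
under eq_Rintegral do rewrite big_cons; rewrite big_cons; case: (p i) => //.
by rewrite bRintegralD ?ih//; exact: bmeas_sum.
Qed.

Lemma le_bRintegral f g : bmeas f -> bmeas g -> (forall x, f x <= g x) ->
  \int[P]_x f x <= \int[P]_x g x.
Proof. by move=> bf bg fg; apply: le_Rintegral => //; exact: bmeas_integrable. Qed.

Lemma bRintegral_bnd f (a b : R) : bmeas f -> (forall x, a <= f x <= b) ->
  a <= \int[P]_x f x <= b.
Proof.
move=> bf ab; rewrite -{1}(bRintegral_cst a) -(bRintegral_cst b).
by apply/andP; split; apply: le_bRintegral => //; try exact: bmeas_cst;
  move=> x; case/andP: (ab x).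
Qed.

End bounded_measurable.

Section bounded_fubini.
Context {R : realType} {d1 d2 : measure_display}.
Context {T1 : measurableType d1} {T2 : measurableType d2}.
Variables (P1 : probability T1 R) (P2 : probability T2 R).
Variable f : T1 * T2 -> R.
Hypothesis bf : bmeas f.

Let bf1 x : bmeas (fun y => f (x, y)).
Proof. by case: bf => mf [M fM]; split; [exact: measurable_fun_pair2 | exists M]. Qed.
Let bf2 y : bmeas (fun x => f (x, y)).
Proof. by case: bf => mf [M fM]; split; [exact: measurable_fun_pair1 | exists M]. Qed.

Let if12 : (P1 \x P2)%E.-integrable setT (EFin \o f).
Proof.
case: bf => mf [M fM].
apply/integrable12ltyP; first exact/measurable_EFinP.
apply: (@le_lt_trans _ _ (\int[P1]_x (\int[P2]_y (M%:E))))%E; last first.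
  under eq_integral do rewrite integral_cst// [X in (_ * X)%E](probability_setT _) mule1.
  by rewrite integral_cst// [X in (_ * X)%E](probability_setT _) mule1 ltry.
apply: ge0_le_integral => //.
- by move=> x _; apply: integral_ge0.
- apply: (measurable_fun_fubini_tonelli_F (fun z => `|(f z)%:E|)%E) => //.
  by apply: measurableT_comp => //; apply/measurable_EFinP.
move=> x _; apply: ge0_le_integral => //.
- apply: measurableT_comp => //; apply/measurable_EFinP; exact: (bf1 x).1.
- by move=> y _; rewrite lee_fin.
Qed.

Lemma bmeas_fubini1 : bmeas (fun x => \int[P2]_y f (x, y)).
Proof.
case: (bf) => mf [M fM]; split.
  apply/measurable_EFinP.
  rewrite (_ : _ \o _ = fun x => \int[P2]_y (f (x, y))%:E)%E; last first.
    by apply/funext => x; rewrite /= EFin_Rintegral//; exact: bf1.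
  exact: (measurable_fubini_F if12).
by exists M => x; rewrite ler_norml; apply: bRintegral_bnd => // y;
  rewrite -ler_norml.
Qed.

Lemma bmeas_fubini2 : bmeas (fun y => \int[P1]_x f (x, y)).
Proof.
case: (bf) => mf [M fM]; split.
  apply/measurable_EFinP.
  rewrite (_ : _ \o _ = fun y => \int[P1]_x (f (x, y))%:E)%E; last first.
    by apply/funext => x; rewrite /= EFin_Rintegral//; exact: bf2.
  exact: (measurable_fubini_G if12).
by exists M => x; rewrite ler_norml; apply: bRintegral_bnd => // y;
  rewrite -ler_norml.
Qed.

Lemma bfubini : \int[P1]_x \int[P2]_y f (x, y) = \int[P2]_y \int[P1]_x f (x, y).
Proof.
rewrite /Rintegral; congr fine.
transitivity (\int[P1]_x \int[P2]_y (f (x, y))%:E)%E.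
  by apply: eq_integral => x _; rewrite -EFin_Rintegral//; exact: bf1.
rewrite (Fubini if12).
by apply: eq_integral => y _; rewrite -EFin_Rintegral//; exact: bf2.
Qed.

Lemma bfubini_prod : \int[(P1 \x P2)%E]_z f z = \int[P1]_x \int[P2]_y f (x, y).
Proof.
rewrite /Rintegral; congr fine.
rewrite -(integral12_prod_meas1 if12).
by apply: eq_integral => x _; apply/esym; rewrite -/(Rintegral _ _ _) EFin_Rintegral//; exact: bf1.
Qed.
End bounded_fubini.

Lemma bmeas_section1 (R : realType) (d1 d2 : measure_display)
    (T1 : measurableType d1) (T2 : measurableType d2) (f : T1 * T2 -> R) x :
  bmeas f -> bmeas (fun y => f (x, y)).
Proof. by case=> mf [M fM]; split; [exact: measurable_fun_pair2 | exists M]. Qed.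

Lemma bmeas_section2 (R : realType) (d1 d2 : measure_display)
    (T1 : measurableType d1) (T2 : measurableType d2) (f : T1 * T2 -> R) y :
  bmeas f -> bmeas (fun x => f (x, y)).
Proof. by case=> mf [M fM]; split; [exact: measurable_fun_pair1 | exists M]. Qed.

Lemma bRintegral2_sum (R : realType) (d1 d2 : measure_display)
    (T1 : measurableType d1) (T2 : measurableType d2)
    (P1 : probability T1 R) (P2 : probability T2 R)
    (J : Type) (r : seq J) (p : pred J) (F : J -> T1 * T2 -> R) :
  (forall j, bmeas (F j)) ->
  \int[P1]_x \int[P2]_y (\sum_(j <- r | p j) F j (x, y)) =
  \sum_(j <- r | p j) \int[P1]_x \int[P2]_y F j (x, y).
Proof.
move=> bF; rewrite -bRintegral_sum => [|j]; last exact: (bmeas_fubini1 P1 P2).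
apply: eq_Rintegral => x _; rewrite bRintegral_sum// => j.
exact: bmeas_section1.
Qed.
Arguments bRintegral2_sum {R d1 d2 T1 T2} P1 P2 {J r p} F.

Lemma bRintegral_pushforward (R : realType) (d d' : measure_display)
  (T : measurableType d) (T' : measurableType d') (P : probability T R)
  (X : {mfun T >-> T'}) (f : T' -> R) : bmeas f ->
  \int[distribution P X]_x f x = \int[P]_w f (X w).
Proof.
move=> bf; rewrite /Rintegral; congr fine.
rewrite integral_distribution//; first exact/measurable_EFinP/bf.1.
by apply: (bmeas_integrable P (f := f \o X)); apply: bmeas_comp.
Qed.

Lemma eq_measure_Rintegral (R : realType) (d : measure_display)
  (T : measurableType d) (mu nu : {measure set T -> \bar R}) (f : T -> R) :
  (forall A, measurable A -> mu A = nu A) ->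
  \int[mu]_x f x = \int[nu]_x f x.
Proof.
by move=> mn; rewrite /Rintegral; congr fine; apply: eq_measure_integral => A mA _; exact: mn.
Qed.

Lemma dominated_cvg_Rintegral (R : realType) (d : measure_display)
    (T : measurableType d) (P : probability T R) (F : nat -> T -> R)
    (f g : T -> R) :
  (forall n, measurable_fun setT (F n)) -> measurable_fun setT f ->
  (forall x, F n x @[n --> \oo] --> f x) ->
  P.-integrable setT (EFin \o g) -> (forall n x, `|F n x| <= g x) ->
  \int[P]_x F n x @[n --> \oo] --> \int[P]_x f x.
Proof.
move=> mF mf Ff ig Fg.
have mF' n : measurable_fun setT (fun x => (F n x)%:E).
  exact/measurable_EFinP.
have mf' : measurable_fun setT (EFin \o f) by exact/measurable_EFinP.
have Ff' : {ae P, forall x, setT x -> (F n x)%:E @[n --> \oo] --> (EFin \o f) x}.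
  by apply: aeW => x _; apply: cvg_EFin; [exact: nearW | exact: Ff].
have Fg' : {ae P, forall x n, setT x -> (`|(F n x)%:E| <= (EFin \o g) x)%E}.
  by apply: aeW => x n _ /=; rewrite lee_fin.
have [iF _ cvgF] := dominated_convergence measurableT mF' mf' Ff' ig Fg'.
have iff : (\int[P]_x (f x)%:E)%E \is a fin_num by exact: integrable_fin_num.
by apply: fine_cvg; rewrite fineK.
Qed.

Lemma bounded_cvg_Rintegral (R : realType) (d : measure_display)
    (T : measurableType d) (P : probability T R) (F : nat -> T -> R)
    (f : T -> R) (M : R) :
  (forall n, measurable_fun setT (F n)) -> measurable_fun setT f ->
  (forall x, F n x @[n --> \oo] --> f x) -> (forall n x, `|F n x| <= M) ->
  \int[P]_x F n x @[n --> \oo] --> \int[P]_x f x.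
Proof.
move=> mF mf Ff FM; apply: (dominated_cvg_Rintegral (g := cst M)) => //.
by apply: bmeas_integrable; exact: bmeas_cst.
Qed.

(** * The continuity theorem for Laplace transforms at the integers *)

Section weierstrass.
Context {R : realType}.
Implicit Types (phi psi : nat -> R) (x y : R).

(* The mean of [phi (X)] for a binomial variable [X] with parameters [n] and
   [y], computed by conditioning on the first trial. *)
Fixpoint bernstein (n : nat) phi y : R :=
  if n is m.+1 then
    (1 - y) * bernstein m phi y + y * bernstein m (fun k => phi k.+1) y
  else phi 0%N.

Lemma bernstein_poly n phi :
  exists p : {poly R}, forall y, p.[y] = bernstein n phi y.
Proof.
elim: n phi => [|n ih] phi.
  by exists (phi 0%N)%:P => y; rewrite hornerC.
have [p pE] := ih phi; have [q qE] := ih (fun k => phi k.+1).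
by exists ((1 - 'X) * p + 'X * q) => y; rewrite !hornerE pE qE.
Qed.

Lemma bernstein_cst n x y : bernstein n (fun=> x) y = x.
Proof. by elim: n => //= n ->; ring. Qed.

Lemma bernstein_lin n a b phi psi y :
  bernstein n (fun k => a * phi k + b * psi k) y =
  a * bernstein n phi y + b * bernstein n psi y.
Proof. by elim: n phi psi => //= n ih phi psi; rewrite !ih; ring. Qed.

Lemma le_bernstein n phi psi y : 0 <= y <= 1 ->
  (forall k, (k <= n)%N -> phi k <= psi k) ->
  bernstein n phi y <= bernstein n psi y.
Proof.
move=> /andP[y0 y1]; elim: n phi psi => [|n ih] phi psi pp /=.
  exact: pp.
apply: lerD; apply: ler_wpM2l; rewrite ?subr_ge0//; apply: ih => k kn.
- by apply: pp; rewrite (leq_trans kn).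
- exact: pp.
Qed.

(** Variance plus squared bias of a binomial variable. The induction needs all [x] at once, since a
    success in the first trial replaces [x] by [x - 1]. *)
Lemma bernstein_var n x y :
  bernstein n (fun k => (k%:R - x) ^+ 2) y
  = n%:R * (y * (1 - y)) + (n%:R * y - x) ^+ 2.
Proof.
elim: n x => [|n ih] x /=; first by ring.
rewrite ih.
rewrite (_ : (fun k => _) = fun k : nat => (k%:R - (x - 1)) ^+ 2); last first.
  by apply/funext => k; rewrite -natr1; ring.
by rewrite ih -natr1; ring.
Qed.

Lemma uniformly_continuous_01 (g : R -> R) (e : R) : continuous g -> 0 < e ->
  exists2 dl : R, 0 < dl & forall y z, 0 <= y <= 1 -> `|y - z| < dl ->
    `|g y - g z| < e.
Proof.
move=> cg e0.
(* Compactness in covering form: what holds locally in [y], for all small [dl], holds on the whole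
   segment for a common [dl]. *)
have := @segment_compact R 0 1; move/compact_near_coveringP.
move=> /(_ R (0 : R)^'+ (fun dl y => forall z, `|y - z| < dl ->
  `|g y - g z| < e) _)[].
  move=> x _.
  have e2 : 0 < e / 2 by rewrite divr_gt0.
  have /cvgrPdist_lt/(_ _ e2)[r /= r0 gr] := cg x.
  exists ([set y | `|x - y| < r / 2], [set dl : R | dl <= r / 2]).
    split => /=.
      by exists (r / 2) => //=; rewrite divr_gt0.
    by apply: nbhs_right_le; rewrite divr_gt0.
  move=> [y dl] /= [xy dlr] z yz.
  have gy : `|g x - g y| < e / 2 by apply: gr => /=; lra.
  have gz : `|g x - g z| < e / 2.
    apply: gr => /=; rewrite -(subrKA y).
    by apply: le_lt_trans (ler_normD _ _) _; lra.
  rewrite -(subrKA (g x)); apply: le_lt_trans (ler_normD _ _) _.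
  by rewrite distrC; lra.
move=> dl /= dl0 H.
have dl2 : 0 < dl / 2 by rewrite divr_gt0.
exists (dl / 2) => // y z y01 yz.
apply: (H (dl / 2)) => //=.
by rewrite sub0r normrN gtr0_norm//; lra.
Qed.

(** Bernstein's proof: the oscillation of [g] is at most [e / 2] near [y] and at most
    [K * (y - z) ^+ 2] away from it, as in Chebyshev's inequality, and the binomial mean of this
    square is at most [1 / n]. *)
Lemma weierstrass_approximation (g : R -> R) (e : R) : continuous g -> 0 < e ->
  exists p : {poly R}, forall y, 0 <= y <= 1 -> `|g y - p.[y]| <= e.
Proof.
move=> cg e0.
have e2 : 0 < e / 2 by rewrite divr_gt0.
have [dl dl0 gdl] := uniformly_continuous_01 cg e2.
have [c _ gc] := @EVT_max R (fun y => `|g y|) 0 1 ler01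
  (continuous_subspaceT (fun x => cvg_norm (cg x))).
set M := `|g c|.
have M0 : 0 <= M by exact: normr_ge0.
(* This [n] makes [K / n.+1%:R <= e / 2] for the constant [K = 2 * M / dl ^+ 2] below. *)
have [n nM] : exists n : nat, 4 * M / (dl ^+ 2 * e) < n.+1%:R.
  exists (Num.truncn (4 * M / (dl ^+ 2 * e))).
  by rewrite truncnS_gt// divr_ge0// mulr_ge0// ?ltW// exprn_gt0.
have [p pE] := bernstein_poly n.+1 (fun k => g (k%:R / n.+1%:R)).
exists p => y y01; rewrite pE.
pose K := 2 * M / dl ^+ 2.
have n0 : 0 < n.+1%:R :> R by rewrite ltr0n.
have d20 : 0 < dl ^+ 2 by rewrite exprn_gt0.
have K0 : 0 <= K by rewrite divr_ge0 ?mulr_ge0// ltW.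
have bnd k : (k <= n.+1)%N -> `|g y - g (k%:R / n.+1%:R)| <=
    e / 2 + K * (y - k%:R / n.+1%:R) ^+ 2.
  move=> kn; set z := k%:R / n.+1%:R.
  have z01 : 0 <= z <= 1.
    by rewrite divr_ge0//= ler_pdivrMr// mul1r ler_nat.
  have [yz|yz] := ltP `|y - z| dl.
    apply: le_trans (ltW (gdl _ _ y01 yz)) _.
    by rewrite lerDl mulr_ge0// sqr_ge0.
  apply: (@le_trans _ _ (M + M)).
    by apply: le_trans (ler_normB _ _) _; apply: lerD; apply: gc; rewrite in_itv.
  apply: (@le_trans _ _ (K * dl ^+ 2)).
    by rewrite /K mulfVK ?gt_eqF//; lra.
  have : dl ^+ 2 <= (y - z) ^+ 2.
    by rewrite -[leRHS]real_normK ?num_real// lerXn2r// nnegrE ltW.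
  by move=> /(ler_wpM2l K0); lra.
have var : bernstein n.+1 (fun k => (y - k%:R / n.+1%:R) ^+ 2) y <= n.+1%:R^-1.
  (* The summand with coefficient 0 only gives the two-term shape of [bernstein_lin]. *)
  rewrite (_ : (fun k => _) = fun k : nat =>
      n.+1%:R^-2 * (k%:R - n.+1%:R * y) ^+ 2 + 0 * (k%:R - n.+1%:R * y) ^+ 2); last first.
    apply/funext => k; field; by rewrite gt_eqF.
  rewrite bernstein_lin bernstein_var.
  rewrite (_ : _ + _ = n.+1%:R^-1 * (y * (1 - y))); last first.
    by field; rewrite gt_eqF.
  by rewrite ler_piMr ?invr_ge0//; case/andP: y01 => ? ?; nra.
have Kn : K / n.+1%:R <= e / 2.
  rewrite ler_pdivrMr// /K ler_pdivrMr//.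
  move: nM; rewrite ltr_pdivrMr ?mulr_gt0//; lra.
clearbody K M.
rewrite -[in g y](bernstein_cst n.+1 (g y) y).
pose up k : R := e / 2 + K * (y - k%:R / n.+1%:R) ^+ 2.
have upE : bernstein n.+1 up y <= e.
  rewrite (_ : up = fun k : nat => 1 * (e / 2) + K * (y - k%:R / n.+1%:R) ^+ 2); last first.
    by apply/funext => k; rewrite mul1r.
  rewrite bernstein_lin bernstein_cst mul1r.
  by rewrite [leRHS]splitr lerD2l; apply: le_trans Kn; exact: ler_wpM2l.
rewrite ler_norml; apply/andP; split.
  have : bernstein n.+1 (fun k => 1 * g (k%:R / n.+1%:R) + (-1) * g y) y <= e.
    apply: le_trans upE; apply: le_bernstein => // k kn.
    apply: le_trans (bnd _ kn); rewrite distrC.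
    by apply: le_trans (ler_norm _); lra.
  by rewrite bernstein_lin !bernstein_cst; lra.
have : bernstein n.+1 (fun k => 1 * g y + (-1) * g (k%:R / n.+1%:R)) y <= e.
  apply: le_trans upE; apply: le_bernstein => // k kn.
  apply: le_trans (bnd _ kn).
  by apply: le_trans (ler_norm _); lra.
by rewrite bernstein_lin !bernstein_cst; lra.
Qed.

End weierstrass.

Lemma cvg_sumr (R : realType) (I J : Type) (F : set_system I) {FF : Filter F}
    (s : seq J) (G : J -> I -> R) (l : J -> R) :
  (forall j, G j @ F --> l j) ->
  (fun i => \sum_(j <- s) G j i) @ F --> \sum_(j <- s) l j.
Proof.
move=> Gl; elim: s => [|j s ih].
  by rewrite big_nil; under eq_fun do rewrite big_nil; exact: cvg_cst.
by rewrite big_cons; under eq_fun do rewrite big_cons; exact: cvgD.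
Qed.

Section laplace_continuity.
Context {R : realType} (I : Type) (F : set_system I) {FF : Filter F}.
Context (d : I -> measure_display) (T : forall i, measurableType (d i)).
Variables (P : forall i, probability (T i) R) (X : forall i, T i -> R).
Arguments X : clear implicits.
Hypothesis mX : forall i, measurable_fun setT (X i).
Variable nu : probability (measurableTypeR R) R.
Hypothesis laplaceX : forall n : nat,
  (fun i => \int[P i]_w expR (- (n%:R * `|X i w|))) @ F -->
  \int[nu]_x expR (- (n%:R * `|x : R|)).

(** The moments of [Y] are the Laplace transforms at the integers, so [laplaceX] is convergence of
    the means of all polynomials in [Y]. *)
Let Y (x : R) : R := expR (- `|x|).

Let Y01 x : 0 <= Y x <= 1.
Proof. by rewrite expR_ge0/= -expR0 ler_expR oppr_le0. Qed.

Let mY i : measurable_fun setT (fun w => Y (X i w)).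
Proof.
apply: measurableT_comp => //; apply: measurableT_comp => //.
exact: measurableT_comp.
Qed.

Let mYnu : measurable_fun setT (Y : measurableTypeR R -> R).
Proof. by apply: measurableT_comp => //; apply: measurableT_comp. Qed.

Let bmeasX (g : R -> R) i : continuous g -> bmeas (fun w => g (Y (X i w))).
Proof.
move=> cg; split.
  by apply: measurableT_comp => //; exact: continuous_measurable_fun.
have [c _ gc] := @EVT_max R (fun y => `|g y|) 0 1 ler01
  (continuous_subspaceT (fun x => cvg_norm (cg x))).
by exists `|g c| => w; apply: gc; rewrite in_itv/=.
Qed.

Let bmeasnu (g : R -> R) : continuous g ->
  bmeas (fun x : measurableTypeR R => g (Y x)).
Proof.
move=> cg; split.
  by apply: measurableT_comp => //; exact: continuous_measurable_fun.
have [c _ gc] := @EVT_max R (fun y => `|g y|) 0 1 ler01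
  (continuous_subspaceT (fun x => cvg_norm (cg x))).
by exists `|g c| => w; apply: gc; rewrite in_itv/=.
Qed.

Let cvg_poly (p : {poly R}) :
  (fun i => \int[P i]_w p.[Y (X i w)]) @ F --> \int[nu]_x p.[Y x].
Proof.
have hornerY (x : R) : p.[Y x] = \sum_(k < size p) p`_k * expR (- (k%:R * `|x|)).
  rewrite horner_coef; apply: eq_bigr => k _.
  by rewrite /Y -expRM_natl mulrN.
have cexp k : continuous (fun x : R => expR (- (k%:R * `|x|))).
  move=> x; apply: continuous_comp; last exact: continuous_expR.
  by apply: cvgN; apply: cvgM; [exact: cvg_cst | exact: cvg_norm].
have bexp d' (U : measurableType d') (Z : U -> R) (k : nat) :
    measurable_fun setT Z -> bmeas (fun w => expR (- (k%:R * `|Z w|))).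
  move=> mZ; apply: bmeas01 => [|w].
    by apply: (measurableT_comp (continuous_measurable_fun (@cexp k))).
  by rewrite expR_ge0/= -expR0 ler_expR oppr_le0 mulr_ge0.
have intE d' (U : measurableType d') (Q : probability U R) (Z : U -> R) :
    measurable_fun setT Z -> \int[Q]_w p.[Y (Z w)] =
    \sum_(k < size p) p`_k * \int[Q]_w expR (- (k%:R * `|Z w|)).
  move=> mZ; under eq_Rintegral do rewrite hornerY.
  rewrite bRintegral_sum => [|k]; last first.
    by apply: bmeasM; [exact: bmeas_cst | exact: bexp].
  by apply: eq_bigr => k _; rewrite bRintegralZ//; exact: bexp.
rewrite (intE _ _ nu id)//.
rewrite (_ : (fun i => _) = fun i =>
    \sum_(k < size p) p`_k * \int[P i]_w expR (- (k%:R * `|X i w|))); last first.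
  by apply/funext => i; rewrite intE.
apply: cvg_sumr => k; apply: cvgM; first exact: cvg_cst.
exact: laplaceX.
Qed.

Let continuous_poly (p : {poly R}) : continuous (horner p).
Proof. exact: continuous_horner. Qed.

Let cvg_continuous (g : R -> R) : continuous g ->
  (fun i => \int[P i]_w g (Y (X i w))) @ F --> \int[nu]_x g (Y x).
Proof.
move=> cg; apply/cvgrPdist_le => /= e e0.
have e3 : 0 < (e : R) / 3 by rewrite divr_gt0.
have [p gp] := weierstrass_approximation cg e3.
have /cvgrPdist_le/(_ _ e3) := @cvg_poly p.
apply: filterS => i pi.
have close d' (U : measurableType d') (Q : probability U R) (Z : U -> R) :
    bmeas (fun w => g (Y (Z w))) -> bmeas (fun w => p.[Y (Z w)]) ->
    `|\int[Q]_w g (Y (Z w)) - \int[Q]_w p.[Y (Z w)]| <= e / 3.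
  move=> bg bp; rewrite -bRintegralB// ler_norml.
  apply: bRintegral_bnd => [|w]; first exact: bmeasB.
  by rewrite -ler_norml; exact: gp.
have h1 := close _ _ nu id (bmeasnu cg) (bmeasnu (@continuous_poly p)).
have h2 := close _ _ (P i) (X i) (bmeasX i cg) (bmeasX i (@continuous_poly p)).
move: h1 h2 pi; rewrite !ler_norml => /andP[? ?] /andP[? ?] /andP[? ?].
by apply/andP; split; lra.
Qed.

(** As a function of [Y], [f] need not extend continuously to [Y = 0], that is, to infinity. It is
    cut off there. The mass lost is small under [nu], and then also under [P i], because the cut-off
    is itself continuous in [Y], so that its mean converges. *)
Lemma laplace_continuity (f : R -> R) : continuous f ->
  (exists M, forall x, `|f x| <= M) ->
  (fun i => \int[P i]_w f `|X i w|) @ F --> \int[nu]_x f `|x : R|.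
Proof.
move=> cf [M0 fM0]; pose M := `|M0| + 1.
have M1 : 0 < M by rewrite ltr_wpDl.
have fM x : `|f x| <= M.
  by rewrite (le_trans (fM0 x))// (le_trans (ler_norm _))// lerDl.
(* A continuous cut-off: 0 for [m%:R * y <= 1] and 1 for [m%:R * y >= 2]. *)
pose h (m : nat) (y : R) := Num.min 1 (Num.max 0 (m%:R * y - 1)).
have ch m : continuous (h m).
  rewrite (_ : h m = (fun=> 1) \min ((fun=> 0) \max (fun y => m%:R * y - 1)))//.
  move=> y; apply: continuous_min; first exact: cvg_cst.
  apply: continuous_max; first exact: cvg_cst.
  by apply: cvgB; [apply: cvgM; [exact: cvg_cst | exact: cvg_id] | exact: cvg_cst].
have h01 m y : 0 <= h m y <= 1.
  by rewrite /h le_min ler01 ge_min lexx/= le_max lexx.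
(* The maximum keeps the argument of [ln] positive. It changes nothing, since [h m.+1] already
   vanishes for [y <= m.+2%:R^-1]. *)
pose g (m : nat) (y : R) := f (- ln (Num.max y (m.+2%:R^-1))) * h m.+1 y.
have cg m : continuous (g m).
  have cmax : continuous (fun y : R => Num.max y m.+2%:R^-1).
    by move=> y; apply: (@continuous_max _ _ id (fun=> m.+2%:R^-1));
      [exact: cvg_id | exact: cvg_cst].
  have cln : continuous (fun y : R => - ln (Num.max y m.+2%:R^-1)).
    move=> y; apply: cvgN; apply: (continuous_comp (cmax y)).
    by apply: continuous_ln; rewrite lt_max invr_gt0 ltr0n orbT.
  have cfln : continuous (fun y : R => f (- ln (Num.max y m.+2%:R^-1))).
    by move=> y; exact: (continuous_comp (cln y) (cf _)).
  by move=> y; apply: (cvgM (cfln y)); exact: ch.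
have gE m x : g m (Y x) = f `|x| * h m.+1 (Y x).
  rewrite /g; have [Ym|Ym] := leP (Y x) m.+2%:R^-1; last first.
    by rewrite /Y expRK opprK.
  rewrite [h _ _](_ : _ = 0) ?mulr0//.
  rewrite /h (_ : Num.max _ _ = 0) ?min_r//; apply/max_idPl.
  rewrite subr_le0; apply: le_trans (ler_wpM2l _ Ym) _ => //.
  by rewrite ler_pdivrMr// mul1r ler_nat.
have tail : (fun m => \int[nu]_x (1 - h m.+1 (Y x))) @ \oo --> (0 : R).
  rewrite -(bRintegral_cst nu 0).
  apply: (bounded_cvg_Rintegral (M := 1)).
  - move=> m; apply: measurable_funB => //.
    by apply: measurableT_comp => //; exact: continuous_measurable_fun.
  - exact: measurable_cst.
  - move=> x; apply/cvgrPdist_le => e e0; near=> m.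
    have Yx : 0 < Y x by exact: expR_gt0.
    have Ym : 2 <= m.+1%:R * Y x.
      rewrite -ler_pdivrMr//; near: m.
      exists (Num.truncn (2 / Y x)) => // m /=; rewrite -(ler_nat R) => km.
      apply: le_trans (ltW (truncnS_gt _)) _ => //.
      by rewrite -natr1 -[leRHS]natr1 lerD2r.
    rewrite /h max_r ?min_l; last 2 first.
    + by lra.
    + by lra.
    by rewrite subrr subrr normr0 ltW.
  - move=> m x; have /andP[? ?] := h01 m.+1 (Y x).
    by rewrite ger0_norm; lra.
apply/cvgrPdist_le => e e0.
(* Of the total error [e], a quarter is the tail under [nu], two quarters the tail under [P i],
   which may be twice as large, and a quarter the convergence for [g m]. *)
pose e4 := e / (4 * M).
have e40 : 0 < e4 by rewrite divr_gt0// mulr_gt0.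
have e4E : e4 * M = e / 4 by rewrite /e4; field; rewrite gt_eqF.
have [m tm] : exists m, \int[nu]_x (1 - h m.+1 (Y x)) <= e4.
  move/cvgrPdist_le : tail => /(_ _ e40)[m _ /(_ m (leqnn m))/=].
  by rewrite sub0r normrN => tm; exists m; apply: le_trans (ler_norm _) _.
have c1h : continuous (fun y => 1 - h m.+1 y).
  by move=> y; apply: cvgB; [exact: cvg_cst | exact: ch].
have e4' : 0 < e / 4 by rewrite divr_gt0.
have /cvgrPdist_le/(_ _ e4') := cvg_continuous (cg m).
have /cvgrPdist_le/(_ _ e40) := cvg_continuous c1h.
apply: filterS2 => i ti gi.
have close d' (U : measurableType d') (Q : probability U R) (Z : U -> R) :
    measurable_fun setT Z ->
    bmeas (fun w => g m (Y (Z w))) -> bmeas (fun w => 1 - h m.+1 (Y (Z w))) ->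
    `|\int[Q]_w f `|Z w| - \int[Q]_w g m (Y (Z w))| <=
      M * \int[Q]_w (1 - h m.+1 (Y (Z w))).
  move=> mZ bg bh.
  have bf : bmeas (fun w => f `|Z w|).
    split; last by exists M.
    apply: (measurableT_comp (continuous_measurable_fun cf)).
    exact: measurableT_comp.
  have bMh := bmeasM (bmeas_cst M) bh.
  rewrite -bRintegralB// -bRintegralZ// ler_norml; apply/andP; split.
    rewrite lerNl -[leLHS]mulN1r -bRintegralZ; last exact: bmeasB.
    apply: le_bRintegral => // [|w].
      by apply: bmeasM; [exact: bmeas_cst | exact: bmeasB].
    have /andP[? ?] := h01 m.+1 (Y (Z w)); rewrite gE.
    have := fM `|Z w|; rewrite ler_norml => /andP[? ?]; nra.
  apply: le_bRintegral => // [|w]; first exact: bmeasB.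
  have /andP[? ?] := h01 m.+1 (Y (Z w)); rewrite gE.
  have := fM `|Z w|; rewrite ler_norml => /andP[? ?]; nra.
have h1 := close _ _ nu id (@measurable_id _ _ _) (bmeasnu (cg m)) (bmeasnu c1h).
have h2 := close _ _ (P i) (X i) (@mX i) (bmeasX i (cg m)) (bmeasX i c1h).
set tn := \int[nu]_x (1 - h m.+1 (Y x)) in tm ti h1.
set tp := \int[P i]_x (1 - h m.+1 (Y (X i x))) in ti h2.
have h1' : M * tn <= e / 4 by rewrite -e4E mulrC ler_pM2r.
have h2' : M * tp <= e / 4 + e / 4.
  rewrite -e4E -mulrDl mulrC ler_pM2r//.
  by move: ti; rewrite ler_norml => /andP[? ?]; lra.
move: h1 h2 gi; rewrite !ler_norml => /andP[? ?] /andP[? ?] /andP[? ?].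
by apply/andP; split; lra.
Unshelve. all: end_near. Qed.

End laplace_continuity.

(** * Exponential laws *)

Import HBNNSimple.

(** The identity holds for simple functions by [nuE] and passes to the limit by monotone
    convergence. *)
Lemma ge0_integral_density (R : realType) (d : measure_display)
    (T : measurableType d) (mu nu : {measure set T -> \bar R}) (g : T -> R)
    (f : T -> \bar R) :
  measurable_fun setT g -> (forall x, 0 <= g x) ->
  (forall A, measurable A -> nu A = (\int[mu]_(x in A) (g x)%:E)%E) ->
  measurable_fun setT f -> (forall x, 0 <= f x)%E ->
  (\int[nu]_x f x = \int[mu]_x (f x * (g x)%:E))%E.
Proof.
move=> mg g0 nuE mf f0.
pose f_ := nnsfun_approx measurableT mf.
have f_f x : (f_ n x)%:E @[n --> \oo] --> f x by exact: cvg_nnsfun_approx.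
have f_nd x : nondecreasing_seq (fun n => (f_ n x)%:E).
  by move=> m n mn; rewrite lee_fin; exact/lefP/nd_nnsfun_approx.
have simple n : (\int[nu]_x (f_ n x)%:E = \int[mu]_x ((f_ n x)%:E * (g x)%:E))%E.
  under eq_integral do rewrite fimfunE -fsumEFin//.
  rewrite ge0_integral_fsum//; last 2 first.
    - by move=> r; exact/measurable_EFinP/measurableT_comp.
    - by move=> r x _; rewrite EFinM nnfun_muleindic_ge0.
  under [RHS]eq_integral.
    move=> x _; rewrite fimfunE -fsumEFin// muleC ge0_mule_fsumr; last first.
      by move=> r; rewrite EFinM nnfun_muleindic_ge0.
    over.
  rewrite ge0_integral_fsum//; last 2 first.
    - move=> r; apply: emeasurable_funM; apply/measurable_EFinP => //.
      by apply: measurable_funM => //; exact: measurable_indic.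
    - move=> r x _; rewrite mule_ge0 ?lee_fin//.
      by have := nnfun_muleindic_ge0 (f_ n) r x; rewrite -EFinM lee_fin.
  apply: eq_fsbigr => r _.
  have mA : measurable (f_ n @^-1` [set r]) by exact: measurable_sfunP.
  rewrite integralZl_indic_nnsfun// integral_indic// setIT nuE//.
  under [RHS]eq_integral do rewrite EFinM muleCA.
  have [r0|r0] := ltP r 0.
    rewrite preimage_nnfun0// integral_set0 mule0 integral0_eq// => x _.
    by rewrite indic0 mule0 mule0.
  rewrite ge0_integralZl//; last 2 first.
    - by apply: emeasurable_funM; apply/measurable_EFinP => //; exact: measurable_indic.
    - by move=> x _; rewrite -EFinM lee_fin mulr_ge0.
  by rewrite integral_mkcond; congr (_ * _)%E; apply: eq_integral => x _;
    rewrite /= patchE indicE; case: ifPn => _; rewrite ?mule1 ?mule0.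
transitivity (limn (fun n => \int[nu]_x (f_ n x)%:E)%E).
  rewrite -monotone_convergence//.
  - by apply: eq_integral => x _; apply/esym/cvg_lim => //; exact: f_f.
  - by move=> n; exact/measurable_EFinP.
  - by move=> n x _; rewrite lee_fin.
under eq_fun do rewrite simple.
rewrite -monotone_convergence//.
- apply: eq_integral => x _; apply/cvg_lim => //.
  by apply: cvgeZr => //; exact: f_f.
- by move=> n; apply: emeasurable_funM; exact/measurable_EFinP.
- by move=> n x _; rewrite mule_ge0 ?lee_fin.
- by move=> x _ m n mn; rewrite lee_wpmul2r ?lee_fin//; have := f_nd x _ _ mn; rewrite lee_fin.
Qed.

(** The shifted measure agrees with Lebesgue measure on half-open intervals, which determine it. *)
Lemma ge0_integral_lebesgue_shift (R : realType) (a : R) (f : R -> \bar R) :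
  measurable_fun setT f -> (forall x, 0 <= f x)%E ->
  (\int[lebesgue_measure]_x f (a + x)%R = \int[lebesgue_measure]_x f x)%E.
Proof.
move=> mf f0.
pose phi : measurableTypeR R -> measurableTypeR R := fun x => a + x.
have mphi : measurable_fun setT phi by apply: measurable_funD.
transitivity (\int[pushforward lebesgue_measure phi]_x f x)%E.
  by rewrite ge0_integral_pushforward.
apply: eq_measure_integral => A mA _; apply/esym/lebesgue_measure_unique => //.
move=> _ [[x y]] _ <-; rewrite /= /pushforward.
rewrite (_ : phi @^-1` _ = `]x - a, y - a]%classic); last first.
  by apply/seteqP; split => z; rewrite /phi/= !in_itv/= ltrBlDl lerBrDl.
by rewrite !lebesgue_measure_itv/= !lte_fin ltrD2r -!EFinD (_ : y - a - (x - a) = y - x)//; ring.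
Qed.

Definition exponential_law (R : realType) (r : R) (r0 : 0 < r) :
    probability (measurableTypeR R) R :=
  exponential_distribution_exponential_prob__canonical__probability_measure_Probability r0.

Section exponential.
Context {R : realType} (r : R) (r0 : 0 < r).

Lemma ge0_integral_exponential (f : R -> \bar R) :
  measurable_fun setT f -> (forall x, 0 <= f x)%E ->
  (\int[exponential_law r0]_x f x =
   \int[lebesgue_measure]_x (f x * (exponential_pdf r x)%:E))%E.
Proof.
move=> mf f0.
apply: (@ge0_integral_density _ _ _ lebesgue_measure (exponential_law r0)) => //.
- exact: measurable_exponential_pdf.
- by move=> x; rewrite exponential_pdf_ge0// ltW.
Qed.

(** Absorbs the single point at which strict and large inequalities, or the density at its jump,
    disagree. *)
Lemma ge0_ae_eq_lebesgue_pt (p : R) (f g : R -> R) :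
  measurable_fun setT f -> measurable_fun setT g ->
  (forall x, 0 <= f x) -> (forall x, 0 <= g x) ->
  (forall x, x != p -> f x = g x) ->
  (\int[lebesgue_measure]_x (f x)%:E = \int[lebesgue_measure]_x (g x)%:E)%E.
Proof.
move=> mf mg f0 g0 fg; apply: ge0_ae_eq_integral => //.
- exact/measurable_EFinP.
- exact/measurable_EFinP.
- by move=> x _; rewrite lee_fin.
- by move=> x _; rewrite lee_fin.
exists [set p]; split => //; first exact: lebesgue_measure_set1.
move=> x /= fgx; apply: contrapT => /eqP xp; apply: fgx => _.
by rewrite fg.
Qed.

Lemma exponential_pdf_shift (x z : R) : 0 <= x -> 0 <= z ->
  exponential_pdf r (x + z) = expR (- (r * x)) * exponential_pdf r z.
Proof.
move=> x0 z0; rewrite !exponential_pdfE ?addr_ge0//.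
by rewrite mulrCA -expRD; congr (_ * expR _); ring.
Qed.

(** Memorylessness: after a shift by [x], the density is [expR (- (r * x))] times itself on the
    half-line, where it has total mass 1. *)
Lemma exponential_tail (b : bool) (x : R) : 0 <= x ->
  \int[exponential_law r0]_y ind (if b then x < y else x <= y) =
  expR (- (r * x)).
Proof.
move=> x0.
have mb : measurable_fun [set: measurableTypeR R]
    (fun y => if b then x < y else x <= y).
  by case: b; [apply: measurable_fun_ltr | apply: measurable_fun_ler].
have mpdf := measurable_exponential_pdf r.
have pdf0 z : 0 <= exponential_pdf r z by rewrite exponential_pdf_ge0// ltW.
have mb0 : measurable_fun [set: measurableTypeR R]
    (fun y : R => if b then 0 < y else 0 <= y).
  by case: b {mb}; [apply: measurable_fun_ltr | apply: measurable_fun_ler].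
have mbp : measurable_fun [set: measurableTypeR R]
    (EFin \o (fun y : R => ind (if b then 0 < y else 0 <= y) * exponential_pdf r y)).
  by apply/measurable_EFinP; apply: measurable_funM => //; exact: measurable_fun_natb.
apply: EFin_inj; rewrite EFin_Rintegral; last exact: bmeasb.
rewrite ge0_integral_exponential//; last first.
  exact/measurable_EFinP/measurable_fun_natb.
under eq_integral do rewrite -EFinM.
rewrite -(@ge0_integral_lebesgue_shift _ x); last 2 first.
- by apply/measurable_EFinP; apply: measurable_funM => //; exact: measurable_fun_natb.
- by move=> y; rewrite lee_fin mulr_ge0.
transitivity (\int[lebesgue_measure]_y ((expR (- (r * x)))%:E *
  (ind (if b then (0 : R) < y else (0 : R) <= y) * exponential_pdf r y)%:E))%E.
  apply: eq_integral => y _; rewrite -EFinM ltrDl lerDl; congr (_%:E).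
  have [y0|y0] := leP (0 : R) y; first by rewrite exponential_pdf_shift// mulrCA.
  have -> : (if b then (0 : R) < y else false) = false.
    by case: (b) => //; apply/negbTE; rewrite -leNgt ltW.
  by rewrite !mul0r mulr0.
rewrite ge0_integralZl//; last first.
  by move=> y _; rewrite lee_fin mulr_ge0.
rewrite (@ge0_ae_eq_lebesgue_pt 0 _ (exponential_pdf r))//.
- by rewrite integral_exponential_pdf// mule1.
- by apply: measurable_funM => //; exact: measurable_fun_natb.
- by move=> y; rewrite mulr_ge0.
- move=> y; rewrite neq_lt => /orP[y0|y0].
    by rewrite lt0_exponential_pdf// mulr0.
  by rewrite ltW// y0; case: (b); rewrite mul1r.
Qed.

(** Waiting periods contain their left end for [b = true], used for interarrival times to match
    [between], and their right end for [b = false], used for stays to match [in_stay]. *)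
Definition in_span (b : bool) (a u x : R) : bool :=
  if b then (a <= u) && (u < a + x) else (a < u) && (u <= a + x).

Lemma exponential_in_span (b : bool) (a u : R) :
  \int[exponential_law r0]_x ind (in_span b a u x) =
  ind (if b then a <= u else a < u) * expR (- (r * (u - a))).
Proof.
have [au|au] := boolP (if b then a <= u else a < u); last first.
  rewrite mul0r -[RHS](bRintegral_cst (exponential_law r0)).
  apply: eq_Rintegral => x _; rewrite /in_span.
  by case: (b) au => /negbTE ->.
rewrite mul1r -(exponential_tail b); last first.
  by rewrite subr_ge0; case: (b) au => // /ltW.
apply: eq_Rintegral => x _; rewrite /in_span.
by case: (b) au => ->; rewrite ?ltrBlDl ?lerBlDl.
Qed.

(* The compensator of a point process with exponential waiting times: the
   integral on the right is over the last waiting period. *)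
Lemma exponential_compensator (b : bool) (a : R) (T : R) (T0 : 0 < T) (h : R -> R) :
  bmeas (h : measurableTypeR R -> R) -> (forall u, 0 <= h u) -> 0 <= a ->
  \int[exponential_law r0]_x (h (a + (x : R)) * ind (a + (x : R) <= T)) =
  r * T * \int[uniform_prob T0]_u
    (\int[exponential_law r0]_x ind (in_span b a u x) * h u).
Proof.
move=> bh h0 a0.
have mpdf := measurable_exponential_pdf r.
have pdf0 z : 0 <= exponential_pdf r z by rewrite exponential_pdf_ge0// ltW.
have mT : measurable_fun [set: measurableTypeR R] (fun t : R => t <= T).
  exact: measurable_fun_ler.
have bhT : bmeas (fun t : measurableTypeR R => h t * ind (t <= T)).
  by apply: bmeasM => //; exact: bmeasb.
have mshift (c : R) : measurable_fun [set: measurableTypeR R] (fun t : R => c + t).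
  by apply: measurable_funD.
pose F (t : R) : R := h t * ind (t <= T) * exponential_pdf r (t - a).
have mF : measurable_fun [set: measurableTypeR R] F.
  apply: measurable_funM; first exact: bhT.1.
  by apply: measurableT_comp => //; under eq_fun do rewrite addrC; exact: mshift.
have F0 t : 0 <= F t by rewrite !mulr_ge0.
transitivity (fine (\int[lebesgue_measure]_t (F t)%:E)%E).
  congr fine; rewrite ge0_integral_exponential; last 2 first.
  - by apply/measurable_EFinP; exact: (measurableT_comp bhT.1 (mshift a)).
  - by move=> x; rewrite lee_fin mulr_ge0.
  rewrite -[RHS](@ge0_integral_lebesgue_shift _ a); last 2 first.
  - exact/measurable_EFinP.
  - by move=> t; rewrite lee_fin.
  by apply: eq_integral => x _; rewrite -EFinM /F addrAC subrr add0r.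
pose G (u : R) : R := ind (if b then a <= u else a < u) * expR (- (r * (u - a))) * h u.
under [in RHS]eq_Rintegral do rewrite exponential_in_span.
have mb : measurable_fun [set: measurableTypeR R]
    (fun u : R => if b then a <= u else a < u).
  by case: (b); [apply: measurable_fun_ler | apply: measurable_fun_ltr].
have mG : measurable_fun [set: measurableTypeR R] G.
  apply: measurable_funM; last exact: bh.1.
  apply: measurable_funM; first exact: measurable_fun_natb.
  apply: measurableT_comp => //; apply: measurableT_comp => //.
  apply: measurable_funM => //.
  by under eq_fun do rewrite addrC; exact: mshift.
have G0 u : 0 <= G u by rewrite !mulr_ge0 ?expR_ge0.
have mG2 : measurable_fun setT (EFin \o G) by exact/measurable_EFinP.
rewrite /Rintegral integral_uniform; last 2 first.
- exact: mG2.
- by move=> u; rewrite lee_fin; exact: (G0 u).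
rewrite subr0.
pose G' (u : R) : R := r * G u * ind (0 <= u <= T).
have mI : measurable_fun [set: measurableTypeR R] (fun u : R => 0 <= u <= T).
  apply: measurable_and => //; exact: measurable_fun_ler.
have mG' : measurable_fun [set: measurableTypeR R] G'.
  apply: measurable_funM; last exact: measurable_fun_natb.
  by apply: measurable_funM.
have G'E : ((\int[lebesgue_measure]_(u in `[0%R, T]) (G u)%:E) * r%:E =
    \int[lebesgue_measure]_u (G' u)%:E)%E.
  rewrite -ge0_integralZr//; last 3 first.
  - exact/measurable_funTS/measurable_EFinP.
  - by move=> u _; rewrite lee_fin.
  - by rewrite lee_fin ltW.
  rewrite integral_mkcond; apply: eq_integral => u _.
  rewrite patchE -EFinM /G' [G u * r]mulrC; case: ifPn => [/set_mem/=|/negP uT].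
    by rewrite in_itv/= => ->; rewrite mulr1.
  have /negbTE-> : ~~ (0 <= u <= T).
    by apply/negP => uT'; apply: uT; rewrite inE/= in_itv.
  by rewrite mulr0.
(* The constant hazard: for [u > a] the density at [u - a] is [r] times the probability of waiting
   longer than [u - a]. Only the point [a] may be an exception. *)
have -> : (\int[lebesgue_measure]_t (F t)%:E = \int[lebesgue_measure]_u (G' u)%:E)%E.
  apply: (@ge0_ae_eq_lebesgue_pt a) => //.
    by move=> u; rewrite !mulr_ge0// ltW.
  move=> u; rewrite neq_lt => /orP[ua|ua].
    rewrite /F lt0_exponential_pdf ?subr_lt0// mulr0 /G' /G.
    have -> : (if b then a <= u else a < u) = false.
      by case: (b); apply/negbTE; rewrite -?ltNge -?leNgt ?ltW.
    by rewrite !(mul0r, mulr0).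
  rewrite /F /G' /G exponential_pdfE ?subr_ge0 ?(ltW ua)// ua.
  rewrite (le_trans a0 (ltW ua))/= mulNr.
  rewrite (_ : (if b then true else true) = true); last by case: (b).
  rewrite (_ : ind true = 1 :> R)//; ring.
(* Pulling constants out of [fine] requires a finite integral; boundedness of [h] provides it. *)
have Gfin : (\int[lebesgue_measure]_(u in `[0%R, T]) (G u)%:E)%E \is a fin_num.
  case: (bh) => _ [M hM].
  have M0 : 0 <= M by apply: le_trans (hM 0).
  rewrite ge0_fin_numE; last by apply: integral_ge0 => u _; rewrite lee_fin.
  apply: (@le_lt_trans _ _ (\int[lebesgue_measure]_(u in `[0%R, T]) M%:E)%E).
    apply: ge0_le_integral => //.
    - by move=> u _; rewrite lee_fin.
    - exact/measurable_funTS/measurable_EFinP.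
    move=> u _; rewrite lee_fin /G.
    have [au|au] := boolP (if b then a <= u else a < u); last by rewrite !mul0r.
    rewrite mul1r -[leRHS]mul1r ler_pM ?expR_ge0//.
      rewrite -expR0 ler_expR oppr_le0 mulr_ge0 ?(ltW r0) ?subr_ge0//.
      by case: (b) au => // /ltW.
    by apply: le_trans (ler_norm _) (hM _).
  by rewrite integral_cst//= lebesgue_measure_itv/= lte_fin T0 -EFinD -EFinM ltry.
rewrite -G'E !fineM//= mulrCA mulrA.
by field; rewrite gt_eqF.
Qed.

(** On the half-line, the integrand times the density is [r / (r + s)] times the density of rate
    [r + s]. *)
Lemma integral_exponential_laplace (s : R) : 0 <= s ->
  \int[exponential_law r0]_x expR (- (s * `|x|)) = r / (r + s).
Proof.
move=> s0; have rs0 : 0 < r + s by rewrite ltr_wpDr.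
have ms : measurable_fun [set: R] (fun x : R => expR (- (s * `|x|))).
  apply: measurableT_comp => //; apply: measurableT_comp => //.
  by apply: measurable_funM => //; exact: measurableT_comp.
have ms2 : measurable_fun setT (EFin \o (fun x : R => expR (- (s * `|x|)))).
  exact/measurable_EFinP.
rewrite /Rintegral ge0_integral_exponential; last 2 first.
- exact: ms2.
- by move=> x; rewrite lee_fin expR_ge0.
transitivity (fine (\int[lebesgue_measure]_x
    ((r / (r + s))%:E * (exponential_pdf (r + s) x)%:E))%E).
  congr fine; apply: eq_integral => x _; rewrite -!EFinM; congr (_%:E).
  have [x0|x0] := leP (0 : R) x; last by rewrite !lt0_exponential_pdf// !mulr0.
  rewrite !exponential_pdfE// ger0_norm// (mulrA (r / (r + s))) divfK ?gt_eqF//.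
  by rewrite mulrCA -expRD; congr (_ * expR _); ring.
have mp2 : measurable_fun [set: measurableTypeR R]
    (EFin \o exponential_pdf (r + s)).
  by apply/measurable_EFinP; exact: measurable_exponential_pdf.
rewrite ge0_integralZl; last 4 first.
- by [].
- exact: mp2.
- by move=> x _; rewrite lee_fin exponential_pdf_ge0// ltW.
- by rewrite lee_fin divr_ge0// ltW.
by rewrite integral_exponential_pdf// mule1.
Qed.

End exponential.

(** * Second-order expansion of Laplace transforms *)

Section exponential_expansion.
Context {R : realType}.
Implicit Type x : R.

Let nondecreasing_of_derive (f g : R -> R) :
  (forall x, is_derive x 1 f (g x)) -> (forall x, 0 <= x -> 0 <= g x) ->
  forall x, 0 <= x -> f 0 <= f x.
Proof.
move=> df g0 x x0.
have cf : continuous f.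
  by move=> y; apply: differentiable_continuous; apply/derivable1_diffP; exact: (@ex_derive _ _ _ _ _ _ _ (df y)).
apply: (@ger0_derive1_le_cc _ f 0 x) => //.
- move=> y; rewrite in_itv/= => /andP[y0 _].
  by rewrite derive1E (@derive_val _ _ _ _ _ _ _ (df y)) g0// ltW.
- exact: continuous_subspaceT.
- by rewrite in_itv/= lexx.
- by rewrite in_itv/= lexx andbT.
Qed.

Lemma expRN_lb1 x : 1 - x <= expR (- x).
Proof. exact: expR_ge1Dx. Qed.

(** This bound and the next are integrated from the preceding one: the difference of the two sides
    vanishes at 0, and its derivative is nonnegative by the preceding bound. *)
Lemma expRN_ub2 x : 0 <= x -> expR (- x) <= 1 - x + x ^+ 2 / 2.
Proof.
move=> x0; rewrite -subr_ge0.
have := @nondecreasing_of_derive (fun x => 1 - x + x ^+ 2 / 2 - expR (- x))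
  (fun x => - 1 + x + expR (- x)) _ _ x x0.
rewrite !oppr0 expR0 expr0n/= mul0r !addr0 subrr; apply.
- by move=> y; apply: is_derive_eq; rewrite /GRing.scale/=; field.
- by move=> y y0; have := expRN_lb1 y; lra.
Qed.

Lemma expRN_lb3 x : 0 <= x -> 1 - x + x ^+ 2 / 2 - x ^+ 3 / 6 <= expR (- x).
Proof.
move=> x0; rewrite -subr_ge0.
have := @nondecreasing_of_derive
  (fun x => expR (- x) - (1 - x + x ^+ 2 / 2 - x ^+ 3 / 6))
  (fun x => 1 - x + x ^+ 2 / 2 - expR (- x)) _ _ x x0.
rewrite !oppr0 expR0 !expr0n/= !mul0r !(addr0, subr0) subrr; apply.
- by move=> y; apply: is_derive_eq; rewrite /GRing.scale/=; field.
- by move=> y y0; have := expRN_ub2 y0; lra.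
Qed.

End exponential_expansion.

Section laplace_expansion.
Context {R : realType} {d : measure_display} {T : measurableType d}.
Variables (P : probability T R) (B : T -> R).
Hypothesis mB : measurable_fun setT B.
Hypothesis B0 : forall w, 0 <= B w.
Hypothesis iB : P.-integrable setT (EFin \o B).
Hypothesis iB2 : P.-integrable setT (EFin \o (fun w => B w ^+ 2)).

Let b s := \int[P]_w expR (- (s * B w)).

(** Dominated convergence with bound [B w ^+ 2 / 2]. The cubic lower bound serves only for the
    pointwise limit, so two moments suffice. *)
Lemma laplace_second_order (u : nat -> R) : (forall n, 0 < u n) ->
  u n @[n --> \oo] --> 0 ->
  (b (u n) - 1 + u n * \int[P]_w B w) / u n ^+ 2 @[n --> \oo] -->
  (\int[P]_w B w ^+ 2) / 2.
Proof.
move=> u0 ucvg.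
pose F n w := (expR (- (u n * B w)) - 1 + u n * B w) / u n ^+ 2.
have sB w n : 0 <= u n * B w by rewrite mulr_ge0// ltW.
have un2 n : u n ^+ 2 != 0 by rewrite gt_eqF// exprn_gt0.
have bexp n : bmeas (fun w => expR (- (u n * B w))).
  apply: bmeas01 => [|w].
    apply: measurableT_comp => //; apply: measurableT_comp => //.
    exact: measurable_funM.
  by rewrite expR_ge0/= -expR0 ler_expR oppr_le0.
have FE n : (b (u n) - 1 + u n * \int[P]_w B w) / u n ^+ 2 = \int[P]_w F n w.
  have i1 : P.-integrable setT (EFin \o (fun w => expR (- (u n * B w)) - 1)).
    by apply: bmeas_integrable; apply: bmeasB => //; exact: bmeas_cst.
  have i2 : P.-integrable setT (EFin \o (fun w => u n * B w)).
    by have := integrableZl measurableT (u n) iB; apply: eq_integrable.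
  have i3 : P.-integrable setT
      (EFin \o (fun w => expR (- (u n * B w)) - 1 + u n * B w)).
    have := integrableD measurableT i1 i2.
    by apply: eq_integrable.
  rewrite /F RintegralZr// RintegralD// RintegralZl//; congr ((_ + _) / _).
  by rewrite bRintegralB ?bRintegral_cst//; exact: bmeas_cst.
under eq_fun do rewrite FE.
have mF n : measurable_fun setT (F n).
  apply: measurable_funM => //; apply: measurable_funD.
    by apply: measurable_funB => //; exact: (bexp n).1.
  exact: measurable_funM.
have iB2h : P.-integrable setT (EFin \o (fun w => B w ^+ 2 / 2)).
  by have := integrableZr measurableT 2^-1 iB2; apply: eq_integrable.
have bnd n w : B w ^+ 2 / 2 - u n * (B w ^+ 3 / 6) <= F n w <= B w ^+ 2 / 2.
  rewrite /F; apply/andP; split.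
    rewrite ler_pdivlMr ?exprn_gt0//.
    by have := expRN_lb3 (sB w n); rewrite !exprMn; lra.
  rewrite ler_pdivrMr ?exprn_gt0//.
  by have := expRN_ub2 (sB w n); rewrite !exprMn; lra.
rewrite -RintegralZr//.
apply: (dominated_cvg_Rintegral (g := fun w => B w ^+ 2 / 2)) => //.
- by apply: measurable_funM => //; exact: measurable_funX.
- move=> w; apply: (@squeeze_cvgr _ _ _ _
    (fun n => B w ^+ 2 / 2 - u n * (B w ^+ 3 / 6)) (fun=> B w ^+ 2 / 2)).
  + by apply: nearW => n; exact: bnd.
  + rewrite -[X in _ --> X]subr0 -(mul0r (B w ^+ 3 / 6)).
    by apply: cvgB; [exact: cvg_cst | apply: cvgM => //; exact: cvg_cst].
  + exact: cvg_cst.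
- move=> n w; rewrite ger0_norm; first by case/andP: (bnd n w).
  rewrite /F; apply: divr_ge0; last by rewrite exprn_ge0// ltW.
  by have := expRN_lb1 (u n * B w); lra.
Qed.

End laplace_expansion.

Lemma exponential_law_ge0 (R : realType) (r : R) (r0 : 0 < r) :
  {ae exponential_law r0, forall x : R, 0 <= x}.
Proof.
exists `]-oo, 0[%classic; split => //.
  rewrite /exponential_law/= /exponential_prob integral0_eq// => x.
  by rewrite /= in_itv/= => x0; rewrite lt0_exponential_pdf.
by move=> x /= /negP; rewrite in_itv/= -ltNge.
Qed.

Lemma exponential_law_norm (R : realType) (r : R) (r0 : 0 < r) (g : R -> R) :
  bmeas (g : measurableTypeR R -> R) ->
  \int[exponential_law r0]_x g `|x : R| = \int[exponential_law r0]_x g x.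
Proof.
move=> bg; rewrite /Rintegral; congr fine.
have mg : measurable_fun [set: measurableTypeR R] (EFin \o g).
  by apply/measurable_EFinP; exact: bg.1.
apply: ae_eq_integral => //.
- by apply: (measurableT_comp mg).
have [N [mN N0 sN]] := exponential_law_ge0 r0.
exists N; split => // x /= h; apply: sN => /= x0; apply: h => _.
by rewrite ger0_norm.
Qed.

Section mfun_of.
Context {d1 d2 : measure_display} {T1 : measurableType d1} {T2 : measurableType d2}.
Variables (f : T1 -> T2) (mf : measurable_fun setT f).
Let mixin := isMeasurableFun.Build _ _ _ _ _ mf.
Definition mfun_of : {mfun T1 >-> T2} := MeasurableFun.Pack (MeasurableFun.Class mixin).
End mfun_of.

Lemma Rintegral_has_law (R : realType) (d : measure_display)
    (T : measurableType d) (P : probability T R) (X : {RV P >-> R})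
    (nu : probability (measurableTypeR R) R) (g : measurableTypeR R -> R) :
  has_law X nu -> bmeas g ->
  \int[P]_w g (X w) = \int[nu]_x g x.
Proof.
move=> lawX bg.
have mX : measurable_fun setT (X : T -> measurableTypeR R).
  exact: (@measurable_funPT _ _ _ _ X).
rewrite -(bRintegral_pushforward P (mfun_of mX) bg).
rewrite /Rintegral; congr fine.
by apply: eq_measure_integral => A mA _; exact: lawX.
Qed.

(** * Independence of one input from the others *)

Section independence.
Context {R : realType} {d : measure_display} {T : measurableType d}.
Variables (P : probability T R) (I : choiceType) (X : I -> {RV P >-> R}).
Hypothesis indepX : mutually_independent X.

Section rest.
Variable j : I.

Definition rest_cylinders : set (set T) :=
  [set B | exists (J : {fset I}) (E : I -> set R), [/\ j \notin J,
    (forall i, measurable (E i)) & B = \bigcap_(i in [set` J]) (X i @^-1` E i)]].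

(** The sample space with the sigma-algebra of all inputs but [j]: measurability on this type says
    that a function does not look at [X j]. *)
Definition rest_type := g_sigma_algebraType rest_cylinders.

Lemma measurable_rest i : i != j ->
  measurable_fun [set: rest_type] (X i : rest_type -> R).
Proof.
move=> ij _ A mA; rewrite setTI; apply: sub_sigma_algebra.
exists [fset i]%fset, (fun=> A); split => //.
  by rewrite inE eq_sym.
apply/seteqP; split => w /=.
  by move=> Aw k /=; rewrite inE => /eqP ->.
by apply; rewrite /= inE.
Qed.

Lemma sub_rest (B : set T) : @measurable _ rest_type B -> measurable B.
Proof.
move=> mB; have : <<s rest_cylinders >> `<=` @measurable _ T.
  apply: smallest_sub; first exact: sigma_algebra_measurable.
  move=> _ [J [E [_ mE ->]]].
  apply: fin_bigcap_measurable => // i _.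
  by rewrite -[X in measurable X]setTI; exact: measurable_funPT.
exact.
Qed.

Lemma measurable_id_rest : measurable_fun [set: T] (id : T -> rest_type).
Proof. by move=> _ B mB; rewrite setTI; exact: sub_rest. Qed.

Lemma setI_closed_rest : setI_closed rest_cylinders.
Proof.
move=> _ _ [J [E [jJ mE ->]]] [K [F [jK mF ->]]].
exists (J `|` K)%fset, (fun i => (if i \in J then E i else setT) `&`
  (if i \in K then F i else setT)); split.
- by rewrite inE negb_or jJ.
- by move=> i; apply: measurableI; case: ifP.
- apply/seteqP; split => w /=.
    move=> [JE KF] i /=; rewrite inE => /orP iJK; split; case: ifPn => // iJ.
      exact: JE.
    exact: KF.
  move=> H; split => i /= iJ.
    by have := H i; rewrite /= inE iJ => /(_ isT)[].
  by have := H i; rewrite /= inE iJ orbT => /(_ isT)[].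
Qed.

(** For cylinders this is mutual independence with [j] added to the finite index set. They are
    stable under intersection, so a Dynkin argument extends it to the sigma-algebra they
    generate. *)
Lemma independent_rest (A : set R) (B : set T) : measurable A ->
  @measurable _ rest_type B ->
  P (X j @^-1` A `&` B) = (P (X j @^-1` A) * P B)%E.
Proof.
move=> mA mB.
have mXA : measurable (X j @^-1` A).
  by rewrite -[X in measurable X]setTI; exact: measurable_funPT.
apply: (@dynkin_induction _ rest_type rest_cylinders
  (fun B => P (X j @^-1` A `&` B) = (P (X j @^-1` A) * P B)%E)) => //.
- exact: setI_closed_rest.
- by rewrite setIT [P setT](probability_setT P) mule1.
- move=> _ [J [E [jJ mE ->]]].
  have := @indepX (j |` J)%fset (fun i => if i == j then A else E i).
  have mE' i : measurable (if i == j then A else E i) by case: ifP.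
  move=> /(_ mE').
  rewrite big_fsetU1//= eqxx.
  rewrite (eq_big_seq (fun i => P (X i @^-1` E i))); last first.
    by move=> i iJ; case: eqP => // ij; rewrite ij (negbTE jJ) in iJ.
  rewrite -(@indepX J E mE) => <-; congr (P _).
  apply/seteqP; split => w /=.
    move=> [Aw JE] i /=; rewrite !inE => /orP[/eqP->|iJ]; first by rewrite eqxx.
    case: eqP => [->//|_]; exact: JE.
  move=> H; split.
    by have := H j; rewrite /= !inE eqxx => /(_ isT).
  move=> i /= iJ; have := H i; rewrite /= !inE iJ orbT => /(_ isT).
  by case: eqP => // ij; rewrite ij (negbTE jJ) in iJ.
- move=> S mS; have {}mS := sub_rest mS => PS.
  rewrite -setDE.
  have -> : P (X j @^-1` A `\` S) = (P (X j @^-1` A) - P (X j @^-1` A `&` S))%E.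
    by rewrite measureD// ?fin_num_measure// (le_lt_trans (probability_le1 _ _)) ?ltry.
  by rewrite PS probability_setC// muleBr ?mule1//; exact: fin_num_measure.
- move=> F mF tF PF; have {}mF n := sub_rest (mF n).
  rewrite setI_bigcupr measure_bigcup//; last 2 first.
  + by move=> n _; exact: measurableI.
  + exact: trivIset_setIl.
  rewrite measure_bigcup//.
  have pE : P (X j @^-1` A) = (fine (P (X j @^-1` A)))%:E.
    by rewrite fineK// fin_num_measure.
  rewrite pE -nneseriesZl//.
  by apply: eq_eseriesr => n _; rewrite -pE; exact: PF.
Qed.

Definition rest_law : probability rest_type R :=
  distribution P (mfun_of measurable_id_rest).

Lemma rest_lawE (f : rest_type -> R) : bmeas f ->
  \int[rest_law]_w f w = \int[P]_w f w.
Proof. by move=> bf; rewrite bRintegral_pushforward. Qed.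

(** The pair of [X j] and the rest has a product law, so Fubini allows integration over [X j] with
    the rest held fixed. *)
Lemma freezing (h : R * rest_type -> R) : bmeas h ->
  \int[P]_w h (X j w, w) =
  \int[distribution P (X j)]_x \int[rest_law]_w h (x, w).
Proof.
move=> bh.
have mpair : measurable_fun [set: T] (fun w => (X j w, w : rest_type)).
  by apply: measurable_fun_pair => //; exact: measurable_id_rest.
transitivity (\int[distribution P (mfun_of mpair)]_z h z).
  by rewrite bRintegral_pushforward.
rewrite -(@eq_measure_Rintegral _ _ _ (distribution P (X j) \x rest_law)%E); last first.
  apply: product_measure_unique => A B mA mB.
  exact: independent_rest.
by rewrite bfubini_prod.
Qed.

Lemma independent_mean (g : R -> R) (k : rest_type -> R) : bmeas g -> bmeas k ->
  \int[P]_w (g (X j w) * k w) = \int[P]_w g (X j w) * \int[P]_w k w.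
Proof.
move=> bg bk.
have bh : bmeas (fun z : R * rest_type => g z.1 * k z.2).
  by apply: bmeasM; [apply: (bmeas_comp bg) | apply: (bmeas_comp bk)].
rewrite (freezing bh)/=.
transitivity (\int[distribution P (X j)]_x (\int[rest_law]_w k w * g x)).
  by apply: eq_Rintegral => x _; rewrite [RHS]mulrC; exact: bRintegralZ.
by rewrite bRintegralZ// mulrC rest_lawE// (bRintegral_pushforward P (X j) bg).
Qed.

Section exponential_clock.
Variables (r : R) (r0 : 0 < r).
Hypothesis lawX : has_law (X j) (exponential_prob r).

Lemma freezing_exponential (h : measurableTypeR R * rest_type -> R) : bmeas h ->
  \int[P]_w h (`|X j w|, w) =
  \int[exponential_law r0]_x \int[rest_law]_w h (x, w).
Proof.
move=> bh.
have mh' : measurable_fun setT (fun z : R * rest_type => (`|z.1|, z.2)).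
  by apply: measurable_fun_pair => //; apply: measurableT_comp.
have bh' : bmeas (fun z : R * rest_type => h (`|z.1|, z.2)).
  exact: (bmeas_comp bh mh').
rewrite (freezing bh').
have bg := bmeas_fubini1 (distribution P (X j)) rest_law bh'.
rewrite (bRintegral_pushforward P (X j) bg).
transitivity (\int[exponential_law r0]_x \int[rest_law]_w h (`|x : R|, w)).
  exact: (Rintegral_has_law (nu := exponential_law r0) lawX bg).
exact: (exponential_law_norm r0 (bmeas_fubini1 (exponential_law r0) rest_law bh)).
Qed.

Lemma measurable_in_span (b : bool) (d' : measure_display) (U : measurableType d')
    (a u x : U -> R) :
  measurable_fun setT a -> measurable_fun setT u -> measurable_fun setT x ->
  measurable_fun setT (fun z => in_span b (a z) (u z) (x z)).
Proof.
move=> ma mu mx; have max := measurable_funD ma mx.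
rewrite /in_span; case: b; apply: measurable_and.
- exact: measurable_fun_ler.
- exact: measurable_fun_ltr.
- exact: measurable_fun_ltr.
- exact: measurable_fun_ler.
Qed.

(** Neither [a] nor [h] looks at [X j]. For each frozen [w], [exponential_compensator] applies with
    constant start [a w]; the same freezing then puts [X j] back under the time integral. *)
Lemma compensator (b : bool) (t : R) (t0 : 0 < t) (a : rest_type -> R)
    (h : measurableTypeR R * rest_type -> R) :
  measurable_fun setT a -> (forall w, 0 <= a w) ->
  bmeas h -> (forall z, 0 <= h z) ->
  \int[P]_w (h (a w + `|X j w|, w) * ind (a w + `|X j w| <= t)) =
  r * t * \int[uniform_prob t0]_u
    \int[P]_w (ind (in_span b (a w) u `|X j w|) * h (u, w)).
Proof.
move=> ma a0 bh h0.
pose H (z : measurableTypeR R * rest_type) : R :=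
  h (a z.2 + z.1, z.2) * ind (a z.2 + z.1 <= t).
have max : measurable_fun setT (fun z : measurableTypeR R * rest_type => a z.2 + z.1).
  by apply: measurable_funD => //; exact: measurableT_comp.
have bH : bmeas H.
  apply: bmeasM; last by apply: bmeasb; exact: measurable_fun_ler.
  by apply: (bmeas_comp bh); apply: measurable_fun_pair.
rewrite (freezing_exponential bH) bfubini//.
have bspan : bmeas (fun z : measurableTypeR R * rest_type =>
    \int[exponential_law r0]_x ind (in_span b (a z.2) z.1 x)).
  apply: (bmeas_fubini1 (exponential_law r0 \x rest_law)%E (exponential_law r0)
    (f := fun z : (measurableTypeR R * rest_type) * measurableTypeR R =>
       ind (in_span b (a z.1.2) z.1.1 z.2))).
  apply: bmeasb; apply: measurable_in_span => //.
  - apply: measurableT_comp => //; exact: measurableT_comp.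
  - exact: measurableT_comp.
have bK : bmeas (fun z : measurableTypeR R * rest_type =>
    \int[exponential_law r0]_x ind (in_span b (a z.2) z.1 x) * h z).
  exact: bmeasM.
transitivity (\int[rest_law]_w (r * t * \int[uniform_prob t0]_u
    (\int[exponential_law r0]_x ind (in_span b (a w) u x) * h (u, w)))).
  apply: eq_Rintegral => w _; rewrite /H/=.
  apply: (exponential_compensator r0 b t0 (h := fun x => h (x, w))) => //.
  by case: bh => mh [M hM]; split; [exact: measurable_fun_pair1 | exists M].
rewrite bRintegralZ; last exact: (bmeas_fubini2 (uniform_prob t0) rest_law bK).
rewrite -(bfubini (uniform_prob t0) rest_law bK); congr (_ * _).
apply: eq_Rintegral => u _.
pose K (z : measurableTypeR R * rest_type) : R :=
  ind (in_span b (a z.2) u z.1) * h (u, z.2).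
have bK' : bmeas K.
  apply: bmeasM.
    by apply: bmeasb; apply: measurable_in_span => //; exact: measurableT_comp.
  by apply: (bmeas_comp bh); apply: measurable_fun_pair.
rewrite (freezing_exponential bK') bfubini//; apply: eq_Rintegral => w _.
rewrite /K/= [RHS](_ : _ = \int[exponential_law r0]_x
  (h (u, w) * ind (in_span b (a w) u x))); last first.
  by apply: eq_Rintegral => x _; rewrite mulrC.
rewrite [LHS]mulrC; apply/esym; apply: bRintegralZ.
by apply: bmeasb; exact: measurable_in_span.
Qed.

End exponential_clock.
End rest.
End independence.

(** * The discounted workload along a path *)

Section uniform_calculus.
Context {R : realType} (T : R) (T0 : 0 < T).
Implicit Types (u v s c : R) (f : R -> R).

(** Both conventions for the left end occur: the beginning of a stay is excluded, whereas an arrival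
    epoch inside it is included. *)
Definition past (b : bool) u t : bool := if b then u <= t else u < t.

Lemma measurable_past (b : bool) (d : measure_display) (U : measurableType d)
    (f g : U -> R) : measurable_fun setT f -> measurable_fun setT g ->
  measurable_fun setT (fun z => past b (f z) (g z)).
Proof.
by move=> mf mg; case: b; [exact: measurable_fun_ler | exact: measurable_fun_ltr].
Qed.

Lemma uniform_segment (b : bool) u v f : 0 <= u -> u <= v -> v <= T ->
  bmeas (f : measurableTypeR R -> R) -> (forall t, 0 <= f t) ->
  T * \int[uniform_prob T0]_t (ind (past b u t && (t <= v)) * f t) =
  \int[lebesgue_measure]_(t in `[u, v]) f t.
Proof.
move=> u0 uv vT bf f0.
have mpt b' : measurable_fun setT (fun t : measurableTypeR R => past b' u t && (t <= v)).
  by apply: measurable_and; [exact: measurable_past | exact: measurable_fun_ler].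
have mF b' : measurable_fun setT
    (fun t : measurableTypeR R => ind (past b' u t && (t <= v)) * f t).
  by apply: measurable_funM; [exact: measurable_fun_natb | exact: bf.1].
have F0 b' t : 0 <= ind (past b' u t && (t <= v)) * f t by rewrite mulr_ge0.
have mFE : measurable_fun setT (EFin \o
    (fun t : measurableTypeR R => ind (past b u t && (t <= v)) * f t)).
  by apply/measurable_EFinP; exact: mF.
have restr b' : (\int[lebesgue_measure]_(t in `[0%R, T])
      (ind (past b' u t && (t <= v)) * f t)%:E =
    \int[lebesgue_measure]_t (ind (past b' u t && (t <= v)) * f t)%:E)%E.
  rewrite integral_mkcond; apply: eq_integral => t _; rewrite patchE.
  case: ifPn => // /negP tT; congr (_%:E).
  have -> : past b' u t && (t <= v) = false; last by rewrite mul0r.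
  apply/negP => /andP[ut tv]; apply: tT; rewrite inE/= in_itv/=.
  by rewrite (le_trans tv vT) andbT (le_trans u0)//; case: b' ut => // /ltW.
have segE : (\int[lebesgue_measure]_t (ind (past true u t && (t <= v)) * f t)%:E
    = \int[lebesgue_measure]_(t in `[u, v]) (f t)%:E)%E.
  rewrite [RHS]integral_mkcond; apply: eq_integral => t _; rewrite patchE.
  case: ifPn => [/set_mem/=|/negP tT].
    by rewrite in_itv/= /past => -> ; rewrite mul1r.
  have -> : past true u t && (t <= v) = false; last by rewrite mul0r.
  by apply/negP => tuv; apply: tT; rewrite inE/= in_itv.
have bE : (\int[lebesgue_measure]_t (ind (past b u t && (t <= v)) * f t)%:E =
    \int[lebesgue_measure]_t (ind (past true u t && (t <= v)) * f t)%:E)%E.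
  apply: (@ge0_ae_eq_lebesgue_pt _ u); [exact: mF|exact: mF|by []|by []|].
  move=> t tu.
  by rewrite /past le_eqVlt eq_sym (negbTE tu)/=; case: (b).
have fin : (\int[lebesgue_measure]_(t in `[u, v]) (f t)%:E)%E \is a fin_num.
  apply: integrable_fin_num => //.
  apply: measurable_bounded_integrable => //.
  - by rewrite /= lebesgue_measure_itv/= lte_fin; case: ifP => _; rewrite -?EFinD ltry.
  - by apply: measurable_funTS; exact: bf.1.
  - case: bf => _ [M fM]; exists M; split; first exact: num_real.
    by move=> N MN x _; apply: le_trans (fM x) _; exact: ltW.
rewrite /Rintegral integral_uniform; last 2 first.
- exact: mFE.
- by move=> t; rewrite lee_fin.
by rewrite restr bE segE fineM//= subr0 mulrA divff ?mul1r// gt_eqF.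
Qed.

Lemma uniform_exp_FTC (b : bool) u v s c : 0 <= u -> u <= v -> v <= T -> 0 <= s ->
  s * T * \int[uniform_prob T0]_t
    (ind (past b u t && (t <= v)) * expR (- (s * (c - t)))) =
  expR (- (s * (c - v))) - expR (- (s * (c - u))).
Proof.
move=> u0 uv vT s0.
pose F t := expR (- (s * (c - t))).
have dF t : is_derive t (1 : R) F (s * F t).
  by rewrite /F; apply: is_derive_eq; rewrite /GRing.scale/=; ring.
have cF : continuous F.
  move=> t; apply: differentiable_continuous; apply/derivable1_diffP.
  exact: (@ex_derive _ _ _ _ _ _ _ (dF t)).
have mF : measurable_fun setT (F : measurableTypeR R -> R).
  exact: continuous_measurable_fun.
have F0 t : 0 <= F t by exact: expR_ge0.
(* [F] is nondecreasing but may be unbounded on the line. Capped at its value in [v] it is bounded,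
   as [uniform_segment] requires, and unchanged up to [v]. *)
pose F' t := Num.min (F t) (F v).
have F'E t : past b u t && (t <= v) -> F' t = F t.
  move=> /andP[_ tv]; apply/min_idPl.
  by rewrite /F ler_expR lerN2 ler_wpM2l// lerD2l lerN2.
have bF' : bmeas (F' : measurableTypeR R -> R).
  split; first by apply: measurable_minr.
  by exists (F v) => t; rewrite ger0_norm ?ge_min ?lexx ?orbT// le_min !F0.
have -> : \int[uniform_prob T0]_t (ind (past b u t && (t <= v)) * F t) =
    \int[uniform_prob T0]_t (ind (past b u t && (t <= v)) * F' t).
  apply: eq_Rintegral => t _.
  by case: (boolP (past b u t && (t <= v))) => [/F'E->//|_]; rewrite !mul0r.
rewrite -mulrA uniform_segment//; last by move=> t; rewrite le_min !F0.
move: uv; rewrite le_eqVlt => /predU1P[<-|uv].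
  by rewrite set_itv1 Rintegral_set1 mulr0 subrr.
have -> : \int[lebesgue_measure]_(t in `[u, v]) F' t = \int[lebesgue_measure]_(t in `[u, v]) F t.
  apply: eq_Rintegral => t; rewrite inE/= in_itv/= => /andP[ut tv].
  by apply/min_idPl; rewrite /F ler_expR lerN2 ler_wpM2l// lerD2l lerN2.
have iF : (@lebesgue_measure R).-integrable `[u, v] (EFin \o F).
  apply: continuous_compact_integrable; first exact: segment_compact.
  exact: continuous_subspaceT.
rewrite -RintegralZl//.
have csF : continuous (fun t => s * F t).
  by move=> t; apply: cvgM; [exact: cvg_cst | exact: cF].
rewrite /Rintegral (@continuous_FTC2 _ (fun t => s * F t) F)//.
- exact: continuous_subspaceT.
- split.
  + by move=> t _; exact: (@ex_derive _ _ _ _ _ _ _ (dF t)).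
  + by apply: cvg_at_right_filter; exact: cF.
  + by apply: cvg_at_left_filter; exact: cF.
- by move=> t _; rewrite derive1E (@derive_val _ _ _ _ _ _ _ (dF t)).
Qed.

(** The discount [exp (- s v)] of the work [v] left at clock value [t] when all of it will be done
    at clock value [c]. *)
Definition psi s c t := expR (- (s * Num.max 0 (c - t))).

Lemma psi01 s c t : 0 <= s -> 0 <= psi s c t <= 1.
Proof.
move=> s0; rewrite expR_ge0/= -expR0 ler_expR oppr_le0 mulr_ge0//.
by rewrite le_max lexx.
Qed.

Lemma measurable_psi s (d : measure_display) (U : measurableType d) (f g : U -> R) :
  measurable_fun setT f -> measurable_fun setT g ->
  measurable_fun setT (fun z => psi s (f z) (g z)).
Proof.
move=> mf mg; apply: measurableT_comp => //.
apply: (@measurable_funN _ _ R setT (fun z => s * Num.max 0 (f z - g z))).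
apply: measurable_funM; first exact: measurable_cst.
by apply: measurable_maxr; [exact: measurable_cst | exact: measurable_funB].
Qed.

(** Up to [c] the derivative of [psi] is [s] times [psi]; from [c] on, [psi] is constant and the
    indicator removes the integrand. Hence the cut at the minimum of [v] and [c]. *)
Lemma uniform_psi_FTC (b : bool) u v s c : 0 <= u -> u <= v -> v <= T -> 0 <= s ->
  s * T * \int[uniform_prob T0]_t
    (ind (past b u t && (t <= v)) * (ind (t <= c) * psi s c t)) =
  psi s c v - psi s c u.
Proof.
move=> u0 uv vT s0.
have psiE t : t <= c -> psi s c t = expR (- (s * (c - t))).
  by move=> tc; rewrite /psi max_r// subr_ge0.
have psi1 t : c <= t -> psi s c t = 1.
  by move=> tc; rewrite /psi max_l ?mulr0 ?oppr0 ?expR0// subr_le0.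
have [cu|uc] := ltP c u.
  rewrite !psi1 ?ltW ?subrr//; last exact: lt_le_trans uv.
  rewrite -[RHS](mulr0 (s * T)); congr (_ * _).
  rewrite -[RHS](bRintegral_cst (uniform_prob T0)); apply: eq_Rintegral => t _.
  have [tc|tc] := leP t c; last by rewrite mul0r mulr0.
  have -> : past b u t = false; last by rewrite mul0r.
  by rewrite /past; case: (b); apply/negbTE; rewrite -?leNgt -?ltNge;
    rewrite ?(le_trans tc) ?(le_lt_trans tc)// ltW.
pose w := Num.min v c.
have wv : w <= v by rewrite ge_min lexx.
have -> : psi s c v = psi s c w.
  rewrite /w; have [//|cv] := leP v c.
  by rewrite !psi1// ltW.
rewrite (@psiE w) ?ge_min ?lexx ?orbT// (@psiE u)//.
rewrite -(@uniform_exp_FTC b)//; last 2 first.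
- by rewrite le_min uv.
- exact: le_trans vT.
congr (_ * _); apply: eq_Rintegral => t _.
rewrite /w le_min; have [tc|tc] := leP t c.
  by rewrite andbT mul1r psiE.
by rewrite !andbF !mul0r mulr0.
Qed.

End uniform_calculus.

Section path_functions.
Context {R : realType}.

Definition epoch (A : nat -> R) n : R := \sum_(k < n) A k.

Lemma epochS A n : epoch A n.+1 = epoch A n + A n.
Proof. by rewrite /epoch big_ord_recr. Qed.

Lemma epoch0 A : epoch A 0 = 0.
Proof. by rewrite /epoch big_ord0. Qed.

Lemma epoch_le A m n : (forall k, 0 <= A k) -> (m <= n)%N -> epoch A m <= epoch A n.
Proof.
move=> A0 /subnKC <-; elim: (n - m)%N => [|p ih]; first by rewrite addn0.
by rewrite addnS epochS ler_wpDr.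
Qed.

Lemma epoch_ge0 A n : (forall k, 0 <= A k) -> 0 <= epoch A n.
Proof. by move=> A0; rewrite -(epoch0 A); exact: epoch_le. Qed.

(* Time spent during [[0, t]] in those of the first [K] stays that are
   selected by [on]. *)
Definition clock (on : pred nat) (D : nat -> R) K (t : R) : R :=
  \sum_(k < K | on k) (Num.min (epoch D k.+1) t - Num.min (epoch D k) t).

(** The clock if stay [k] never ended. It involves only [D m] with [m < k] and agrees with the true
    clock until stay [k] ends; this makes [D k] available for freezing. *)
Definition endless_clock (on : pred nat) (D : nat -> R) k (t : R) : R :=
  clock on D k t + (if on k then t - Num.min (epoch D k) t else 0).

Lemma clockS on D K t : clock on D K.+1 t = clock on D K t +
  (if on K then Num.min (epoch D K.+1) t - Num.min (epoch D K) t else 0).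
Proof. by rewrite /clock big_mkcond [in RHS]big_mkcond big_ord_recr. Qed.

Lemma clock_endless on (D : nat -> R) K k t : (forall m, 0 <= D m) ->
  (k < K)%N -> t <= epoch D k.+1 -> clock on D K t = endless_clock on D k t.
Proof.
move=> D0 + tk; elim: K => // K ih; rewrite ltnS leq_eqVlt clockS.
move=> /predU1P[<-|kK]; first by rewrite /endless_clock (min_r tk).
have tK := le_trans tk (epoch_le D0 kK).
rewrite ih// (min_r tK) min_r ?subrr ?if_same ?addr0//.
by apply: le_trans tK _; exact: epoch_le.
Qed.

Lemma endless_clock_stay on (D : nat -> R) k x y : (forall m, 0 <= D m) ->
  epoch D k <= x -> x <= y ->
  endless_clock on D k y - endless_clock on D k x = if on k then y - x else 0.
Proof.
move=> D0 kx xy; rewrite /endless_clock.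
have -> : clock on D k y = clock on D k x.
  apply: eq_bigr => m _.
  have h z j : epoch D k <= z -> (j <= k)%N -> Num.min (epoch D j) z = epoch D j.
    by move=> kz jk; rewrite min_l// (le_trans _ kz)// epoch_le.
  by rewrite !h// ?(ltnW (ltn_ord m)) ?(le_trans kx).
by rewrite !min_l ?(le_trans kx)//; case: (on k); ring.
Qed.

Lemma clock_stay on (D : nat -> R) K k x y : (forall m, 0 <= D m) ->
  (k < K)%N -> epoch D k <= x -> x <= y -> y <= epoch D k.+1 ->
  clock on D K y - clock on D K x = if on k then y - x else 0.
Proof.
move=> D0 kK kx xy yk.
by rewrite !(@clock_endless _ _ K k) ?endless_clock_stay// (le_trans xy).
Qed.

Section service.
Variables (sigma : R -> R) (A S : nat -> R).

(** Clock value at which the first [n] customers have been served; the index is shifted by one with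
    respect to [completion], so that an empty history gets the value 0. *)
Fixpoint departure n : R :=
  if n is m.+1 then Num.max (sigma (epoch A m.+1)) (departure m) + S m else 0.

(* [exp (- s v)], where [v] is the workload at time [t] due to the first [n]
   customers. *)
Definition discount s n t := psi s (departure n) (sigma t).

(** Exactly [n] customers have arrived by time [t]; customer [m] arrives at [epoch A m.+1]. *)
Definition between n t := (epoch A n <= t) && (t < epoch A n.+1).

Lemma betweenE n t : (forall k, 0 <= A k) ->
  ind (between n t) = ind (epoch A n <= t) - ind (epoch A n.+1 <= t) :> R.
Proof.
move=> A0; rewrite /between; have [nt|nt] := leP (epoch A n) t; last first.
  have -> : (epoch A n.+1 <= t) = false; last by rewrite subrr.
  by apply/negbTE; rewrite -ltNge (lt_le_trans nt)// epoch_le.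
by case: (leP _ t) => _ /=; rewrite ?subrr ?subr0.
Qed.

(** Lindley's recursion: whether or not work is left, the arriving customer adds exactly [S n] to
    it. *)
Lemma discount_arrival s n : 0 <= S n ->
  discount s n.+1 (epoch A n.+1) = expR (- (s * S n)) * discount s n (epoch A n.+1).
Proof.
move=> S0; rewrite /discount /psi -expRD; congr expR => /=.
set x := sigma _; set y := departure n.
have [xy|xy] := leP x y.
  by rewrite !max_r ?subr_ge0//; [ring|lra].
by rewrite (max_r (_ : 0 <= x + S n - x)) ?(max_l (_ : y - x <= 0)); [ring|lra|lra].
Qed.

(** For nonnegative [A], at most one term is nonzero, and all vanish unless [0 <= t < epoch A N]:
    the discount is killed when the last of the [N] customers arrives. *)
Definition system_discount s N t := \sum_(n < N) ind (between n t) * discount s n t.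

Definition busy_discount s N t :=
  \sum_(n < N) ind (between n t) * (ind (sigma t <= departure n) * discount s n t).

Variables (T : R) (T0 : 0 < T).
Hypothesis msigma : measurable_fun setT (sigma : measurableTypeR R -> R).

Lemma bmeas_discount s n : 0 <= s ->
  bmeas (discount s n : measurableTypeR R -> R).
Proof.
move=> s0; apply: bmeas01 => [|t]; last exact: psi01.
exact: measurable_psi.
Qed.

Section stay.
Variables (on : bool) (u v : R).
Hypotheses (u0 : 0 <= u) (uv : u <= v) (vT : v <= T).
Hypothesis sigma_stay : forall x y, u <= x -> x <= y -> y <= v ->
  sigma y - sigma x = if on then y - x else 0.

Lemma discount_drift (b : bool) s n x : 0 <= s -> u <= x -> x <= v ->
  (if on then s else 0) * T * \int[uniform_prob T0]_t
    (ind (past b x t && (t <= v)) *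
     (ind (sigma t <= departure n) * discount s n t)) =
  discount s n v - discount s n x.
Proof.
move=> s0 ux xv; have x0 := le_trans u0 ux.
case: (boolP on) => on1; last first.
  rewrite !mul0r /discount.
  have := sigma_stay ux xv (lexx v); rewrite (negbTE on1) => /eqP.
  by rewrite subr_eq0 => /eqP ->; rewrite subrr.
(* The real time at which the work of the first [n] customers would be finished if the present stay
   went on. *)
pose c := departure n - sigma x + x.
have sE t : x <= t -> t <= v -> sigma t = sigma x + (t - x).
  by move=> xt tv; have := sigma_stay ux xt tv; rewrite on1 => <-; ring.
have dE t : x <= t -> t <= v -> discount s n t = psi s c t.
  by move=> xt tv; rewrite /discount /psi sE//; congr (expR (- (s * Num.max 0 _))); rewrite /c; ring.
rewrite (dE v) // (dE x) //.
have <- := @uniform_psi_FTC R T T0 b x v s c x0 xv vT s0.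
apply: (congr1 (fun z => s * T * z)); apply: eq_Rintegral => t _.
case: (boolP (past b x t && (t <= v))) => [/andP[xt tv]|_]; last by rewrite !mul0r.
have {}xt : x <= t by move: xt; rewrite /past; case: (b) => // /ltW.
rewrite dE//; congr (_ * (ind _ * _)).
by rewrite sE// /c; apply/idP/idP => ?; lra.
Qed.

(** A discount that is switched on at time [p] jumps at [p] and drifts afterwards. The difference of
    the cases [p = epoch A n] and [p = epoch A n.+1] gives the contribution of [between A n]. *)
Lemma discount_step s n p : 0 <= s ->
  ind (p <= v) * discount s n v - ind (p <= u) * discount s n u =
  (if on then s else 0) * T * \int[uniform_prob T0]_t
    (ind (past false u t && (t <= v)) * (ind (p <= t) *
     (ind (sigma t <= departure n) * discount s n t))) +
  ind ((u < p) && (p <= v)) * discount s n p.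
Proof.
move=> s0; have [pu|up] := leP p u.
  rewrite (le_trans pu uv) mul0r addr0 !mul1r -(@discount_drift false)//.
  congr (_ * _); apply: eq_Rintegral => t _; rewrite /past.
  have [ut|_] := ltP u t; last by rewrite !mul0r.
  by rewrite (le_trans pu (ltW ut)) mul1r.
have [pv|vp] := leP p v.
  rewrite mul0r subr0 !mul1r; apply/eqP; rewrite -subr_eq; apply/eqP.
  rewrite -(@discount_drift true)//; last exact: ltW.
  congr (_ * _); apply: eq_Rintegral => t _; rewrite /past.
  have [pt|_] := leP p t; last by rewrite !(mul0r, mulr0).
  by rewrite (lt_le_trans up pt) mul1r.
rewrite !mul0r subr0 addr0.
rewrite -[LHS](mulr0 ((if on then s else 0) * T)); congr (_ * _).
rewrite -[LHS](bRintegral_cst (uniform_prob T0)); apply: eq_Rintegral => t _.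
have [tv|_] := leP t v; last by rewrite andbF mul0r.
by rewrite leNgt (le_lt_trans tv vp) !(mul0r, mulr0).
Qed.

(** The jumps of [discount_step] telescope over [n]. At each arrival the old term ends and the next
    begins, smaller by the factor [expR (- (s * S n))], which leaves [1 - expR (- (s * S n))]; at
    [epoch A N] the last term ends without a successor. *)
Lemma system_discount_step s N : 0 <= s ->
  (forall k, 0 <= A k) -> (forall k, 0 <= S k) ->
  system_discount s N v - system_discount s N u =
  (if on then s else 0) * T * \int[uniform_prob T0]_t
    (ind ((u < t) && (t <= v)) * busy_discount s N t) -
  \sum_(n < N) ind ((u < epoch A n.+1) && (epoch A n.+1 <= v)) *
    (1 - expR (- (s * S n))) * discount s n (epoch A n.+1) -
  ind ((u < epoch A N) && (epoch A N <= v)) * discount s N (epoch A N).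
Proof.
move=> s0 A0 S0.
pose I n p := \int[uniform_prob T0]_t (ind (past false u t && (t <= v)) *
  (ind (p <= t) * (ind (sigma t <= departure n) * discount s n t))).
pose J n p := ind ((u < p) && (p <= v)) * discount s n p : R.
have mpast : measurable_fun setT
    (fun t : measurableTypeR R => past false u t && (t <= v)).
  by apply: measurable_and; [exact: measurable_past | exact: measurable_fun_ler].
have bI n : bmeas (fun t : measurableTypeR R =>
    ind (sigma t <= departure n) * discount s n t).
  apply: bmeasM; last exact: bmeas_discount.
  by apply: bmeasb; exact: measurable_fun_ler.
have bp p : bmeas (fun t : measurableTypeR R => ind (p <= t)).
  by apply: bmeasb; exact: measurable_fun_ler.
have IE n : \int[uniform_prob T0]_t (ind ((u < t) && (t <= v)) *
    (ind (between n t) * (ind (sigma t <= departure n) * discount s n t))) =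
    I n (epoch A n) - I n (epoch A n.+1).
  rewrite /I -bRintegralB; last 2 first.
  - by apply: bmeasM; [exact: bmeasb | apply: bmeasM].
  - by apply: bmeasM; [exact: bmeasb | apply: bmeasM].
  by apply: eq_Rintegral => t _; rewrite betweenE// mulrBl mulrBr.
have -> : \int[uniform_prob T0]_t (ind ((u < t) && (t <= v)) * busy_discount s N t) =
    \sum_(n < N) (I n (epoch A n) - I n (epoch A n.+1)).
  under eq_Rintegral do rewrite mulr_sumr.
  rewrite bRintegral_sum => [|n]; first by apply: eq_bigr => n _; exact: IE.
  apply: bmeasM; first exact: bmeasb.
  apply: bmeasM => //; under eq_fun do rewrite betweenE//.
  exact: bmeasB.
have stepE n : ind (between n v) * discount s n v - ind (between n u) * discount s n u =
    (if on then s else 0) * T * (I n (epoch A n) - I n (epoch A n.+1)) +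
    (J n (epoch A n) - J n (epoch A n.+1)).
  rewrite !betweenE// !mulrBl opprB addrACA -opprB.
  have h p := @discount_step s n p s0.
  rewrite (_ : _ + _ = (ind (epoch A n <= v) * discount s n v - ind (epoch A n <= u) * discount s n u) -
    (ind (epoch A n.+1 <= v) * discount s n v - ind (epoch A n.+1 <= u) * discount s n u)); last by ring.
  by rewrite !h /I /J; ring.
rewrite /system_discount -sumrB (eq_bigr _ (fun (n : 'I_N) _ => stepE n)) big_split/= -mulr_sumr.
rewrite -!addrA; congr (_ + _).
(* The term of index 0 starts at time 0, which is not in the left-open interval from [u] to [v]. *)
have J0 : J 0%N (epoch A 0) = 0 by rewrite /J epoch0 ltNge u0 mul0r.
have JS n : J n.+1 (epoch A n.+1) = J n (epoch A n.+1) -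
  ind ((u < epoch A n.+1) && (epoch A n.+1 <= v)) *
    (1 - expR (- (s * S n))) * discount s n (epoch A n.+1).
  by rewrite /J discount_arrival//; ring.
rewrite -/(J N (epoch A N)).
elim: N => [|N ih]; first by rewrite !big_ord0 J0 !oppr0 addr0.
by rewrite !big_ord_recr/= ih JS; ring.
Qed.

End stay.
End service.

(** The departures of customers arrived by time [t] evaluate the clock at their arrival epochs only,
    so a clock known up to [t] is enough. *)
Lemma system_discount_eq (sigma tau : R -> R) A S s N t :
  (forall k, 0 <= A k) -> (forall x, x <= t -> sigma x = tau x) ->
  system_discount sigma A S s N t = system_discount tau A S s N t.
Proof.
move=> A0 st; apply: eq_bigr => n _; rewrite /between.
case: (leP (epoch A n) t) => nt; last by rewrite !mul0r.
rewrite /discount st//.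
suff -> : departure sigma A S n = departure tau A S n by [].
elim: (n : nat) nt => //= m ih mt.
by rewrite st// ih// (le_trans _ mt)// epoch_le.
Qed.

End path_functions.

(** * Measurability of the path functions in the inputs they involve *)

Section measurable_paths.
Context {R : realType} {d : measure_display} {U : measurableType d}.
Implicit Types (A S D : nat -> U -> R) (t : U -> R) (sigma : U -> R -> R).

Lemma measurable_sumr (J : Type) (r : seq J) (p : pred J) (F : J -> U -> R) :
  (forall j, p j -> measurable_fun setT (F j)) ->
  measurable_fun setT (fun z => \sum_(j <- r | p j) F j z).
Proof.
move=> mF; elim: r => [|j r ih].
  by under eq_fun do rewrite big_nil; exact: measurable_cst.
under eq_fun do rewrite big_cons.
have [pj|//] := boolP (p j).
by apply: measurable_funD => //; exact: mF.
Qed.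

Lemma measurable_epoch A n : (forall k, (k < n)%N -> measurable_fun setT (A k)) ->
  measurable_fun setT (fun z => epoch (A ^~ z) n).
Proof. by move=> mA; apply: measurable_sumr => k _; exact: mA. Qed.

Lemma measurable_clock on D K t :
  (forall k, (k < K)%N -> measurable_fun setT (D k)) -> measurable_fun setT t ->
  measurable_fun setT (fun z => clock on (D ^~ z) K (t z)).
Proof.
move=> mD mt; apply: measurable_sumr => k _.
apply: measurable_funB; apply: measurable_minr => //.
- by apply: measurable_epoch => m mk; apply: mD; exact: leq_trans mk (ltn_ord k).
- by apply: measurable_epoch => m mk; apply: mD; exact: ltn_trans mk (ltn_ord k).
Qed.

Lemma measurable_endless_clock on D k t :
  (forall m, (m < k)%N -> measurable_fun setT (D m)) -> measurable_fun setT t ->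
  measurable_fun setT (fun z => endless_clock on (D ^~ z) k (t z)).
Proof.
move=> mD mt; apply: measurable_funD; first exact: measurable_clock.
case: (on k) => //; apply: measurable_funB => //; apply: measurable_minr => //.
exact: measurable_epoch.
Qed.

Lemma measurable_between A n t : (forall k, (k <= n)%N -> measurable_fun setT (A k)) ->
  measurable_fun setT t -> measurable_fun setT (fun z => between (A ^~ z) n (t z)).
Proof.
move=> mA mt; apply: measurable_and.
- apply: measurable_fun_ler => //; apply: measurable_epoch => k kn.
  by apply: mA; exact: ltnW.
- by apply: measurable_fun_ltr => //; exact: measurable_epoch.
Qed.

Section clocked.
Variable sigma : U -> R -> R.
Hypothesis msigma : forall t, measurable_fun setT t ->
  measurable_fun setT (fun z => sigma z (t z)).

Lemma measurable_departure A S n :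
  (forall k, (k < n)%N -> measurable_fun setT (A k)) ->
  (forall k, (k < n)%N -> measurable_fun setT (S k)) ->
  measurable_fun setT (fun z => departure (sigma z) (A ^~ z) (S ^~ z) n).
Proof.
elim: n => [|n ih] mA mS /=; first exact: measurable_cst.
apply: measurable_funD; last exact: mS.
apply: measurable_maxr.
  by apply: msigma; exact: measurable_epoch.
by apply: ih => k kn; [apply: mA | apply: mS]; exact: ltn_trans kn _.
Qed.

Lemma bmeas_discount_path A S s n t : 0 <= s ->
  (forall k, (k < n)%N -> measurable_fun setT (A k)) ->
  (forall k, (k < n)%N -> measurable_fun setT (S k)) ->
  measurable_fun setT t ->
  bmeas (fun z => discount (sigma z) (A ^~ z) (S ^~ z) s n (t z)).
Proof.
move=> s0 mA mS mt; apply: bmeas01 => [|z]; last exact: psi01.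
by apply: measurable_psi; [exact: measurable_departure | exact: msigma].
Qed.

Lemma bmeas_system_discount A S s N t : 0 <= s ->
  (forall k, measurable_fun setT (A k)) -> (forall k, measurable_fun setT (S k)) ->
  measurable_fun setT t ->
  bmeas (fun z => system_discount (sigma z) (A ^~ z) (S ^~ z) s N (t z)).
Proof.
move=> s0 mA mS mt; apply: bmeas_sum => n; apply: bmeasM.
  by apply: bmeasb; exact: measurable_between.
exact: bmeas_discount_path.
Qed.

Lemma bmeas_busy_discount A S s N t : 0 <= s ->
  (forall k, measurable_fun setT (A k)) -> (forall k, measurable_fun setT (S k)) ->
  measurable_fun setT t ->
  bmeas (fun z => busy_discount (sigma z) (A ^~ z) (S ^~ z) s N (t z)).
Proof.
move=> s0 mA mS mt; apply: bmeas_sum => n; apply: bmeasM.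
  by apply: bmeasb; exact: measurable_between.
apply: bmeasM; last exact: bmeas_discount_path.
apply: bmeasb; apply: measurable_fun_ler; first exact: msigma.
exact: measurable_departure.
Qed.

End clocked.
End measurable_paths.
Arguments measurable_epoch {R d U A n}.
Arguments measurable_clock {R d U on D K t}.
Arguments measurable_endless_clock {R d U on D k t}.
Arguments measurable_between {R d U A n t}.
Arguments bmeas_discount_path {R d U sigma} msigma {A S s n t}.
Arguments bmeas_system_discount {R d U sigma} msigma {A S s N t}.
Arguments bmeas_busy_discount {R d U sigma} msigma {A S s N t}.

Section renewal_bounds.
Context {R : realType}.

(* Stay [k] is taken as the interval []epoch D k, epoch D k.+1]]. *)
Definition in_stay (on : pred nat) (D : nat -> R) K (T : R) (o : bool) (t : R) : R :=
  ind (t <= T) * \sum_(k < K | on k == o) ind (in_span false (epoch D k) t (D k)).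

Lemma sum_between (A : nat -> R) N t : (forall k, 0 <= A k) ->
  \sum_(n < N) ind (between A n t) = ind (0 <= t) - ind (epoch A N <= t) :> R.
Proof.
move=> A0; elim: N => [|N ih]; first by rewrite big_ord0 epoch0 subrr.
by rewrite big_ord_recr/= ih betweenE//; ring.
Qed.

Lemma sum_in_span (D : nat -> R) K t : (forall k, 0 <= D k) ->
  \sum_(k < K) ind (in_span false (epoch D k) t (D k)) =
  ind (0 < t) - ind (epoch D K < t) :> R.
Proof.
move=> D0; elim: K => [|K ih]; first by rewrite big_ord0 epoch0 subrr.
rewrite big_ord_recr/= ih /in_span -epochS.
have [Kt|Kt] := ltP (epoch D K) t.
  by have [_|_] := leP t (epoch D K.+1); rewrite ?(subrK, subr0, addr0)//; ring.
rewrite (_ : (epoch D K.+1 < t) = false) ?addr0 ?subr0//.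
by apply/negbTE; rewrite -leNgt (le_trans Kt)// epoch_le.
Qed.

Lemma in_stayD (on : pred nat) (D : nat -> R) K T t : (forall k, 0 <= D k) ->
  in_stay on D K T true t + in_stay on D K T false t =
  ind (t <= T) * (ind (0 < t) - ind (epoch D K < t)).
Proof.
move=> D0; rewrite -mulrDr -sum_in_span//; congr (_ * _).
rewrite [RHS](bigID (fun k : 'I_K => on k))/=; congr (_ + _); apply: eq_bigl => k.
  by rewrite eqb_id.
by case: (on k).
Qed.

Lemma in_stay_ge0 on (D : nat -> R) K T o t : 0 <= in_stay on D K T o t.
Proof. by rewrite mulr_ge0// sumr_ge0. Qed.

Lemma in_stay_le1 on (D : nat -> R) K T o t : (forall k, 0 <= D k) ->
  in_stay on D K T o t <= 1.
Proof.
move=> D0; have := in_stayD on K T t D0.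
have h1 := in_stay_ge0 on D K T true t; have h2 := in_stay_ge0 on D K T false t.
have h3 : ind (t <= T) * (ind (0 < t) - ind (epoch D K < t)) <= 1 :> R.
  by case: (t <= T); case: (0 < t); case: (epoch D K < t) => /=; lra.
by case: o; lra.
Qed.

Lemma system_discount01 (sigma : R -> R) A S s N t : 0 <= s -> (forall k, 0 <= A k) ->
  0 <= system_discount sigma A S s N t <= 1.
Proof.
move=> s0 A0; apply/andP; split.
  by apply: sumr_ge0 => n _; rewrite mulr_ge0//; case/andP: (psi01 (departure sigma A S n) (sigma t) s0).
apply: (@le_trans _ _ (\sum_(n < N) ind (between A n t))).
  apply: ler_sum => n _; rewrite ler_piMr//.
  by case/andP: (psi01 (departure sigma A S n) (sigma t) s0).
by rewrite sum_between//; case: (0 <= t); case: (epoch A N <= t) => /=; lra.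
Qed.

(** Cutting both ends of a stay at [T] replaces the factor for [t <= T]; this is the form in which
    [system_discount_step] can be summed over stays. *)
Lemma in_stay_arrival on (D : nat -> R) K T o t :
  in_stay on D K T o t =
  \sum_(k < K | on k == o)
    ind ((Num.min (epoch D k) T < t) && (t <= Num.min (epoch D k.+1) T)).
Proof.
rewrite /in_stay mulr_sumr; apply: eq_bigr => k _.
rewrite /in_span -epochS gt_min le_min.
by have [tT|tT] := leP t T; rewrite ?mul1r ?mul0r ?orbF ?andbT ?andbF.
Qed.

(** A stay of one kind begins where the preceding one, of the other kind, ends. Only the very first
    beginning and the last end remain unmatched. *)
Lemma alternate_sum (on : pred nat) (H : nat -> R) K o :
  (forall k, on k.+1 = ~~ on k) ->
  \sum_(k < K | on k == o) H k - \sum_(k < K | on k == ~~ o) H k.+1 =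
  ind (on 0%N == o) * H 0%N - ind (on K == o) * H K.
Proof.
move=> alt; elim: K => [|K ih]; first by rewrite !big_ord0 !subrr.
rewrite big_mkcond [X in _ - X]big_mkcond !big_ord_recr/= -!big_mkcond/=.
rewrite alt; move: ih; case: (on K); case: o => /=; lra.
Qed.

End renewal_bounds.

Section idle.
Context {R : realType}.

Definition idle (sigma : R -> R) A S N t :=
  \sum_(n < N) ind (between A n t) * ind (departure sigma A S n < sigma t) : R.

(** Once the clock has passed the last departure the workload is 0 and its discount is 1 for every
    [s]; this is why the idle term is free of [s]. *)
Lemma system_discount_idle sigma A S s N t :
  system_discount sigma A S s N t = busy_discount sigma A S s N t + idle sigma A S N t.
Proof.
rewrite -big_split/=; apply: eq_bigr => n _; rewrite -mulrDr; congr (_ * _).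
have [_|dl] := leP (sigma t) (departure sigma A S n); first by rewrite mul1r addr0.
by rewrite mul0r add0r /discount /psi max_l ?mulr0 ?oppr0 ?expR0// subr_le0 ltW.
Qed.

End idle.

(** * The balance of the discounted workload over the stays *)

Section balance.
Context {R : realType} {d : measure_display} {Om : measurableType d}.
Variables (P : probability Om R) (I : choiceType) (X : I -> {RV P >-> R}).
Hypothesis indepX : mutually_independent X.
Variables (iA iS iD : nat -> I).
Hypotheses (iA_inj : injective iA) (iS_inj : injective iS) (iD_inj : injective iD).
Hypotheses (iAS : forall m n, iA m != iS n) (iAD : forall m n, iA m != iD n)
  (iSD : forall m n, iS m != iD n).
Variables (lam : R) (c : bool -> R) (on : pred nat).
Hypotheses (lam0 : 0 < lam) (c0 : forall o, 0 < c o).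
Hypothesis alt : forall k, on k.+1 = ~~ on k.
Hypothesis lawA : forall n, has_law (X (iA n)) (exponential_prob lam).
Hypothesis lawD : forall k, has_law (X (iD k)) (exponential_prob (c (on k))).

Let A n w : R := `|X (iA n) w|.
Let S n w : R := `|X (iS n) w|.
Let D n w : R := `|X (iD n) w|.
Let A0 w n : 0 <= A n w. Proof. exact: normr_ge0. Qed.
Let S0 w n : 0 <= S n w. Proof. exact: normr_ge0. Qed.
Let D0 w n : 0 <= D n w. Proof. exact: normr_ge0. Qed.

Variables (s b : R) (s0 : 0 <= s).
Hypothesis bE : forall n, \int[P]_w expR (- (s * S n w)) = b.

Variables (T : R) (T0 : 0 < T) (N K : nat).

Let sigma w := clock on (D ^~ w) K.
Let G w t := system_discount (sigma w) (A ^~ w) (S ^~ w) s N t.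
Let Gn n w t := discount (sigma w) (A ^~ w) (S ^~ w) s n t.
Let busy w t := busy_discount (sigma w) (A ^~ w) (S ^~ w) s N t.
Let stay o w t := in_stay on (D ^~ w) K T o t.

Let mA n : measurable_fun setT (A n).
Proof. by apply: measurableT_comp => //; exact: measurable_funPT. Qed.
Let mS n : measurable_fun setT (S n).
Proof. by apply: measurableT_comp => //; exact: measurable_funPT. Qed.
Let mD n : measurable_fun setT (D n).
Proof. by apply: measurableT_comp => //; exact: measurable_funPT. Qed.

Let mrest j i : i != j -> measurable_fun [set: rest_type X j]
  ((fun w => `|X i w|) : rest_type X j -> R).
Proof. by move=> ij; apply: measurableT_comp => //; exact: measurable_rest. Qed.

Lemma bmeas_in_stay (d' : measure_display) (U : measurableType d')
    (D' : nat -> U -> R) (t : U -> R) o :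
  (forall k, measurable_fun setT (D' k)) -> (forall k z, 0 <= D' k z) ->
  measurable_fun setT t ->
  bmeas (fun z => in_stay on (D' ^~ z) K T o (t z)).
Proof.
move=> mD' D'0 mt; apply: bmeasM.
  by apply: bmeasb; exact: measurable_fun_ler.
apply: bmeas_sum => k; apply: bmeasb; apply: measurable_in_span => //.
exact: measurable_epoch.
Qed.

(** The quantities [x] (for [o = true]) and [y] (for [o = false]) of the balance equations, at
    finite [T] and along truncated paths; [mean_busy] stands for [x - p]. *)
Definition mean_discount o :=
  \int[uniform_prob T0]_t \int[P]_w (stay o w t * G w t).

Definition mean_busy :=
  \int[uniform_prob T0]_t \int[P]_w (stay true w t * busy w t).

(* The service time of a customer is independent of the other factors, and the
   preceding interarrival time is exponential and independent of the path
   before the arrival. *)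
Lemma arrival_compensator o :
  \int[P]_w (\sum_(n < N) stay o w (epoch (A ^~ w) n.+1) *
     (1 - expR (- (s * S n w))) * Gn n w (epoch (A ^~ w) n.+1)) =
  lam * (1 - b) * T * mean_discount o.
Proof.
have one n : \int[P]_w (stay o w (epoch (A ^~ w) n.+1) *
     (1 - expR (- (s * S n w))) * Gn n w (epoch (A ^~ w) n.+1)) =
  lam * (1 - b) * T * \int[uniform_prob T0]_t \int[P]_w
    (stay o w t * (ind (between (A ^~ w) n t) * Gn n w t)).
  pose k (w : rest_type X (iS n)) : R :=
    stay o w (epoch (A ^~ w) n.+1) * Gn n w (epoch (A ^~ w) n.+1).
  have bk : bmeas k.
    have me : measurable_fun [set: rest_type X (iS n)] (fun w => epoch (A ^~ w) n.+1).
      by apply: measurable_epoch => m _; exact: mrest.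
    have mD1 m : measurable_fun [set: rest_type X (iS n)] (D m).
      by apply: mrest; rewrite eq_sym.
    apply: bmeasM; first exact: bmeas_in_stay.
    apply: bmeas_discount_path => //.
    - by move=> t mt; exact: measurable_clock.
    - by move=> m _; exact: mrest.
    - by move=> m mn; apply: mrest; apply/eqP => /iS_inj mE; rewrite mE ltnn in mn.
  have bg : bmeas (fun x : R => 1 - expR (- (s * `|x|))).
    apply: bmeasB; first exact: bmeas_cst.
    apply: bmeas01 => [|x].
      apply: measurableT_comp => //; apply: measurableT_comp => //.
      by apply: measurable_funM => //; exact: measurableT_comp.
    by rewrite expR_ge0/= -expR0 ler_expR oppr_le0 mulr_ge0.
  transitivity (\int[P]_w ((1 - expR (- (s * S n w))) * k w)).
    by apply: eq_Rintegral => w _; rewrite /k; ring.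
  (* At the arrival of customer [n], the factor [Gn n] involves only the services of customers
     [m < n]. *)
  rewrite (independent_mean indepX bg bk).
  have -> : \int[P]_w (1 - expR (- (s * `|X (iS n) w|))) = 1 - b.
    rewrite bRintegralB ?bRintegral_cst ?bE//; first exact: bmeas_cst.
    apply: bmeas01 => [|w].
      apply: measurableT_comp => //; apply: measurableT_comp => //.
      by apply: measurable_funM => //; exact: mS.
    by rewrite expR_ge0/= -expR0 ler_expR oppr_le0 mulr_ge0.
  have mA1 m : (m < n)%N -> measurable_fun [set: rest_type X (iA n)] (A m).
    by move=> mn; apply: mrest; apply/eqP => /iA_inj mE; rewrite mE ltnn in mn.
  have mS1 m : measurable_fun [set: rest_type X (iA n)] (S m).
    by apply: mrest; rewrite eq_sym.
  have mD1 m : measurable_fun [set: rest_type X (iA n)] (D m).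
    by apply: mrest; rewrite eq_sym.
  pose U := (measurableTypeR R * rest_type X (iA n))%type.
  pose h (z : U) : R := stay o z.2 z.1 * Gn n z.2 z.1.
  have bh : bmeas h.
    apply: bmeasM.
      apply: (bmeas_in_stay (D' := fun k (z : U) => D k z.2)) => //.
      by move=> m; exact: (measurableT_comp (mD1 m)).
    apply: (bmeas_discount_path (sigma := fun z : U => sigma z.2) _
      (A := fun k (z : U) => A k z.2) (S := fun k (z : U) => S k z.2)) => //.
    - move=> t mt; apply: (measurable_clock (D := fun k (z : U) => D k z.2)) => //.
      by move=> m _; exact: (measurableT_comp (mD1 m)).
    - by move=> m mn; exact: (measurableT_comp (mA1 m mn)).
    - by move=> m mn; exact: (measurableT_comp (mS1 m)).
  have h0 z : 0 <= h z.
    rewrite mulr_ge0 ?in_stay_ge0//.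
    by case/andP: (psi01 (departure (sigma z.2) (A ^~ z.2) (S ^~ z.2) n) (sigma z.2 z.1) s0).
  have me : measurable_fun [set: rest_type X (iA n)] (fun w => epoch (A ^~ w) n).
    exact: measurable_epoch.
  have := compensator indepX lam0 (lawA n) true T0 me
    (fun w => epoch_ge0 n (A0 w)) bh h0.
  (* The cut-off at [T] in [compensator] is already contained in [stay]. *)
  rewrite (_ : \int[P]_w (h (epoch (A ^~ w) n + `|X (iA n) w|, w) * _) = \int[P]_w k w); last first.
    apply: eq_Rintegral => w _; rewrite -/(A n w) /h/= -epochS /k /stay /in_stay.
    by case: (_ <= T); rewrite ?mul0r ?mulr1 ?mulr0.
  move=> ->; rewrite (_ : lam * (1 - b) * T = (1 - b) * (lam * T)); last by ring.
  rewrite !mulrA; congr (_ * _); apply: eq_Rintegral => t _.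
  by apply: eq_Rintegral => w _; rewrite /h /between epochS /=; ring.
have me n : measurable_fun setT (fun w => epoch (A ^~ w) n).
  exact: measurable_epoch.
rewrite bRintegral_sum; last first.
  move=> n; apply: bmeasM.
    apply: bmeasM; first exact: bmeas_in_stay.
    apply: bmeasB; first exact: bmeas_cst.
    apply: bmeas01 => [|w].
      apply: measurableT_comp => //; apply: measurableT_comp => //.
      by apply: measurable_funM => //; exact: mS.
    by rewrite expR_ge0/= -expR0 ler_expR oppr_le0 mulr_ge0.
  apply: bmeas_discount_path => // t mt; exact: measurable_clock.
under eq_bigr do rewrite one.
rewrite -mulr_sumr /mean_discount; congr (_ * _).
pose U := (measurableTypeR R * Om)%type.
rewrite -(bRintegral2_sum (uniform_prob T0) P (fun (n : 'I_N) (z : U) =>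
  stay o z.2 z.1 * (ind (between (A ^~ z.2) n z.1) * Gn n z.2 z.1))) => [|n].
  apply: eq_Rintegral => t _; apply: eq_Rintegral => w _.
  by rewrite /G /system_discount mulr_sumr.
have mA2 m : measurable_fun setT (fun z : U => A m z.2).
  exact: (measurableT_comp (mA m)).
have mS2 m : measurable_fun setT (fun z : U => S m z.2).
  exact: (measurableT_comp (mS m)).
have mD2 m : measurable_fun setT (fun z : U => D m z.2).
  exact: (measurableT_comp (mD m)).
apply: bmeasM.
  by apply: (bmeas_in_stay (D' := fun k (z : U) => D k z.2)).
apply: bmeasM.
  by apply: bmeasb; apply: (measurable_between (A := fun k (z : U) => A k z.2)).
apply: (bmeas_discount_path (sigma := fun z : U => sigma z.2) _
  (A := fun k (z : U) => A k z.2) (S := fun k (z : U) => S k z.2)) => //.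
by move=> t mt; apply: (measurable_clock (D := fun k (z : U) => D k z.2)).
Qed.

Let ind_congr (a : bool) (x g g' : R) : (a -> g' = g) ->
  ind a * (x * g) = x * ind a * g'.
Proof. by case: a => [->//|_]; rewrite ?(mulr1, mul1r) // !(mul0r, mulr0). Qed.

(** While stay [k] lasts, its end has constant hazard [c (on k)], by [compensator] applied to
    [D k]. *)
Lemma switch_compensator k : (k < K)%N ->
  \int[P]_w (ind (epoch (D ^~ w) k.+1 <= T) * G w (epoch (D ^~ w) k.+1)) =
  c (on k) * T * \int[uniform_prob T0]_t \int[P]_w
    (ind (t <= T) * ind (in_span false (epoch (D ^~ w) k) t (D k w)) * G w t).
Proof.
move=> kK; pose Re := rest_type X (iD k).
have mA1 m : measurable_fun [set: Re] (A m) by exact: mrest.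
have mS1 m : measurable_fun [set: Re] (S m) by exact: mrest.
have mD1 m : (m < k)%N -> measurable_fun [set: Re] (D m).
  by move=> mk; apply: mrest; apply/eqP => /iD_inj mE; rewrite mE ltnn in mk.
pose U := (measurableTypeR R * Re)%type.
(* While stay [k] lasts, the workload does not depend on its duration. *)
pose Ge (w : Re) t := system_discount (endless_clock on (D ^~ w) k) (A ^~ w) (S ^~ w) s N t.
have GeE w t : t <= epoch (D ^~ w) k.+1 -> G w t = Ge w t.
  move=> tk; apply: system_discount_eq; first exact: A0.
  by move=> x xt; apply: clock_endless => //; exact: le_trans tk.
pose h (z : U) : R := ind (z.1 <= T) * Ge z.2 z.1.
have bh : bmeas h.
  apply: bmeasM; first by apply: bmeasb; exact: measurable_fun_ler.
  apply: (bmeas_system_discount (sigma := fun z : U => endless_clock on (D ^~ z.2) k) _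
    (A := fun k (z : U) => A k z.2) (S := fun k (z : U) => S k z.2)) => //.
  - move=> t mt; apply: (measurable_endless_clock (D := fun k (z : U) => D k z.2)) => //.
    by move=> m mk; exact: (measurableT_comp (mD1 m mk)).
  - by move=> m; exact: (measurableT_comp (mA1 m)).
  - by move=> m; exact: (measurableT_comp (mS1 m)).
have h0 z : 0 <= h z.
  rewrite mulr_ge0//.
  by case/andP: (system_discount01 (endless_clock on (D ^~ z.2) k) (S ^~ z.2) N z.1 s0 (A0 z.2)).
have me : measurable_fun [set: Re] (fun w => epoch (D ^~ w) k).
  exact: measurable_epoch.
have := compensator indepX (c0 (on k)) (lawD k) false T0 me
  (fun w => epoch_ge0 k (D0 w)) bh h0.
rewrite (_ : \int[P]_w (h (epoch (D ^~ w) k + `|X (iD k) w|, w) * _) =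
    \int[P]_w (ind (epoch (D ^~ w) k.+1 <= T) * G w (epoch (D ^~ w) k.+1))); last first.
  apply: eq_Rintegral => w _; rewrite -/(D k w) /h/= epochS GeE ?epochS//.
  by case: (_ <= T); rewrite ?mul0r ?mulr1.
move=> ->; congr (_ * _); apply: eq_Rintegral => t _; apply: eq_Rintegral => w _.
rewrite /h/=; apply: ind_congr => /andP[_ tk].
by apply: GeE; rewrite epochS.
Qed.

Let joint := (measurableTypeR R * Om)%type.

Let mA2 m : measurable_fun setT (fun z : joint => A m z.2).
Proof. exact: (measurableT_comp (mA m)). Qed.
Let mS2 m : measurable_fun setT (fun z : joint => S m z.2).
Proof. exact: (measurableT_comp (mS m)). Qed.
Let mD2 m : measurable_fun setT (fun z : joint => D m z.2).
Proof. exact: (measurableT_comp (mD m)). Qed.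

Let bG2 : bmeas (fun z : joint => G z.2 z.1).
Proof.
apply: (bmeas_system_discount (sigma := fun z : joint => sigma z.2) _
  (A := fun k (z : joint) => A k z.2) (S := fun k (z : joint) => S k z.2)) => //.
by move=> t mt; apply: (measurable_clock (D := fun k (z : joint) => D k z.2)).
Qed.

Let bbusy2 : bmeas (fun z : joint => busy z.2 z.1).
Proof.
apply: (bmeas_busy_discount (sigma := fun z : joint => sigma z.2) _
  (A := fun k (z : joint) => A k z.2) (S := fun k (z : joint) => S k z.2)) => //.
by move=> t mt; apply: (measurable_clock (D := fun k (z : joint) => D k z.2)).
Qed.

Let bstay2 o : bmeas (fun z : joint => stay o z.2 z.1).
Proof. by apply: (bmeas_in_stay (D' := fun k (z : joint) => D k z.2)). Qed.

Let bG t : measurable_fun setT t -> bmeas (fun w => G w (t w)).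
Proof.
move=> mt; apply: bmeas_system_discount => // u mu; exact: measurable_clock.
Qed.

Let G01 w t : 0 <= G w t <= 1.
Proof. exact: system_discount01. Qed.

(* The increments of the discounted workload over the stays with [on k = o],
   due to switches, drift and arrivals, add up to three boundary terms, each at
   most 1 in absolute value. *)
Lemma balance o :
  `|c o * T * mean_discount o - c (~~ o) * T * mean_discount (~~ o)
    - (if o then s * T * mean_busy else 0)
    + lam * (1 - b) * T * mean_discount o| <= 3.
Proof.
have me n : measurable_fun setT (fun w => epoch (D ^~ w) n).
  exact: measurable_epoch.
have meA n : measurable_fun setT (fun w => epoch (A ^~ w) n).
  exact: measurable_epoch.
pose H k w := ind (epoch (D ^~ w) k <= T) * G w (epoch (D ^~ w) k).
have H01 k w : 0 <= H k w <= 1.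
  have /andP[g0 g1] := G01 w (epoch (D ^~ w) k).
  by rewrite /H; case: (_ <= T); rewrite ?mul1r ?mul0r ?g0 ?lexx//= ler01.
have bH k : bmeas (H k).
  apply: bmeasM; last exact: bG.
  by apply: bmeasb; exact: measurable_fun_ler.
have switched o' : \int[P]_w (\sum_(k < K | on k == o') H k.+1 w) =
    c o' * T * mean_discount o'.
  rewrite bRintegral_sum//.
  pose F k (z : joint) := ind (z.1 <= T) *
    ind (in_span false (epoch (D ^~ z.2) k) z.1 (D k z.2)) * G z.2 z.1.
  have bF k : bmeas (F k).
    apply: bmeasM => //; apply: bmeasM.
      by apply: bmeasb; exact: measurable_fun_ler.
    apply: bmeasb; apply: measurable_in_span => //.
    by apply: (measurable_epoch (A := fun k (z : joint) => D k z.2)).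
  transitivity (\sum_(k < K | on k == o') c o' * T *
      \int[uniform_prob T0]_t \int[P]_w F k (t, w)).
    by apply: eq_bigr => k /eqP <-; rewrite switch_compensator.
  rewrite -mulr_sumr -(bRintegral2_sum (uniform_prob T0) P (fun k : 'I_K => F k))//.
  congr (_ * _).
  apply: eq_Rintegral => t _; apply: eq_Rintegral => w _.
  by rewrite /F /= -mulr_suml -mulr_sumr.
pose u k w := Num.min (epoch (D ^~ w) k) T.
(* Cut at [T], the stay in progress at that time ends with [G w T] instead of a switch term. *)
pose last w := \sum_(k < K | on k == o)
  (ind (epoch (D ^~ w) k <= T) - ind (epoch (D ^~ w) k.+1 <= T)) * G w T.
pose jumps w := \sum_(n < N) stay o w (epoch (A ^~ w) n.+1) *
     (1 - expR (- (s * S n w))) * Gn n w (epoch (A ^~ w) n.+1).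
(* The loss due to keeping only [N] customers, if it occurs in a stay of kind [o]. *)
pose ending w := stay o w (epoch (A ^~ w) N) * Gn N w (epoch (A ^~ w) N).
pose drift w := \int[uniform_prob T0]_t (stay o w t * busy w t).
have stepE k w : (k < K)%N -> G w (u k.+1 w) - G w (u k w) = H k.+1 w - H k w +
    (ind (epoch (D ^~ w) k <= T) - ind (epoch (D ^~ w) k.+1 <= T)) * G w T.
  move=> kK; rewrite /H /u; have kk : epoch (D ^~ w) k <= epoch (D ^~ w) k.+1.
    exact: epoch_le.
  have [k1T|Tk1] := leP (epoch (D ^~ w) k.+1) T.
    by rewrite (le_trans kk k1T) (min_l (le_trans kk k1T)) /= !mulr1n; ring.
  by have [kT|Tk] := leP (epoch (D ^~ w) k) T; rewrite /= ?mulr1n ?mulr0n; ring.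
have u0 k w : 0 <= u k w by rewrite le_min epoch_ge0//= ltW.
have uS k w : u k w <= u k.+1 w.
  by rewrite le_min !ge_min lexx epoch_le// orbT.
have uT k w : u k w <= T by rewrite ge_min lexx orbT.
have path w : \sum_(k < K | on k == o) H k.+1 w - \sum_(k < K | on k == o) H k w +
    last w = (if o then s else 0) * T * drift w - jumps w - ending w.
  rewrite /last -sumrB -big_split/=.
  have msig : measurable_fun setT (sigma w : measurableTypeR R -> R).
    by apply: (measurable_clock (D := fun k (_ : measurableTypeR R) => D k w)).
  pose dr k := \int[uniform_prob T0]_t (ind ((u k w < t) && (t <= u k.+1 w)) * busy w t).
  transitivity (\sum_(k < K | on k == o) ((if o then s else 0) * T * dr k -
    \sum_(n < N) ind ((u k w < epoch (A ^~ w) n.+1) && (epoch (A ^~ w) n.+1 <= u k.+1 w)) *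
      (1 - expR (- (s * S n w))) * Gn n w (epoch (A ^~ w) n.+1) -
    ind ((u k w < epoch (A ^~ w) N) && (epoch (A ^~ w) N <= u k.+1 w)) *
      Gn N w (epoch (A ^~ w) N))).
    apply: eq_bigr => k /eqP ok; rewrite -stepE//.
    apply: (system_discount_step T0 msig (on := o)) => // x y ux xy yu.
    have [kT|Tk] := leP (epoch (D ^~ w) k) T.
      rewrite -ok; apply: (clock_stay _ (D0 w) (ltn_ord k)) => //.
        by move: ux; rewrite /u min_l.
      by apply: le_trans yu _; rewrite ge_min lexx.
    (* Stay [k] begins after [T], so its cut interval reduces to the point [T]. *)
    have -> : x = y; last by rewrite !subrr if_same.
    apply/eqP; rewrite eq_le xy/=; apply: le_trans yu _; apply: le_trans ux.
    by rewrite /u (min_r (ltW Tk)) ge_min lexx orbT.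
  rewrite !sumrB -mulr_sumr; congr (_ - _ - _).
  - congr (_ * _); rewrite /drift -bRintegral_sum => [|k].
      apply: eq_Rintegral => t _.
      by rewrite /stay in_stay_arrival mulr_suml.
    apply: bmeasM.
      apply: bmeasb; apply: measurable_and.
        exact: measurable_fun_ltr.
      exact: measurable_fun_ler.
    exact: (bmeas_section2 w bbusy2).
  - rewrite exchange_big/=; apply: eq_bigr => n _.
    by rewrite /stay in_stay_arrival !mulr_suml.
  - by rewrite /ending /stay in_stay_arrival mulr_suml.
pose ends w := ind (on 0%N == o) * H 0%N w - ind (on K == o) * H K w.
have path' w : \sum_(k < K | on k == o) H k.+1 w -
    \sum_(k < K | on k == ~~ o) H k.+1 w - ends w + last w =
    (if o then s else 0) * T * drift w - jumps w - ending w.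
  rewrite -path; have := alternate_sum (H ^~ w) K o alt; rewrite -/(ends w).
  lra.
have bends : bmeas ends.
  by apply: bmeasB; apply: bmeasM => //; exact: bmeas_cst.
have blast : bmeas last.
  apply: bmeas_sum => k; apply: bmeasM; last exact: bG.
  by apply: bmeasB; apply: bmeasb; exact: measurable_fun_ler.
have bdrift : bmeas drift.
  exact: (bmeas_fubini2 (uniform_prob T0) P (bmeasM (bstay2 o) bbusy2)).
have bGnA n m : (n <= m)%N -> bmeas (fun w => Gn n w (epoch (A ^~ w) m)).
  move=> nm; apply: bmeas_discount_path => // t mt; exact: measurable_clock.
have bstay m : bmeas (fun w => stay o w (epoch (A ^~ w) m)).
  exact: bmeas_in_stay.
have bjumps : bmeas jumps.
  apply: bmeas_sum => n; apply: bmeasM; last exact: bGnA.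
  apply: bmeasM => //; apply: bmeasB; first exact: bmeas_cst.
  apply: bmeas01 => [|w].
    apply: measurableT_comp => //; apply: measurableT_comp => //.
    by apply: measurable_funM => //; exact: mS.
  by rewrite expR_ge0/= -expR0 ler_expR oppr_le0 mulr_ge0.
have bending : bmeas ending by apply: bmeasM => //; exact: bGnA.
have bHs o' : bmeas (fun w => \sum_(k < K | on k == o') H k.+1 w).
  exact: bmeas_sum.
have e1 : -1 <= \int[P]_w ends w <= 1.
  apply: bRintegral_bnd => // w; rewrite /ends.
  have /andP[? ?] := H01 0%N w; have /andP[? ?] := H01 K w.
  by case: (on 0%N == o); case: (on K == o); rewrite /= ?mul1r ?mul0r; lra.
clearbody ends.
have intE : \int[P]_w (\sum_(k < K | on k == o) H k.+1 w -
    \sum_(k < K | on k == ~~ o) H k.+1 w - ends w + last w) =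
  \int[P]_w ((if o then s else 0) * T * drift w - jumps w - ending w).
  by apply: eq_Rintegral => w _; exact: path'.
move: intE; rewrite bRintegralD//; last first.
  by apply: bmeasB => //; exact: bmeasB.
rewrite bRintegralB//; last exact: bmeasB.
rewrite bRintegralB// !switched.
rewrite bRintegralB//; last first.
  by apply: bmeasB => //; apply: bmeasM => //; exact: bmeas_cst.
rewrite bRintegralB//; last by apply: bmeasM => //; exact: bmeas_cst.
rewrite bRintegralZ// arrival_compensator.
have -> : (if o then s else 0) * T * \int[P]_w drift w =
    if o then s * T * mean_busy else 0.
  case: (o) @drift bdrift {path path'} => drift' _; last by rewrite !mul0r.
  rewrite /drift' /mean_busy; congr (_ * _).
  by rewrite -(bfubini (uniform_prob T0) P (bmeasM (bstay2 true) bbusy2)).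
(* The coefficients in [last] telescope over all stays: at most one stay straddles [T]. *)
have e2 : 0 <= \int[P]_w last w <= 1.
  apply: bRintegral_bnd => // w; have /andP[? ?] := G01 w T.
  have t0 (k : nat) : 0 <= ind (epoch (D ^~ w) k <= T) - ind (epoch (D ^~ w) k.+1 <= T) :> R.
    rewrite subr_ge0 ler_nat; have [kT|//] := leP (epoch (D ^~ w) k.+1) T.
    by rewrite (le_trans _ kT)// epoch_le.
  rewrite sumr_ge0/= => [|k _]; last by rewrite mulr_ge0.
  apply: (@le_trans _ _ (\sum_(k < K) (ind (epoch (D ^~ w) k <= T) - ind (epoch (D ^~ w) k.+1 <= T)))).
    rewrite [leRHS](bigID (fun k : 'I_K => on k == o))/= ler_wpDr//.
      by apply: sumr_ge0.
    by apply: ler_sum => k _; rewrite ler_piMr.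
  have -> : \sum_(k < K) (ind (epoch (D ^~ w) k <= T) - ind (epoch (D ^~ w) k.+1 <= T)) =
      ind (epoch (D ^~ w) 0 <= T) - ind (epoch (D ^~ w) K <= T) :> R.
    elim: K => [|K' ih]; first by rewrite big_ord0 subrr.
    by rewrite big_ord_recr/= ih; ring.
  by case: (epoch (D ^~ w) 0 <= T); case: (epoch (D ^~ w) K <= T) => /=; lra.
have e3 : 0 <= \int[P]_w ending w <= 1.
  apply: bRintegral_bnd => // w.
  have /andP[g0 g1] := psi01 (departure (sigma w) (A ^~ w) (S ^~ w) N) (sigma w (epoch (A ^~ w) N)) s0.
  rewrite mulr_ge0 ?in_stay_ge0//= -[leRHS]mulr1 ler_pM ?in_stay_ge0 ?in_stay_le1//.
have bound (p q i j x y z : R) : -1 <= x <= 1 -> 0 <= y <= 1 -> 0 <= z <= 1 ->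
    p - q - x + y = i - j - z -> `|p - q - i + j| <= 3.
  move=> /andP[? ?] /andP[? ?] /andP[? ?] ?.
  by rewrite ler_norml; apply/andP; split; lra.
exact: bound.
Qed.

Lemma bmeas_discountD : bmeas (fun t : measurableTypeR R =>
  \int[P]_w ((stay true w t + stay false w t) * G w t)).
Proof.
have bF : bmeas (fun z : joint => (stay true z.2 z.1 + stay false z.2 z.1) * G z.2 z.1).
  by apply: bmeasM => //; exact: bmeasD.
exact: (bmeas_fubini1 (uniform_prob T0) P bF).
Qed.

Lemma mean_discountD : mean_discount true + mean_discount false =
  \int[uniform_prob T0]_t \int[P]_w ((stay true w t + stay false w t) * G w t).
Proof.
have bF o : bmeas (fun z : joint => stay o z.2 z.1 * G z.2 z.1) by exact: bmeasM.
rewrite -bRintegralD; last 2 first.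
- exact: (bmeas_fubini1 (uniform_prob T0) P (bF true)).
- exact: (bmeas_fubini1 (uniform_prob T0) P (bF false)).
apply: eq_Rintegral => t _; rewrite -bRintegralD; last 2 first.
- exact: (bmeas_section1 t (bF true)).
- exact: (bmeas_section1 t (bF false)).
by apply: eq_Rintegral => w _; rewrite mulrDl.
Qed.

(** The right-hand side does not contain [s]: it is the finite-time version of the idle probability
    [p]. *)
Lemma mean_discount_busy : mean_discount true - mean_busy =
  \int[uniform_prob T0]_t \int[P]_w
    (stay true w t * idle (sigma w) (A ^~ w) (S ^~ w) N t).
Proof.
have bF : bmeas (fun z : joint => stay true z.2 z.1 * G z.2 z.1) by exact: bmeasM.
have bF' : bmeas (fun z : joint => stay true z.2 z.1 * busy z.2 z.1) by exact: bmeasM.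
rewrite -bRintegralB; last 2 first.
- exact: (bmeas_fubini1 (uniform_prob T0) P bF).
- exact: (bmeas_fubini1 (uniform_prob T0) P bF').
apply: eq_Rintegral => t _; rewrite -bRintegralB; last 2 first.
- exact: (bmeas_section1 t bF).
- exact: (bmeas_section1 t bF').
by apply: eq_Rintegral => w _; rewrite /G system_discount_idle /busy; ring.
Qed.

End balance.

Section eseries.
Context {R : realType}.

Lemma eseries_finite (p : pred nat) (F : nat -> R) K :
  (forall k, p k -> (K <= k)%N -> F k = 0) ->
  fine (\sum_(k <oo | p k) (F k)%:E)%E = \sum_(k < K | p k) F k.
Proof.
move=> F0; rewrite (_ : (\sum_(k <oo | p k) _)%E = (\sum_(k < K | p k) F k)%:E)//.
apply: cvg_lim => //; apply: cvg_near_cst; near=> n.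
have Kn : (K <= n)%N by near: n; exists K.
rewrite sumEFin; congr (_%:E).
rewrite (@big_cat_nat _ _ _ K)//= [X in _ + X]big_nat_cond [X in _ + X]big1 ?addr0 ?big_mkord//.
by move=> k /andP[/andP[Kk _] pk]; exact: F0.
Unshelve. all: end_near. Qed.

End eseries.

(** * The workload of the polling model *)

Section path_workload.
Context {R : realType} (j0 : queue) (A S D : queue -> nat -> R) (q : queue).
Hypotheses (A0 : forall n, 0 <= A q n) (S0 : forall n, 0 <= S q n)
  (D0 : forall i n, 0 <= D i n).

Let stay k := D (queue_of_stay j0 k) k./2.
Let stay0 k : 0 <= stay k. Proof. exact: D0. Qed.
Let on : pred nat := fun k => queue_of_stay j0 k == q.

Lemma server_time_clock K t : t <= epoch stay K ->
  server_time j0 D q t = clock on stay K t.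
Proof.
move=> tK; apply: eseries_finite => k _ Kk; rewrite -!/(epoch stay _).
by rewrite !min_r ?subrr// (le_trans tK)// epoch_le// ltnW.
Qed.

Lemma clock_nondecreasing K x y : x <= y -> clock on stay K x <= clock on stay K y.
Proof.
move=> xy; apply: ler_sum => k _.
have : epoch stay k <= epoch stay k.+1 by exact: epoch_le.
set a := epoch _ k; set b := epoch _ _ => ab.
have [] := leP b x; have [] := leP a x; have [] := leP b y; have [] := leP a y; lra.
Qed.

Lemma clock_ge0 K t : 0 <= t -> 0 <= clock on stay K t.
Proof.
move=> t0; apply: le_trans (clock_nondecreasing K t0).
apply: sumr_ge0 => k _; rewrite !min_r ?subrr//; exact: epoch_ge0.
Qed.

Variables (K : nat) (t : R).
Hypotheses (t0 : 0 <= t) (tK : t <= epoch stay K).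
Let sigma := clock on stay K.

Lemma completion_departure n : epoch (A q) n.+1 <= t ->
  completion j0 A S D q n = departure sigma (A q) (S q) n.+1.
Proof.
elim: n => [|n ih] nt; rewrite /= -!/(epoch (A q) _) (server_time_clock (K := K)) -/sigma ?(le_trans nt)//.
  (* [departure] takes a maximum with 0 for the first customer, where [completion] takes none; the
     clock being nonnegative, this makes no difference. *)
  by rewrite max_l// clock_ge0// epoch_ge0.
by rewrite ih// (le_trans _ nt)// epoch_le.
Qed.

Lemma sum_remaining_service n : epoch (A q) n <= t ->
  \sum_(m < n) remaining_service j0 A S D q m t =
  Num.max 0 (departure sigma (A q) (S q) n - sigma t).
Proof.
elim: n => [|n ih] nt.
  by rewrite big_ord0/= max_l// sub0r oppr_le0 clock_ge0.
rewrite big_ord_recr/= ih; last by rewrite (le_trans _ nt)// epoch_le.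
rewrite /remaining_service completion_departure// (server_time_clock (K := K))//= -/sigma.
have := clock_nondecreasing K nt; rewrite -/sigma.
have := S0 n; set a := sigma (epoch _ _); set x := sigma t; set y := departure _ _ _ n.
move: (S q n) => z z0 ax.
(* If the clock has not passed the departure [y] of the earlier customers, customer [n] still needs
   all of [z]; otherwise the earlier ones contribute 0. *)
have [xy|yx] := leP x y.
  rewrite (max_r (le_trans ax xy)) !max_r ?min_l; lra.
rewrite (max_l (_ : y - x <= 0)) ?add0r; last lra.
by rewrite min_r// lerBlDr addrC lerD2l ge_max ax ltW.
Qed.

Lemma workload_departure n : between (A q) n t ->
  workload j0 A S D q t = Num.max 0 (departure sigma (A q) (S q) n - sigma t).
Proof.
move=> /andP[nt tn]; rewrite -sum_remaining_service// /workload.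
rewrite (@eseries_finite _ _ _ n) => [|k kt nk].
  apply: eq_bigl => k.
  by rewrite -/(epoch (A q) k.+1) (le_trans _ nt)// epoch_le.
have : t < t; last by rewrite ltxx.
by apply: lt_le_trans tn _; apply: le_trans kt; rewrite -/(epoch (A q) k.+1) epoch_le.
Qed.

Lemma system_discount_workload s N : t < epoch (A q) N ->
  system_discount sigma (A q) (S q) s N t = expR (- (s * workload j0 A S D q t)).
Proof.
move=> tN; transitivity (\sum_(n < N) ind (between (A q) n t) *
    expR (- (s * workload j0 A S D q t))).
  apply: eq_bigr => n _; case: (boolP (between (A q) n t)) => [nt|_]; last by rewrite !mul0r.
  by rewrite (workload_departure nt).
by rewrite -mulr_suml sum_between// t0 leNgt tN subr0 mul1r.
Qed.

End path_workload.

Section sandwich.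
Context {R : realType} {d : measure_display} {T : measurableType d}.

(** No measurability is involved: the integral of a nonnegative function is a supremum over the
    simple functions below it. *)
Lemma le_integral_pointwise (mu : {measure set T -> \bar R}) (f g : T -> \bar R) :
  (forall x, 0 <= f x)%E -> (forall x, f x <= g x)%E ->
  (\int[mu]_x f x <= \int[mu]_x g x)%E.
Proof.
move=> f0 fg; have g0 x : (0 <= g x)%E by exact: le_trans (f0 x) (fg x).
rewrite !ge0_integralTE//; apply: le_ereal_sup => _ [h hf <-]; exists h => // x.
exact: le_trans (hf x) (fg x).
Qed.

(* To be applied to functions of the workload, whose defining series converge,
   and hence are measurable, only off a null set. *)
Lemma Rintegral_sandwich (P : probability T R) (f l u : T -> R) :
  bmeas l -> bmeas u -> (forall x, 0 <= f x) -> (forall x, 0 <= l x) ->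
  {ae P, forall x, l x <= f x <= u x} ->
  \int[P]_x l x <= \int[P]_x f x <= \int[P]_x u x.
Proof.
move=> bl bu f0 l0 [N [mN PN sN]].
have lfu x : ~ N x -> l x <= f x <= u x by move=> Nx; apply: contrapT => h; apply: Nx; exact: sN.
have el : (\int[P]_x (l x)%:E <= \int[P]_x (f x)%:E)%E.
  (* Setting the lower bound to 0 on the null set [N] keeps its integral and makes the inequality
     hold everywhere. *)
  rewrite (_ : (\int[P]_x (l x)%:E)%E = (\int[P]_x (l x * \1_(~` N) x)%:E)%E); last first.
    have ml : measurable_fun setT (EFin \o l) by apply/measurable_EFinP; exact: bl.1.
    apply: ae_eq_integral => //.
      by apply/measurable_EFinP; apply: measurable_funM; [exact: bl.1 | apply: measurable_indic; exact: measurableC].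
    exists N; split => // x /= h; apply: contrapT => Nx; apply: h => _.
    by rewrite indicE mem_set// mulr1.
  apply: le_integral_pointwise => x; rewrite lee_fin indicE.
    by rewrite mulr_ge0.
  case: (boolP (x \in ~` N)) => [/set_mem Nx|_]; last by rewrite mulr0.
  by rewrite mulr1; case/andP: (lfu x Nx).
have eu : (\int[P]_x (f x)%:E <= \int[P]_x (u x)%:E)%E.
  have mu' : measurable_fun setT (EFin \o u) by apply/measurable_EFinP; exact: bu.1.
  (* Likewise, the upper bound is set to [+oo] on [N]. *)
  rewrite (_ : (\int[P]_x (u x)%:E)%E = (\int[P]_x (if x \in N then +oo else (u x)%:E))%E); last first.
    apply: ae_eq_integral => //.
      apply: measurable_fun_if => //.
      - apply: (measurable_fun_bool true) => //; rewrite setTI preimage_mem_true; exact: mN.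
      - exact: measurable_funTS.
    exists N; split => // x /= h; apply: contrapT => Nx; apply: h => _.
    by rewrite memNset.
  apply: le_integral_pointwise => x; first by rewrite lee_fin.
  case: ifPn => [_|/negP xN]; first by rewrite leey.
  by rewrite lee_fin; case/andP: (lfu x (fun h => xN (mem_set h))).
have fl : (\int[P]_x (l x)%:E)%E \is a fin_num.
  by rewrite -EFin_Rintegral.
have fu : (\int[P]_x (u x)%:E)%E \is a fin_num.
  by rewrite -EFin_Rintegral.
have ff : (\int[P]_x (f x)%:E)%E \is a fin_num.
  by rewrite fin_numE; apply/andP; split; apply/eqP => h; move: el eu; rewrite h;
    rewrite -?EFin_Rintegral.
by apply/andP; split; apply: fine_le.
Qed.

End sandwich.

(** * Sums of exponential variables leave every bounded interval *)

Section no_explosion.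
Context {R : realType} {d : measure_display} {Om : measurableType d}.
Variables (P : probability Om R) (I : choiceType) (X : I -> {RV P >-> R}).
Hypothesis indepX : mutually_independent X.
Variables (i : nat -> I) (i_inj : injective i) (r : nat -> R) (rmax : R).
Hypotheses (r0 : forall n, 0 < r n) (r_max : forall n, r n <= rmax).
Hypothesis lawX : forall n, has_law (X (i n)) (exponential_prob (r n)).

Let Y n w : R := `|X (i n) w|.
Let Y0 w n : 0 <= Y n w. Proof. exact: normr_ge0. Qed.

Lemma has_law_exponential n : has_law (X (i n)) (exponential_law (r0 n)).
Proof. exact: lawX. Qed.

Let bexp : bmeas (fun x : R => expR (- `|x|)).
Proof.
apply: bmeas01 => [|x].
  by apply: measurableT_comp => //; exact: measurableT_comp.
by rewrite expR_ge0/= -expR0 ler_expR oppr_le0.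
Qed.

(** By independence the transform at 1 is a product of factors [r k / (r k + 1)], each at most
    [rmax / (rmax + 1)]. *)
Lemma epoch_laplace n :
  \int[P]_w expR (- epoch (Y ^~ w) n) <= (rmax / (rmax + 1)) ^+ n.
Proof.
elim: n => [|n ih].
  under eq_Rintegral do rewrite epoch0 oppr0 expR0.
  by rewrite bRintegral_cst expr0.
pose k (w : rest_type X (i n)) := expR (- epoch (Y ^~ w) n).
have bk : bmeas k.
  apply: bmeas01 => [|w]; last first.
    by rewrite expR_ge0/= -expR0 ler_expR oppr_le0 epoch_ge0.
  apply: measurableT_comp => //; apply: measurableT_comp => //.
  apply: measurable_epoch => m mn; apply: measurableT_comp => //.
  by apply: measurable_rest; apply/eqP => /i_inj mE; rewrite mE ltnn in mn.
rewrite (_ : \int[P]_w _ = \int[P]_w (expR (- Y n w) * k w)); last first.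
  by apply: eq_Rintegral => w _; rewrite epochS opprD expRD mulrC.
rewrite (independent_mean indepX bexp bk).
have -> : \int[P]_w expR (- `|X (i n) w|) = r n / (r n + 1).
  rewrite (Rintegral_has_law (has_law_exponential n) bexp).
  rewrite -(integral_exponential_laplace (r0 n) ler01).
  by apply: eq_Rintegral => x _; rewrite mul1r.
have rn := r0 n; have rm := r_max n.
rewrite exprS ler_pM//.
- by rewrite divr_ge0// ?addr_ge0 ?ltW.
- by apply: Rintegral_ge0 => w _; exact: expR_ge0.
- rewrite ler_pdivrMr ?addr_gt0// mulrAC ler_pdivlMr ?addr_gt0//; first by nra.
  exact: lt_le_trans rm.
Qed.

(** Exponential Markov inequality: the indicator is at most [exp (T - epoch)], whose mean decreases
    geometrically in [n] because the rates are bounded. *)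
Lemma no_explosion (T e : R) : 0 < e ->
  exists n, \int[P]_w ind (epoch (Y ^~ w) n <= T) <= e.
Proof.
move=> e0; have rm0 : 0 < rmax by apply: lt_le_trans (r_max 0).
have q1 : `|rmax / (rmax + 1)| < 1.
  by rewrite ger0_norm ?divr_ge0 ?addr_ge0 ?ltW// ltr_pdivrMr ?addr_gt0// mul1r ltrDl.
have q0 : 0 < e / expR T by rewrite divr_gt0 ?expR_gt0.
have /cvgrPdist_le/(_ _ q0)[n _ /(_ n (leqnn n))] := cvg_expr q1.
rewrite sub0r normrN ger0_norm; last first.
  by rewrite exprn_ge0// divr_ge0 ?addr_ge0 ?ltW.
rewrite ler_pdivlMr ?expR_gt0// => qn; exists n; apply: le_trans qn.
have me : measurable_fun setT (fun w => epoch (Y ^~ w) n).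
  apply: measurable_epoch => m mn; apply: measurableT_comp => //.
have be : bmeas (fun w => expR (- epoch (Y ^~ w) n)).
  apply: bmeas01 => [|w].
    by apply: measurableT_comp => //; apply: measurableT_comp.
  by rewrite expR_ge0/= -expR0 ler_expR oppr_le0 epoch_ge0.
apply: (@le_trans _ _ (expR T * \int[P]_w expR (- epoch (Y ^~ w) n))).
  rewrite -bRintegralZ//; apply: le_bRintegral => [||w].
  - by apply: bmeasb; exact: measurable_fun_ler.
  - by apply: bmeasM => //; exact: bmeas_cst.
  - rewrite -expRD; case: (leP (epoch (Y ^~ w) n) T) => h /=; last by rewrite expR_ge0.
    by rewrite -expR0 ler_expR subr_ge0.
by rewrite mulrC ler_pM2r ?expR_gt0//; exact: epoch_laplace.
Qed.

End no_explosion.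

(** * Truncation to finitely many customers and stays *)

Section truncation.
Context {R : realType} {dB : measure_display} {TB : measurableType dB}.
Variables (Q : probability TB R) (B : queue -> {RV Q >-> R}) (lam c : queue -> R).
Hypotheses (B_gt0 : forall i, {ae Q, forall w, 0 < B i w})
  (lam0 : forall i, 0 < lam i) (c0 : forall i, 0 < c i).
Context {d : measure_display} {Om : measurableType d}.
Variables (P : probability Om R) (X : input -> queue -> nat -> {RV P >-> R}).
Hypothesis inputs : polling_inputs B lam c X.
Variables (j0 q : queue).

Let Y (j : input * queue * nat) : {RV P >-> R} := X j.1.1 j.1.2 j.2.
Let indepY : mutually_independent Y. Proof. by case: inputs. Qed.

Definition arrival_input n : input * queue * nat := (Interarrival, q, n).
Definition service_input n : input * queue * nat := (Service, q, n).
Definition stay_input k : input * queue * nat :=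
  (Residing, queue_of_stay j0 k, k./2).
Definition stays_here : pred nat := fun k => queue_of_stay j0 k == q.

Lemma arrival_input_inj : injective arrival_input. Proof. by move=> m n []. Qed.
Lemma service_input_inj : injective service_input. Proof. by move=> m n []. Qed.
(** The queue visited gives the parity of the stay number, and the index at this queue gives its
    half. *)
Lemma stay_input_inj : injective stay_input.
Proof.
move=> m n [e h]; rewrite -(odd_double_half m) -(odd_double_half n) h; congr (_ + _)%N.
by congr nat_of_bool; move: e; rewrite /queue_of_stay; case: (odd m); case: (odd n); case: j0.
Qed.

Lemma stays_here_alternate k : stays_here k.+1 = ~~ stays_here k.
Proof. by rewrite /stays_here /queue_of_stay/=; case: (odd k); case: j0; case: q. Qed.

Definition leaving_rate o := if o then c q else c (other_queue q).

Lemma leaving_rateE k : leaving_rate (stays_here k) = c (queue_of_stay j0 k).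
Proof.
by rewrite /leaving_rate /stays_here; case: (queue_of_stay j0 k); case: q.
Qed.

Lemma leaving_rate_gt0 o : 0 < leaving_rate o. Proof. by case: o; exact: c0. Qed.

Let A n w : R := `|Y (arrival_input n) w|.
Let S n w : R := `|Y (service_input n) w|.
Let D k w : R := `|Y (stay_input k) w|.
Let A0 w n : 0 <= A n w. Proof. exact: normr_ge0. Qed.
Let S0 w n : 0 <= S n w. Proof. exact: normr_ge0. Qed.
Let D0 w n : 0 <= D n w. Proof. exact: normr_ge0. Qed.
Let mA n : measurable_fun setT (A n).
Proof. by apply: measurableT_comp => //; exact: measurable_funPT. Qed.
Let mS n : measurable_fun setT (S n).
Proof. by apply: measurableT_comp => //; exact: measurable_funPT. Qed.
Let mD n : measurable_fun setT (D n).
Proof. by apply: measurableT_comp => //; exact: measurable_funPT. Qed.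

Lemma service_laplace s n : 0 <= s -> \int[P]_w expR (- (s * S n w)) =
  \int[Q]_w expR (- (s * `|B q w|)).
Proof.
move=> s0; have bg : bmeas (fun x : R => expR (- (s * `|x|))).
  apply: bmeas01 => [|x].
    apply: measurableT_comp => //; apply: measurableT_comp => //.
    by apply: measurable_funM => //; exact: measurableT_comp.
  by rewrite expR_ge0/= -expR0 ler_expR oppr_le0 mulr_ge0.
have lawS : has_law (Y (service_input n)) (distribution Q (B q)).
  by case: inputs => _ _ lawS _; exact: lawS.
rewrite -(bRintegral_pushforward Q (B q) bg).
rewrite -(bRintegral_pushforward P (Y (service_input n)) bg).
by apply: eq_measure_Rintegral => E mE; exact: lawS.
Qed.

Lemma measurable_negative : measurable [set x : R | x < 0].
Proof.
have := @measurable_itv R `]-oo, 0%R[; rewrite (_ : [set` _] = [set x | x < 0])//.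
Qed.

Lemma ge0_of_law (Z : {RV P >-> R}) (mu : set R -> \bar R) : has_law Z mu ->
  mu [set x | x < 0] = 0%E -> {ae P, forall w, 0 <= Z w}.
Proof.
move=> lawZ mu0; exists [set w | Z w < 0]; split.
- have := @measurable_funPT _ _ _ _ Z measurableT _ measurable_negative.
  by rewrite setTI.
- rewrite -[RHS]mu0 -lawZ//; exact: measurable_negative.
- by move=> w /= /negP; rewrite -ltNge.
Qed.

Lemma inputs_ge0 : {ae P, forall w, forall k i n, 0 <= X k i n w}.
Proof.
have exp_neg r (r0 : 0 < r) : exponential_prob r [set x : R | x < 0] = 0%E.
  have [N [mN N0 sN]] := exponential_law_ge0 r0.
  apply: (@subset_measure0 _ _ _ (exponential_law r0) _ N) => //.
    exact: measurable_negative.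
  by move=> x /= x0; apply: sN => /=; apply/negP; rewrite -ltNge.
have one k i : {ae P, forall w, forall n, 0 <= X k i n w}.
  apply: ae_foralln => n; case: inputs => _ lawA lawS lawD; case: k.
  - by apply: ge0_of_law (lawA i n) _; exact: exp_neg.
  - apply: ge0_of_law (lawS i n) _.
    have [N [mN N0 sN]] := B_gt0 i.
    apply: (@subset_measure0 _ _ _ Q _ N) => //.
      have := @measurable_funPT _ _ _ _ (B i) measurableT _ measurable_negative.
      by rewrite setTI.
    by move=> x /= x0; apply: sN => /=; apply/negP; rewrite -leNgt ltW.
  - by apply: ge0_of_law (lawD i n) _; exact: exp_neg.
have two k : {ae P, forall w, forall i n, 0 <= X k i n w}.
  by apply: filterS2 (one k Q1) (one k Q2) => w h1 h2 [].
by apply: filterS3 (two Interarrival) (two Service) (two Residing) => w h1 h2 h3 [].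
Qed.

Let W u w := workload j0 (fun i n => X Interarrival i n w)
  (fun i n => X Service i n w) (fun i n => X Residing i n w) q u.

Lemma workload_ge0 (A' S' D' : queue -> nat -> R) i u :
  0 <= workload j0 A' S' D' i u.
Proof.
rewrite fine_ge0// nneseries_ge0// => n _ _.
by rewrite lee_fin le_max lexx.
Qed.

Let Gd s N K w u :=
  system_discount (clock stays_here (D ^~ w) K) (A ^~ w) (S ^~ w) s N u.
Let stay T K o w u := in_stay stays_here (D ^~ w) K T o u.

(** Outside an event of probability at most [e], both the [N] arrivals and the [K] stays extend
    beyond [T], and there the truncated path is the true one. That [N] and [K] do not depend on [s]
    is what later makes the idle average the same for all [s]. *)
Lemma truncation T e : 0 < e -> exists N K, forall s u, 0 <= s -> 0 < u <= T ->
  `| \int[P]_w expR (- (s * `|W u w|)) -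
     \int[P]_w ((stay T K true w u + stay T K false w u) * Gd s N K w u) | <= e.
Proof.
move=> e0; have e2 : 0 < e / 2 by rewrite divr_gt0.
have lawA n : has_law (Y (arrival_input n)) (exponential_prob (lam q)).
  by case: inputs => _ law _ _; exact: law.
have lawD n : has_law (Y (stay_input n)) (exponential_prob (c (queue_of_stay j0 n))).
  by case: inputs => _ _ _ law; exact: law.
have cmax n : c (queue_of_stay j0 n) <= c Q1 + c Q2.
  by case: (queue_of_stay j0 n); rewrite ?lerDl ?lerDr ltW.
have [N hN] := no_explosion indepY arrival_input_inj (fun=> lam0 q) (fun=> lexx _) lawA T e2.
have [K hK] := no_explosion indepY stay_input_inj (fun=> c0 _) cmax lawD T e2.
exists N, K => s u s0 /andP[u0 uT].
have meA : measurable_fun setT (fun w => epoch (A ^~ w) N) by exact: measurable_epoch.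
have meD : measurable_fun setT (fun w => epoch (D ^~ w) K) by exact: measurable_epoch.
pose l w := (stay T K true w u + stay T K false w u) * Gd s N K w u.
pose r w := ind (epoch (A ^~ w) N <= T) + ind (epoch (D ^~ w) K <= T) : R.
have bl : bmeas l.
  apply: bmeasM; first by apply: bmeasD; exact: bmeas_in_stay.
  apply: bmeas_system_discount => // t mt; exact: measurable_clock.
have br : bmeas r.
  by apply: bmeasD; apply: bmeasb; exact: measurable_fun_ler.
have G01 w : 0 <= Gd s N K w u <= 1 by exact: system_discount01.
have l0 w : 0 <= l w.
  by rewrite mulr_ge0 ?addr_ge0 ?in_stay_ge0//; case/andP: (G01 w).
have E01 w : 0 <= expR (- (s * `|W u w|)) <= 1.
  by rewrite expR_ge0/= -expR0 ler_expR oppr_le0 mulr_ge0.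
have : {ae P, forall w, l w <= expR (- (s * `|W u w|)) <= l w + r w}.
  move: inputs_ge0; apply: filterS => w X0.
  have AE : A ^~ w = fun n => X Interarrival q n w.
    by apply/funext => n; apply: ger0_norm; exact: X0.
  have SE : S ^~ w = fun n => X Service q n w.
    by apply/funext => n; apply: ger0_norm; exact: X0.
  have DE : D ^~ w = fun k => X Residing (queue_of_stay j0 k) k./2 w.
    by apply/funext => k; apply: ger0_norm; exact: X0.
  have /andP[g0 g1] := G01 w; have /andP[x0 x1] := E01 w.
  rewrite /l /stay in_stayD// uT u0 mul1r /r.
  have [uK|Ku] := leP u (epoch (D ^~ w) K); last first.
    rewrite subrr mul0r x0 add0r (le_trans (ltW Ku) uT) (le_trans x1)// lerDr//.
  rewrite subr0 mul1r.
  have [uN|Nu] := ltP u (epoch (A ^~ w) N).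
    rewrite /W ger0_norm ?workload_ge0// /Gd AE SE DE.
    rewrite (@system_discount_workload _ j0 (fun i n => X Interarrival i n w)
      (fun i n => X Service i n w) (fun i n => X Residing i n w) q _ _ _ K u)//.
    - by rewrite lexx lerDl addr_ge0.
    - exact: ltW.
    - by move: uK; rewrite DE.
    - by move: uN; rewrite AE.
  have -> : Gd s N K w u = 0.
    apply: big1 => n _; rewrite /between.
    have -> : (u < epoch (A ^~ w) n.+1) = false; last by rewrite andbF mul0r.
    by apply/negbTE; rewrite -leNgt (le_trans _ Nu)// epoch_le.
  by rewrite x0 add0r (le_trans Nu uT) (le_trans x1)// lerDl.
move=> /(Rintegral_sandwich bl (bmeasD bl br) (fun w => expR_ge0 _) l0)/andP[h1 h2].
move: h2; rewrite bRintegralD// [X in _ + X]bRintegralD//; last 2 first.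
  by apply: bmeasb; exact: measurable_fun_ler.
  by apply: bmeasb; exact: measurable_fun_ler.
rewrite ger0_norm ?subr_ge0// lerBlDl => h2; apply: le_trans h2 _.
by rewrite lerD2l [leRHS]splitr lerD.
Qed.

End truncation.

(** * Long-time averages *)

Section cesaro.
Context {R : realType}.

Lemma uniform_prob_initial (T v : R) (T0 : 0 < T) : 0 <= v -> v <= T ->
  \int[uniform_prob T0]_t ind ((0 < t) && (t <= v)) = v / T.
Proof.
move=> v0 vT.
have := @uniform_segment R T T0 false 0 v (fun=> 1) (lexx 0) v0 vT
  (bmeas_cst _) (fun=> ler01).
rewrite Rintegral_cst// [X in fine X]lebesgue_measure_itv/= lte_fin mul1r => h.
have -> : v / T = (if 0 < v then v else 0) / T.
  by case: ltgtP v0 => // <-.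
have -> : (if 0 < v then v else 0) = fine (if 0 < v then (v%:E + (- 0)%:E)%E else 0%E).
  by case: ifP => //= _; rewrite subr0.
rewrite -h mulrAC divff ?gt_eqF// mul1r.
by apply: eq_Rintegral => t _; rewrite mulr1.
Qed.

(** Only the approximations [g n] are integrated, so nothing is asked of the measurability of [Phi].
    Times up to some [M] carry a fraction [M / T] of the average; beyond [M], [Phi] is close to its
    limit. *)
Lemma cesaro_uniform (Phi : R -> R) (g : nat -> R -> R) (phi : R) :
  Phi u @[u --> +oo] --> phi ->
  (forall u, 0 <= Phi u <= 1) -> 0 <= phi <= 1 ->
  (forall n, bmeas (g n : measurableTypeR R -> R)) ->
  (forall n u, 0 < u <= n.+1%:R -> `|Phi u - g n u| <= n.+1%:R^-1) ->
  (forall n u, ~~ (0 < u <= n.+1%:R) -> g n u = 0) ->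
  \int[uniform_prob (ltr0Sn R n)]_u g n u @[n --> \oo] --> phi.
Proof.
move=> cPhi Phi01 /andP[phi0 phi1] bg gPhi g0.
apply/cvgrPdist_le => e e0.
have e3 : 0 < e / 3 by rewrite divr_gt0.
have /cvgrPdist_le/(_ _ e3)[M' [_ hM']] := cPhi.
pose M := Num.max 0 M' + 1.
have M0 : 0 < M by rewrite ltr_wpDl// le_max lexx.
have hM u : M < u -> `|phi - Phi u| <= e / 3.
  move=> Mu; apply: hM'; apply: lt_trans Mu.
  by rewrite /M; have [] := leP 0 M'; lra.
near=> n.
(* This makes [M <= T], [M / T <= e / 3] and [T^-1 <= e / 3] for [T = n.+1%:R]; the three thirds of
   [e] are the two errors beyond [M] and the share of the times up to [M]. *)
have nM : (M + 1) / (e / 3) + M + 1 <= n.+1%:R.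
  apply: (@le_trans _ _ n%:R); last by rewrite ler_nat.
  by near: n; exact: nbhs_infty_ger.
set T : R := n.+1%:R in nM *; have T0 : 0 < T := ltr0Sn R n.
have d0 : 0 < (M + 1) / (e / 3) by rewrite divr_gt0// addr_gt0.
have Me : M + 1 <= T * (e / 3) by rewrite -ler_pdivrMr//; lra.
have T1 : T^-1 <= e / 3 by rewrite -[leLHS]mul1r ler_pdivrMr// mulrC; lra.
have MT : M <= T by lra.
have bpart (v : R) : bmeas (fun t : measurableTypeR R => ind ((0 < t) && (t <= v)) : R).
  by apply: bmeasb; apply: measurable_and; [exact: measurable_fun_ltr|exact: measurable_fun_ler].
pose h u := g n u - phi * ind ((0 < u) && (u <= T)).
have bh : bmeas (h : measurableTypeR R -> R).
  by apply: bmeasB => //; apply: bmeasM => //; exact: bmeas_cst.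
have part1 : \int[uniform_prob (ltr0Sn R n)]_u ind ((0 < u) && (u <= T)) = 1.
  rewrite uniform_prob_initial; [|exact: ltW|exact: lexx].
  by apply: mulfV; rewrite gt_eqF.
have -> : phi - \int[uniform_prob (ltr0Sn R n)]_u g n u =
    - \int[uniform_prob (ltr0Sn R n)]_u h u.
  rewrite bRintegralB//; last by apply: bmeasM => //; exact: bmeas_cst.
  rewrite (bRintegralZ _ phi (bpart T)) part1 mulr1.
  by rewrite opprB.
rewrite normrN.
pose k u : R := e / 3 + e / 3 + ind ((0 < u) && (u <= M)).
have bk : bmeas (k : measurableTypeR R -> R).
  by apply: bmeasD => //; exact: bmeas_cst.
have hk u : `|h u| <= k u.
  rewrite /h /k; case: (boolP (0 < u <= T)) => [uT|uT]; last first.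
    by rewrite g0// mulr0 subrr normr0 !addr_ge0// ltW.
  rewrite mulr1.
  have h1 := gPhi n u uT; have -> : g n u - phi = (Phi u - phi) - (Phi u - g n u) by ring.
  apply: le_trans (ler_normB _ _) _; case/andP: uT => u0 uT; rewrite u0/=.
  have /andP[P0 P1] := Phi01 u.
  have [uM|Mu] := leP u M.
    have : `|Phi u - phi| <= 1 by rewrite ler_norml; apply/andP; split; lra.
    by rewrite (_ : ind true = 1 :> R)//; move: (le_trans h1 T1); lra.
  by rewrite (_ : ind false = 0 :> R)// distrC; move: (hM u Mu) (le_trans h1 T1); lra.
apply: (@le_trans _ _ (\int[uniform_prob (ltr0Sn R n)]_u k u)).
  rewrite ler_norml; apply/andP; split.
    rewrite -[X in X <= _]mulN1r -bRintegralZ//; apply: le_bRintegral => //.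
      by apply: bmeasM => //; exact: bmeas_cst.
    by move=> u; rewrite mulN1r; have := hk u; rewrite ler_norml => /andP[].
  by apply: le_bRintegral => // u; have := hk u; rewrite ler_norml => /andP[].
rewrite bRintegralD//; last exact: bmeas_cst.
rewrite bRintegral_cst uniform_prob_initial; [|exact: ltW|exact: MT].
rewrite [leRHS](_ : e = e / 3 + e / 3 + e / 3) ?lerD2l; last by lra.
by rewrite ler_pdivrMr// mulrC; lra.
Unshelve. all: end_near. Qed.

End cesaro.

(** * The stationary Laplace transform *)

Section transform.
Context {R : realType} {dB : measure_display} {TB : measurableType dB}.
Variables (Q : probability TB R) (B : queue -> {RV Q >-> R}) (lam c : queue -> R).
Hypotheses (B_gt0 : forall i, {ae Q, forall w, 0 < B i w})
  (lam0 : forall i, 0 < lam i) (c0 : forall i, 0 < c i).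
Variables (q : queue) (nu : probability (measurableTypeR R) R).
Hypotheses (iB : Q.-integrable setT (EFin \o (fun w => `|B q w|)))
  (iB2 : Q.-integrable setT (EFin \o (fun w => `|B q w| ^+ 2))).
Hypothesis steady : steady_state_workload B lam c q nu.

Let b s := \int[Q]_w expR (- (s * `|B q w|)).
Let L s := lam q * (1 - b s).
Let phi s := \int[nu]_x expR (- (s * `|x : R|)).
Let c1 := c q.
Let c2 := c (other_queue q).
Let factor s := (c2 + L s) / (c1 + c2 + L s) - L s / s.

Let c1_gt0 : 0 < c1. Proof. exact: c0. Qed.
Let c2_gt0 : 0 < c2. Proof. exact: c0. Qed.

Let bexp s : 0 <= s -> bmeas (fun x : R => expR (- (s * `|x|))).
Proof.
move=> s0; apply: bmeas01 => [|x].
  apply: measurableT_comp => //; apply: measurableT_comp => //.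
  by apply: measurable_funM => //; exact: measurableT_comp.
by rewrite expR_ge0/= -expR0 ler_expR oppr_le0 mulr_ge0.
Qed.

Let bexp' s : 0 <= s -> bmeas ((fun x : R => expR (- (s * `|x|))) : measurableTypeR R -> R).
Proof. exact: bexp. Qed.

Let phi01 s : 0 <= s -> 0 <= phi s <= 1.
Proof.
move=> s0; apply: (bRintegral_bnd nu (bexp' s0)) => x.
by rewrite expR_ge0/= -expR0 ler_expR oppr_le0 mulr_ge0.
Qed.

Let L_ge0 s : 0 <= s -> 0 <= L s.
Proof.
move=> s0; rewrite mulr_ge0 ?(ltW (lam0 q))// subr_ge0.
have bB : bmeas (fun w => expR (- (s * `|B q w|))).
  exact: (bmeas_comp (bexp s0) (@measurable_funPT _ _ _ _ (B q))).
suff /andP[] : 0 <= b s <= 1 by [].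
apply: (bRintegral_bnd _ bB) => w.
by rewrite expR_ge0/= -expR0 ler_expR oppr_le0 mulr_ge0.
Qed.

(** The sequence is the idle average up to time [n.+1], with truncation levels fixed before [s]. Its
    limit therefore cannot depend on [s], although only the right-hand side shows that the limit
    exists. *)
Lemma transform_cst : exists p : nat -> R, forall s, 0 < s ->
  p n @[n --> \oo] --> phi s * factor s.
Proof.
case: steady => d [Om [P [X [j0 [inputs cW]]]]].
pose Y (j : input * queue * nat) : {RV P >-> R} := X j.1.1 j.1.2 j.2.
have indepY : mutually_independent Y by case: inputs.
pose W u w := workload j0 (fun i n => X Interarrival i n w)
  (fun i n => X Service i n w) (fun i n => X Residing i n w) q u.
have /choice[NK hNK] : forall n : nat, exists NK : nat * nat, forall s u, 0 <= s -> 0 < u <= n.+1%:R ->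
  `| \int[P]_w expR (- (s * `|W u w|)) -
     \int[P]_w ((in_stay (stays_here j0 q) (fun k => `|Y (stay_input j0 k) w|) NK.2 n.+1%:R true u +
      in_stay (stays_here j0 q) (fun k => `|Y (stay_input j0 k) w|) NK.2 n.+1%:R false u) *
     system_discount (clock (stays_here j0 q) (fun k => `|Y (stay_input j0 k) w|) NK.2)
       (fun k => `|Y (arrival_input q k) w|) (fun k => `|Y (service_input q k) w|) s NK.1 u) | <= n.+1%:R^-1.
  move=> n; have e0 : 0 < n.+1%:R^-1 :> R by rewrite invr_gt0.
  have [N [K h]] := truncation B_gt0 lam0 c0 inputs j0 q n.+1%:R e0.
  by exists (N, K).
pose m s n := @mean_discount _ _ _ P _ Y (arrival_input q) (service_input q) (stay_input j0)
  (stays_here j0 q) s _ (ltr0Sn R n) (NK n).1 (NK n).2.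
pose z s n := @mean_busy _ _ _ P _ Y (arrival_input q) (service_input q) (stay_input j0)
  (stays_here j0 q) s _ (ltr0Sn R n) (NK n).1 (NK n).2.
pose idle_mean n := \int[uniform_prob (ltr0Sn R n)]_t \int[P]_w
  (in_stay (stays_here j0 q) (fun k => `|Y (stay_input j0 k) w|) (NK n).2 n.+1%:R true t *
   idle (clock (stays_here j0 q) (fun k => `|Y (stay_input j0 k) w|) (NK n).2)
     (fun k => `|Y (arrival_input q k) w|) (fun k => `|Y (service_input q k) w|) (NK n).1 t).
have pE s n : 0 <= s -> m s n true - z s n = idle_mean n.
  by move=> s0; apply: mean_discount_busy.
exists idle_mean => s s0; have s0' := ltW s0.
have totalE n : m s n true + m s n false = \int[uniform_prob (ltr0Sn R n)]_u
    \int[P]_w ((in_stay (stays_here j0 q) (fun k => `|Y (stay_input j0 k) w|) (NK n).2 n.+1%:R true u +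
      in_stay (stays_here j0 q) (fun k => `|Y (stay_input j0 k) w|) (NK n).2 n.+1%:R false u) *
     system_discount (clock (stays_here j0 q) (fun k => `|Y (stay_input j0 k) w|) (NK n).2)
       (fun k => `|Y (arrival_input q k) w|) (fun k => `|Y (service_input q k) w|) s (NK n).1 u).
  exact: mean_discountD.
have total : m s n true + m s n false @[n --> \oo] --> phi s.
  under eq_fun do rewrite totalE.
  apply: (@cesaro_uniform _ (fun u => \int[P]_w expR (- (s * `|W u w|)))).
  - have cf : continuous (fun x : R => expR (- (s * `|x|))).
      move=> x; apply: continuous_comp; last exact: continuous_expR.
      apply: cvgN; apply: cvgM; first exact: cvg_cst.
      exact: norm_continuous.
    have bf : exists M : R, forall x : R, `|expR (- (s * `|x|))| <= M.
      by case: (bexp s0').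
    have := cW _ cf bf; rewrite -(EFin_Rintegral nu (bexp' s0')).
    by move=> /fine_cvg.
  - move=> u.
    have E01 w : 0 <= expR (- (s * `|W u w|)) <= 1.
      by rewrite expR_ge0/= -expR0 ler_expR oppr_le0 mulr_ge0.
    have := @Rintegral_sandwich _ _ _ P _ (fun=> 0) (fun=> 1)
      (bmeas_cst _) (bmeas_cst _) (fun w => expR_ge0 _) (fun=> lexx 0) (aeW _ E01).
    by rewrite !bRintegral_cst.
  - exact: phi01.
  - by move=> n; apply: bmeas_discountD.
  - by move=> n u uT; apply: hNK.
  - move=> n u uT; rewrite -[RHS](bRintegral_cst P); apply: eq_Rintegral => w _.
    rewrite in_stayD//; move: uT; case: (u <= n.+1%:R); rewrite ?mul0r//.
    rewrite andbT => u0; rewrite (negbTE u0) (_ : (_ < u) = false) ?subrr ?mulr0 ?mul0r//.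
    apply/negbTE; rewrite -leNgt; rewrite -leNgt in u0; apply: le_trans u0 _.
    exact: epoch_ge0.
have T0 n : 0 < n.+1%:R :> R by rewrite ltr0n.
have lawA n : has_law (Y (arrival_input q n)) (exponential_prob (lam q)).
  by case: inputs => _ law _ _; exact: law.
have lawD k : has_law (Y (stay_input j0 k)) (exponential_prob (leaving_rate c q (stays_here j0 q k))).
  by rewrite leaving_rateE; case: inputs => _ _ _ law; exact: law.
have iSA k l : arrival_input q k != service_input q l by [].
have iAD k l : arrival_input q k != stay_input j0 l by [].
have iSD k l : service_input q k != stay_input j0 l by [].
have bal n o : `|leaving_rate c q o * n.+1%:R * m s n o -
    leaving_rate c q (~~ o) * n.+1%:R * m s n (~~ o) -
    (if o then s * n.+1%:R * z s n else 0) + lam q * (1 - b s) * n.+1%:R * m s n o| <= 3.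
  exact: (@balance _ _ _ P _ Y indepY _ _ _ (@arrival_input_inj q)
  (@service_input_inj q) (@stay_input_inj j0) iSA iAD iSD _ _ _ (lam0 q)
  (leaving_rate_gt0 c0 q) (stays_here_alternate j0 q) lawA lawD s (b s) s0'
  (fun n => service_laplace inputs q n s0') _ (ltr0Sn R n) (NK n).1 (NK n).2 o).
clearbody m z idle_mean.
pose x n := m s n true; pose y n := m s n false.
pose E1 n := c1 * x n - c2 * y n - s * z s n + L s * x n.
pose E2 n := c2 * y n - c1 * x n + L s * y n.
have small (E : nat -> R) : (forall n, `|n.+1%:R * E n| <= 3) -> E n @[n --> \oo] --> 0.
  move=> hE; have h3 : 3 * n.+1%:R^-1 @[n --> \oo] --> (0 : R).
    by rewrite -[X in _ --> X](mulr0 3); apply: cvgM; [exact: cvg_cst | exact: cvg_harmonic].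
  apply: norm_cvg0; apply: (@squeeze_cvgr _ _ _ _ (fun=> 0) (fun n => 3 * n.+1%:R^-1)) => //.
    apply: nearW => n; rewrite normr_ge0/= ler_pdivlMr//.
    by have := hE n; rewrite normrM ger0_norm// mulrC.
  exact: cvg_cst.
have E1_0 : E1 n @[n --> \oo] --> 0.
  apply: small => n; have := bal n true; rewrite /leaving_rate/= -/c1 -/c2.
  by congr (`|_| <= _); rewrite /E1 /L /x /y; ring.
have E2_0 : E2 n @[n --> \oo] --> 0.
  apply: small => n; have := bal n false; rewrite /leaving_rate/= -/c1 -/c2 subr0.
  by congr (`|_| <= _); rewrite /E2 /L /x /y; ring.
have cL : c1 + c2 + L s != 0.
  by rewrite gt_eqF// ltr_wpDr ?L_ge0// addr_gt0.
(* [E2] determines [x] from [x + y], and [E1 + E2] determines [z]; the idle average is [x - z]. *)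
have idleE n : idle_mean n = factor s * (x n + y n) - (c1 + c2 + L s)^-1 * E2 n +
    s^-1 * (E1 n + E2 n).
  rewrite -(pE s n s0') /E1 /E2 /factor -/(x n); field.
  by rewrite cL gt_eqF.
under eq_fun do rewrite idleE.
rewrite (_ : phi s * factor s = factor s * phi s - (c1 + c2 + L s)^-1 * 0 + s^-1 * (0 + 0)); last first.
  by ring.
apply: cvgD; first apply: cvgB.
- by apply: cvgM => //; exact: cvg_cst.
- by apply: cvgM => //; exact: cvg_cst.
- by apply: cvgM; [exact: cvg_cst | exact: cvgD].
Qed.

(** The constant is computed along [u n = 1 / (n + 1)]: there [phi] tends to 1 because [nu] is a
    probability, [L] tends to 0, and [L / s] tends to the load of the queue. *)
Theorem transform_formula s : 0 < s ->
  let L := lam q * (1 - \int[Q]_w expR (- (s * `|B q w|))) in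
  \int[nu]_x expR (- (s * `|x : R|)) *
    ((c (other_queue q) + L) / (c q + c (other_queue q) + L) - L / s) =
  c (other_queue q) / (c q + c (other_queue q)) - lam q * \int[Q]_w `|B q w|.
Proof.
rewrite -/c1 -/c2 /= -/(b s) -/(L s) -/(phi s) -/(factor s).
move=> s0; have [p cp] := transform_cst.
pose u n : R := n.+1%:R^-1.
have u0 n : 0 < u n by rewrite invr_gt0 ltr0n.
have cu : u n @[n --> \oo] --> 0 by exact: cvg_harmonic.
have Fu n : phi (u n) * factor (u n) = phi s * factor s.
  exact: (cvg_unique _ (cp _ (u0 n)) (cp _ s0)).
have cphi : phi (u n) @[n --> \oo] --> (1 : R).
  rewrite -[X in _ --> X](bRintegral_cst nu).
  apply: (@bounded_cvg_Rintegral _ _ _ nu (fun n (x : measurableTypeR R) => expR (- (u n * `|x : R|))) (fun=> 1) 1).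
  - by move=> n; exact: (bexp' (ltW (u0 n))).1.
  - exact: measurable_cst.
  - move=> x; rewrite -expR0 -oppr0 -(mul0r `|x : R|).
    apply: continuous_cvg; first exact: continuous_expR.
    by apply: cvgN; apply: cvgM => //; exact: cvg_cst.
  - move=> n x; rewrite ger0_norm ?expR_ge0// -expR0 ler_expR oppr_le0.
    by rewrite mulr_ge0// ltW.
set mB := \int[Q]_w `|B q w|.
have mBq : measurable_fun setT (fun w => `|B q w|) by exact: measurableT_comp.
have c2nd := laplace_second_order mBq (fun w => normr_ge0 _) iB iB2 u0 cu.
(* The first-order limit is read off the second-order expansion multiplied by [u n]. *)
have cLu : L (u n) / u n @[n --> \oo] --> lam q * mB.
  set k := (X in _ --> X) in c2nd.
  rewrite -[X in _ --> X](_ : lam q * (mB - 0 * k) = _); last by rewrite mul0r subr0.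
  rewrite (_ : (fun n => _) = fun n => lam q * (mB - u n * ((b (u n) - 1 + u n * mB) / u n ^+ 2))).
    apply: cvgM; first exact: cvg_cst.
    by apply: cvgB; [exact: cvg_cst | exact: cvgM].
  by apply/funext => n; rewrite /L; field; rewrite gt_eqF.
have cL : L (u n) @[n --> \oo] --> 0.
  rewrite -[X in _ --> X](mulr0 (lam q * mB)).
  rewrite (_ : (fun n => _) = fun n => L (u n) / u n * u n); first exact: cvgM.
  by apply/funext => n; rewrite mulfVK// gt_eqF.
have cF : phi (u n) * factor (u n) @[n --> \oo] --> c2 / (c1 + c2) - lam q * mB.
  rewrite -[X in _ --> X]mul1r; apply: cvgM => //; apply: cvgB => //.
  have cD (k : R) : k + L (u n) @[n --> \oo] --> k.
    by rewrite -[X in _ --> X]addr0; apply: cvgD => //; exact: cvg_cst.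
  by apply: cvgM => //; apply: cvgV => //; rewrite gt_eqF// addr_gt0.
have E : (fun n => phi (u n) * factor (u n)) = fun=> phi s * factor s.
  by apply/funext => n; exact: Fu.
move: cF; rewrite E => cF; exact: (cvg_unique _ (cvg_cst _) cF).
Qed.

End transform.

(** * Heavy traffic *)

Section positive_variable.
Context {R : realType} {d : measure_display} {T : measurableType d}.
Variables (Q : probability T R) (Z : {RV Q >-> R}).
Hypotheses (Z_gt0 : {ae Q, forall w, 0 < Z w}) (Z_mean : ('E_Q[Z] < +oo)%E).

Let mZ : measurable_fun setT Z. Proof. exact: measurable_funPT. Qed.
Let mabs : measurable_fun setT (fun w => `|Z w|). Proof. exact: measurableT_comp. Qed.

Let EabsE : 'E_Q[Z]%E = (\int[Q]_w (`|Z w|)%:E)%E.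
Proof.
rewrite unlock; apply: ae_eq_integral => //.
- exact/measurable_EFinP.
- exact/measurable_EFinP.
- by move: Z_gt0; apply: filterS => w Z0 _; rewrite ger0_norm// ltW.
Qed.

Lemma integrable_positive : Q.-integrable setT (EFin \o (fun w => `|Z w|)).
Proof.
apply/integrableP; split; first exact/measurable_EFinP.
rewrite (_ : (\int[Q]_w _)%E = 'E_Q[Z]%E)// EabsE.
by apply: eq_integral => w _; rewrite /= normr_id.
Qed.

Lemma mean_positive : \int[Q]_w `|Z w| = mean Q Z.
Proof. by rewrite /mean EabsE. Qed.

(** Mean 0 would force [Z] to vanish almost surely. Positivity is needed to divide by the mean
    service time. *)
Lemma mean_gt0 : 0 < mean Q Z.
Proof.
rewrite -mean_positive lt_neqAle Rintegral_ge0 ?andbT => [|w _]; last by [].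
apply/eqP => E0.
have : (\int[Q]_w `|(Z w)%:E|)%E = 0%E.
  have := integrable_fin_num measurableT integrable_positive.
  by move=> /fineK <-; rewrite -[X in X%:E]/(Rintegral _ _ _) -E0.
move=> /(ae_eq_integral_abs Q measurableT (_ : measurable_fun _ (EFin \o Z))).
move=> /(_ (ltac:(exact/measurable_EFinP))) h0.
have : {ae Q, forall w, False}.
  by move: h0 Z_gt0; apply: filterS2 => w /(_ I)[->]; rewrite ltxx.
move=> [N [mN N0 sN]].
have NT : N = setT by apply/seteqP; split => // w _; apply: sN.
have := probability_setT Q; rewrite -NT N0 => /eqP.
by rewrite eq_sym onee_eq0.
Qed.

Lemma integrable_positive_sqr : ('E_Q[fun w => (Z w ^+ 2)%R] < +oo)%E ->
  Q.-integrable setT (EFin \o (fun w => `|Z w| ^+ 2)).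
Proof.
move=> Z2; apply/integrableP; split.
  by apply/measurable_EFinP; exact: measurable_funX.
rewrite (_ : (\int[Q]_w _)%E = 'E_Q[fun w => (Z w ^+ 2)%R]%E)// unlock.
by apply: eq_integral => w _; rewrite /= -normrX normr_id ger0_norm ?sqr_ge0.
Qed.

Lemma mean_positive_sqr : \int[Q]_w `|Z w| ^+ 2 = mean Q (fun w => Z w ^+ 2).
Proof.
rewrite /mean unlock /Rintegral; congr fine; apply: eq_integral => w _.
by rewrite real_normK ?num_real.
Qed.

End positive_variable.

(** The bounded continuous test function [f] vanishes on all workloads and is positive on negative
    numbers; its mean under the limit law is therefore 0. *)
Lemma steady_state_ge0 (R : realType) (dB : measure_display)
    (TB : measurableType dB) (Q : probability TB R) (B : queue -> {RV Q >-> R})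
    (lam c : queue -> R) q (nu : probability (measurableTypeR R) R) :
  steady_state_workload B lam c q nu -> {ae nu, forall x, (0 : R) <= x}.
Proof.
move=> [d [Om [P [X [j0 [_ cW]]]]]].
pose f (x : R) := Num.min 1 (Num.max 0 (- x)).
have f0 x : 0 <= f x by rewrite le_min ler01 le_max lexx.
have cf : continuous f.
  move=> x; apply: (@continuous_min _ _ (fun=> 1) (fun x : R => Num.max 0 (- x))); first exact: cvg_cst.
  apply: (@continuous_max _ _ (fun=> 0) (fun x : R => - x)); first exact: cvg_cst.
  by apply: cvgN.
have bf : exists M, forall x, `|f x| <= M.
  by exists 1 => x; rewrite ger0_norm// ge_min lexx.
have := cW f cf bf.
under eq_fun => t.
  under eq_integral => w _.
    rewrite (_ : f _ = 0); first over.
    by rewrite /f (max_l (_ : - _ <= 0)) ?oppr_le0 ?workload_ge0// min_r.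
  rewrite integral0; over.
move=> /cvg_lim; rewrite lim_cst// => /(_ _)/esym I0.
have mf : measurable_fun setT (EFin \o f : measurableTypeR R -> \bar R).
  by apply/measurable_EFinP; exact: continuous_measurable_fun.
have : (\int[nu]_x `|(EFin \o f) x|)%E = 0%E.
  by rewrite -[RHS]I0//; apply: eq_integral => x _; rewrite /= ger0_norm.
move=> /(ae_eq_integral_abs nu measurableT mf).
apply: filterS => x /(_ Logic.I)[] fx; rewrite leNgt; apply/negP => x0.
have : 0 < f x by rewrite lt_min ltr01 lt_max oppr_gt0 x0 orbT.
by rewrite fx ltxx.
Qed.

(** With [c = c1 + c2] and [K] the second-order remainder, [L / u = c2 / c - delta - l * u * K] and
    [(c2 + L) / (c + L) = c2 / c + L * c1 / (c * (c + L))]. The constants [c2 / c] cancel, and every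
    remaining term is of order [delta]. The term with [c1] yields the part of the mean due to the
    alternation of the server, the term with [K] the part due to the variability of the service
    times. *)
Lemma heavy_traffic_cvg (R : realType) (b : R -> R) (m1 m2 c1 c2 k : R)
    (l : nat -> R) :
  0 < m1 -> 0 < c1 -> 0 < c2 -> 0 < k ->
  (forall n, l n < c2 / (c1 + c2) / m1) ->
  l n @[n --> \oo] --> c2 / (c1 + c2) / m1 ->
  let delta n := c2 / (c1 + c2) - l n * m1 in
  let u n := k * delta n in
  let L n := l n * (1 - b (u n)) in
  (b (u n) - 1 + u n * m1) / u n ^+ 2 @[n --> \oo] --> m2 / 2 ->
  ((c2 + L n) / (c1 + c2 + L n) - L n / u n) / delta n @[n --> \oo] -->
    1 + k * (c1 * c2 / (c1 + c2) ^+ 3 + c2 / (c1 + c2) * (1 / 2) * (m2 / m1)).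
Proof.
move=> m10 c10 c20 k0 ll cl delta u L cK.
set c := c1 + c2; have c0 : 0 < c by exact: addr_gt0.
have delta0 n : 0 < delta n.
  by rewrite subr_gt0 -ltr_pdivlMr.
have u0 n : 0 < u n by exact: mulr_gt0.
pose K n := (b (u n) - 1 + u n * m1) / u n ^+ 2.
have LE n : L n = u n * (l n * m1 - l n * (u n * K n)).
  by rewrite /L /K; field; rewrite gt_eqF.
have cdelta : delta n @[n --> \oo] --> 0.
  rewrite [X in _ --> X](_ : 0 = c2 / c - c2 / c / m1 * m1); last first.
    by rewrite mulfVK ?gt_eqF// subrr.
  by apply: cvgB; [exact: cvg_cst | apply: cvgM => //; exact: cvg_cst].
have cu : u n @[n --> \oo] --> 0.
  by rewrite -[X in _ --> X](mulr0 k); apply: cvgM => //; exact: cvg_cst.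
have clm : l n * m1 @[n --> \oo] --> c2 / c.
  rewrite [X in _ --> X](_ : _ = c2 / c / m1 * m1); last by rewrite mulfVK ?gt_eqF.
  by apply: cvgM => //; exact: cvg_cst.
have cLd : k * (l n * m1 - l n * (u n * K n)) @[n --> \oo] --> k * (c2 / c).
  rewrite [X in _ --> X](_ : _ = k * (c2 / c - c2 / c / m1 * (0 * (m2 / 2)))); last first.
    by rewrite mul0r mulr0 subr0.
  apply: cvgM; first exact: cvg_cst.
  by apply: cvgB => //; apply: cvgM => //; exact: cvgM.
have cL : L n @[n --> \oo] --> 0.
  rewrite -[X in _ --> X](mul0r (k * (c2 / c))).
  rewrite (_ : L = fun n => delta n * (k * (l n * m1 - l n * (u n * K n)))); first exact: cvgM.
  by apply/funext => n; rewrite LE /u; ring.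
have ccL : (c + L n)^-1 @[n --> \oo] --> c^-1.
  apply: cvgV; first by rewrite gt_eqF.
  by rewrite -[X in _ --> X]addr0; apply: cvgD => //; exact: cvg_cst.
have cLn0 : \forall n \near \oo, c + L n != 0.
  have c0' : - c < 0 by rewrite oppr_lt0.
  have : \forall n \near \oo, - c < L n by exact: (cvgr_gt _ cL).
  by apply: filterS => n h; rewrite gt_eqF// -ltrBlDl sub0r.
set m := c1 * c2 / c ^+ 3 + _.
have -> : 1 + k * m = 1 + k * (c2 / c) * (c1 / c * c^-1) + c2 / c / m1 * k * (m2 / 2).
  by rewrite /m; field; rewrite !gt_eqF.
apply: cvg_trans.
  apply: near_eq_cvg; near=> n.
  suff -> : ((c2 + L n) / (c + L n) - L n / u n) / delta n =
    1 + k * (l n * m1 - l n * (u n * K n)) * (c1 / c * (c + L n)^-1) + l n * k * K n by [].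
  have d1 : delta n != 0 by rewrite gt_eqF.
  have e1 : c + L n != 0 by near: n.
  have -> : l n * m1 = c2 / c - delta n by rewrite /delta; ring.
  have LE' : L n = k * delta n * (c2 / c - delta n - l n * (u n * K n)).
    by rewrite LE /u /delta; ring.
  have -> : (c2 + L n) / (c + L n) = c2 / c + L n * (c1 / c * (c + L n)^-1).
    by rewrite /c; rewrite /c in e1; field; rewrite e1 gt_eqF// addr_gt0.
  move: (c + L n)^-1 => y; rewrite LE' /u; field.
  by rewrite d1 !gt_eqF.
apply: cvgD; first apply: cvgD.
- exact: cvg_cst.
- by apply: cvgM => //; apply: cvgM => //; exact: cvg_cst.
- by apply: cvgM => //; apply: cvgM => //; exact: cvg_cst.
Unshelve. all: end_near. Qed.

Lemma stationary_laplace (R : realType)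
    (dB : measure_display) (TB : measurableType dB) (Q : probability TB R)
    (B : queue -> {RV Q >-> R}) (lam c : queue -> R) (q : queue)
    (B_gt0 : forall i, {ae Q, forall w, 0 < B i w})
    (B_mean : ('E_Q[B q] < +oo)%E)
    (B_moment2 : ('E_Q[fun w => (B q w ^+ 2)%R] < +oo)%E)
    (lam0 : forall i, 0 < lam i) (c0 : forall i, 0 < c i)
    (d : measure_display) (T : measurableType d) (P : probability T R)
    (V : {RV P >-> R}) :
  steady_state_workload B lam c q (distribution P V) ->
  {ae P, forall w, 0 <= V w} /\
  forall s, 0 < s ->
    let L := lam q * (1 - \int[Q]_w expR (- (s * `|B q w|))) in
    \int[P]_w expR (- (s * `|V w|)) *
      ((c (other_queue q) + L) / (c q + c (other_queue q) + L) - L / s) =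
    c (other_queue q) / (c q + c (other_queue q)) - lam q * mean Q (B q).
Proof.
move=> steady.
have mV : measurable_fun setT (V : T -> measurableTypeR R).
  exact: (@measurable_funPT _ _ _ _ V).
pose nu : probability (measurableTypeR R) R := distribution P (mfun_of mV).
have steady' : steady_state_workload B lam c q nu by exact: steady.
split.
  have [N [mN N0 sN]] := steady_state_ge0 steady'.
  exists (V @^-1` N); split => //.
    by have := mV measurableT N mN; rewrite setTI.
  by move=> w /= h; apply: sN.
move=> s s0; rewrite -(mean_positive (B_gt0 q)).
rewrite /= -(transform_formula B_gt0 lam0 c0 (integrable_positive (B_gt0 q) B_mean)
  (integrable_positive_sqr B_moment2) steady' s0) /=; congr (_ * _).
have bg : bmeas ((fun x : R => expR (- (s * `|x|))) : measurableTypeR R -> R).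
  apply: bmeas01 => [|x].
    apply: measurableT_comp => //; apply: measurableT_comp => //.
    by apply: measurable_funM => //; exact: measurableT_comp.
  by rewrite expR_ge0/= -expR0 ler_expR oppr_le0 mulr_ge0// ltW.
by rewrite (bRintegral_pushforward P (mfun_of mV) bg).
Qed.

Theorem theorem4p2 (R : realType)
    (dB : measure_display) (TB : measurableType dB) (Q : probability TB R)
    (B : queue -> {RV Q >-> R}) (lambda2 : R) (c : queue -> R)
    (B_gt0 : forall i, {ae Q, forall w, 0 < B i w})
    (B_mean : forall i, ('E_Q[B i] < +oo)%E)
    (B1_moment2 : ('E_Q[fun w => (B Q1 w ^+ 2)%R] < +oo)%E)
    (c_gt0 : forall i, 0 < c i)
    (lambda2_gt0 : 0 < lambda2)
    (stable2 : lambda2 * mean Q (B Q2) < c Q1 / (c Q1 + c Q2))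
    (d : R -> measure_display) (T : forall l, measurableType (d l))
    (P : forall l, probability (T l) R) (V1 : forall l, {RV (P l) >-> R})
    (V1_steady : forall lambda1 : R, 0 < lambda1 ->
       lambda1 * mean Q (B Q1) < c Q2 / (c Q1 + c Q2) ->
       steady_state_workload B (fun i => if i is Q1 then lambda1 else lambda2)
         c Q1 (distribution (P lambda1) (V1 lambda1))) :
  cvg_in_law (c Q2 / (c Q1 + c Q2) / mean Q (B Q1))^'- P
    (fun lambda1 w =>
       (c Q2 / (c Q1 + c Q2) - lambda1 * mean Q (B Q1)) * V1 lambda1 w)
    (exponential_prob
       (c Q1 * c Q2 / (c Q1 + c Q2) ^+ 3 +
        c Q2 / (c Q1 + c Q2) * (1 / 2) *
          (mean Q (fun w => B Q1 w ^+ 2) / mean Q (B Q1)))^-1).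
Proof.
set m1 := mean Q (B Q1); set m2 := mean Q (fun w => B Q1 w ^+ 2).
set cc := c Q1 + c Q2; set m := _ + _ * (m2 / m1).
have m10 : 0 < m1 := mean_gt0 (B_gt0 Q1) (B_mean Q1).
have cc0 : 0 < cc by rewrite addr_gt0.
have m0 : 0 < m.
  apply: ltr_pwDl; first by rewrite divr_gt0 ?mulr_gt0 ?exprn_gt0.
  rewrite !mulr_ge0 ?invr_ge0 ?ler01 ?(ltW cc0) ?(ltW m10) ?(ltW (c_gt0 _))//.
  by rewrite /m2 -mean_positive_sqr; apply: Rintegral_ge0 => w _; exact: sqr_ge0.
have r0 : 0 < m^-1 by rewrite invr_gt0.
pose delta l := c Q2 / cc - l * m1.
have delta0 l : l < c Q2 / cc / m1 -> 0 < delta l.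
  by move=> lc; rewrite subr_gt0 -ltr_pdivlMr.
pose V l w := delta l * V1 l w.
have mV l : measurable_fun setT (V l).
  by apply: measurable_funM; [exact: measurable_cst | exact: measurable_funPT].
move=> f cf fM.
have bf : bmeas (f : measurableTypeR R -> R).
  by split => //; exact: continuous_measurable_fun.
have bf' : bmeas (f : R -> R) by exact: bf.
have bfV l : bmeas (fun w => f (V l w)) by exact: (bmeas_comp bf').
rewrite [X in _ --> X](_ : _ = (\int[exponential_law r0]_x f x)%:E); last first.
  by rewrite (EFin_Rintegral (exponential_law r0) bf).
apply: cvg_EFin.
  by apply: nearW => l; rewrite -[X in X \is a fin_num](EFin_Rintegral (P l) (bfV l)).
change ((fun l => \int[P l]_w f (V l w)) @ (c Q2 / cc / m1)^'- -->
  \int[exponential_law r0]_x f x).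
(* Passing to sequences below the critical rate keeps [delta (l n)] positive and suits the dominated
   convergence behind [laplace_second_order]. *)
apply/cvg_at_leftP => l [l_lt l_cvg].
(* [V1_steady] is available for positive arrival rates only; the critical rate is positive, so this
   holds eventually. *)
have l0 : \forall n \near \oo, 0 < l n.
  by apply: (cvgr_gt _ l_cvg); rewrite !divr_gt0.
have stat n : 0 < l n -> {ae P (l n), forall w, 0 <= V1 (l n) w} /\
    forall s, 0 < s ->
      let L := l n * (1 - \int[Q]_w expR (- (s * `|B Q1 w|))) in
      \int[P (l n)]_w expR (- (s * `|V1 (l n) w|)) *
        ((c Q2 + L) / (cc + L) - L / s) = delta (l n).
  move=> ln0; have lam0 i : 0 < (if i is Q1 then l n else lambda2) by case: i.
  apply: (stationary_laplace B_gt0 (B_mean Q1) B1_moment2 lam0 c_gt0).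
  by apply: V1_steady => //; rewrite -ltr_pdivlMr.
have laplace (k : nat) : \int[P (l n)]_w expR (- (k%:R * `|V (l n) w|)) @[n --> \oo] -->
    \int[exponential_law r0]_x expR (- (k%:R * `|x : R|)).
  rewrite integral_exponential_laplace//.
  (* The stationary formula requires [s > 0]; at 0 both transforms are 1. *)
  case: k => [|k].
    rewrite addr0 divff ?gt_eqF//.
    under eq_fun do under eq_Rintegral do rewrite mul0r oppr0 expR0.
    by under eq_fun do rewrite bRintegral_cst; exact: cvg_cst.
  have k0 : 0 < k.+1%:R :> R by rewrite ltr0n.
  have u0 n : 0 < k.+1%:R * delta (l n) by rewrite mulr_gt0 ?delta0.
  have cu : k.+1%:R * delta (l n) @[n --> \oo] --> 0.
    rewrite [X in _ --> X](_ : 0 = k.+1%:R * (c Q2 / cc - c Q2 / cc / m1 * m1)); last first.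
      by rewrite mulfVK ?gt_eqF// subrr mulr0.
    apply: cvgM; first exact: cvg_cst.
    by apply: cvgB; [exact: cvg_cst | apply: cvgM => //; exact: cvg_cst].
  have mB1 : measurable_fun setT (fun w => `|B Q1 w|).
    by apply: measurableT_comp => //; exact: measurable_funPT.
  have := laplace_second_order mB1 (fun w => normr_ge0 _)
    (integrable_positive (B_gt0 Q1) (B_mean Q1)) (integrable_positive_sqr B1_moment2) u0 cu.
  rewrite (mean_positive (B_gt0 Q1)) mean_positive_sqr -/m1 -/m2.
  move=> /(heavy_traffic_cvg (b := fun s => \int[Q]_w expR (- (s * `|B Q1 w|))) m10 (c_gt0 Q1) (c_gt0 Q2) k0 l_lt l_cvg) cH.
  rewrite (_ : m^-1 / _ = (1 + k.+1%:R * m)^-1); last first.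
    by rewrite -invfM mulrDr mulfV ?gt_eqF// [m * _]mulrC.
  pose L n := l n * (1 - \int[Q]_w expR (- (k.+1%:R * delta (l n) * `|B Q1 w|))).
  pose H n := (c Q2 + L n) / (cc + L n) - L n / (k.+1%:R * delta (l n)).
  have {}cH : (H n / delta (l n))^-1 @[n --> \oo] --> (1 + k.+1%:R * m)^-1.
    by apply: cvgV; [rewrite gt_eqF// addr_gt0// mulr_gt0 | exact: cH].
  apply: cvg_trans cH; apply: near_eq_cvg; near=> n.
  have ln0 : 0 < l n by near: n.
  have [_ /(_ _ (u0 n))/=] := stat n ln0.
  have -> : \int[P (l n)]_w expR (- (k.+1%:R * delta (l n) * `|V1 (l n) w|)) =
      \int[P (l n)]_w expR (- (k.+1%:R * `|V (l n) w|)).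
    apply: eq_Rintegral => w _.
    by rewrite /V normrM (ger0_norm (ltW (delta0 _ (l_lt n)))) mulrA.
  rewrite -/cc -/(L n) -/(H n) => pH; have d0 : delta (l n) != 0 by rewrite gt_eqF ?delta0.
  (* The transform times [H n] is [delta (l n)], which is not 0; hence the transform equals the
     inverse of [H n / delta (l n)]. *)
  have H0 : H n != 0 by apply: contra_neq d0 => H0; rewrite -pH H0 mulr0.
  by rewrite invf_div -pH mulfK.
have := @laplace_continuity R nat \oo _ _ (fun n => T (l n)) (fun n => P (l n))
  (fun n => V (l n)) (fun n => mV (l n)) (exponential_law r0) laplace f cf fM.
rewrite (exponential_law_norm r0 bf) => /(_ _) cabs.
apply: cvg_trans cabs; apply: near_eq_cvg; near=> n.
have ln0 : 0 < l n by near: n.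
have [V0 _] := stat n ln0; rewrite /Rintegral; congr fine; apply: ae_eq_integral => //.
- by apply/measurable_EFinP; exact: (bmeas_comp bf' (measurableT_comp (@normr_measurable _ setT) (mV (l n)))).1.
- by apply/measurable_EFinP; exact: (bfV (l n)).1.
by move: V0; apply: filterS => w V0 _; rewrite /= ger0_norm// mulr_ge0// ltW// delta0.
Unshelve. all: end_near. Qed.
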